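(* Let $\mathbf{M}$ be a weight sequence such that $\gamma(\mathbf{M})=\infty$ and $\sup_{k\in\mathbb{N}}\sqrt[k]{M_k/M_{k-1}}<\infty$, and let $\mathbf{T}$ be a weight sequence satisfying $\mathbf{T}\preceq\mathbf{M}^\rho$ for all $\rho>0$. Let $P$ be a non-elliptic linear differential operator of order $d\ge1$ with coefficients in $\mathcal{E}^{\{\mathbf{T}\}}(\Omega)$, $\Omega\subseteq\mathbb{R}^n$ open. Then there are a smooth function $u\in\mathcal{E}(\Omega)$ and some $\nu>1$ such that $$u\in\mathcal{E}^{(\mathbf{M})}(\Omega;P)\setminus\mathcal{E}^{\{\mathbf{M}\}}(\Omega)$$ and $u$ is an optimal function of $\mathcal{E}^{\{\mathbf{M}^\nu\}}(\Omega)$.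
   Context: $\mathbb{N}=\{1,2,\dots\}$. A weight sequence is a sequence $\mathbf{M}=(M_k)_{k\in\mathbb{N}_0}$ of positive numbers with $M_0=1\le M_1$ such that $\mu_k=M_k/M_{k-1}$ ($k\ge1$) is increasing and $\mu_k\to\infty$. For $\tau>0$, $\mathbf{M}^\tau=((M_k)^\tau)_k$. Index: $\gamma(\mathbf{M})=\sup\{\gamma>0: (\mu_k/k^\gamma)_{k\ge1}\text{ is almost increasing}\}\in[0,\infty]$ (with $\sup\emptyset=0$), where $(L_k)_k$ is almost increasing if there is $C>0$ with $L_j\le CL_k$ for all $j\le k$. $\mathbf{T}\preceq\mathbf{N}$ means there are $C,h>0$ with $T_k\le Ch^kN_k$ for all $k\in\mathbb{N}_0$; $\mathbf{T}\precnapprox\mathbf{N}$ means $\mathbf{T}\preceq\mathbf{N}$ but not $\mathbf{N}\preceq\mathbf{T}$. $\mathcal{E}(\Omega)$: smooth functions on $\Omega$. $\mathcal{E}^{\{\mathbf{M}\}}(\Omega)$: the $f\in\mathcal{E}(\Omega)$ such that for every compact $K\subset\Omega$ there are $C,h>0$ with $\sup_{x\in K}|D^\alpha f(x)|\le Ch^{|\alpha|}M_{|\alpha|}$ for all $\alpha\in\mathbb{N}_0^n$. A function $g\in\mathcal{E}(\Omega)$ is an optimal function of $\mathcal{E}^{\{\mathbf{N}\}}(\Omega)$ if $g\in\mathcal{E}^{\{\mathbf{N}\}}(\Omega)$ but $g\notin\mathcal{E}^{\{\mathbf{S}\}}(\Omega)$ for every weight sequence $\mathbf{S}\precnapprox\mathbf{N}$.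 For $P$ of order $d$, $\mathcal{E}^{(\mathbf{M})}(\Omega;P)$ is the set of distributions $u\in\mathcal{D}'(\Omega)$ with $P^ku\in L^2_{loc}(\Omega)$ for all $k\in\mathbb{N}_0$ ($P^0=\mathrm{Id}$) such that for all compact $K\subset\Omega$ and all $h>0$ there is $C>0$ with $\|P^ku\|_{L^2(K)}\le Ch^kM_{dk}$ for all $k\in\mathbb{N}_0$. $P=\sum_{|\alpha|\le d}p_\alpha(x)D^\alpha$ is elliptic in $\Omega$ if $p_d(x,\xi)=\sum_{|\alpha|=d}p_\alpha(x)\xi^\alpha\ne0$ for all $x\in\Omega$, $\xi\in\mathbb{R}^n\setminus\{0\}$; otherwise it is non-elliptic. *)

(* Defs.v *)
From HB Require Import structures.
From mathcomp Require Import all_boot all_order all_algebra.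
From mathcomp Require Import all_classical all_reals all_analysis.
From mathcomp Require Import complex.

Set Implicit Arguments.
Unset Strict Implicit.
Unset Printing Implicit Defensive.
Import Order.TTheory GRing.Theory Num.Theory.
Import numFieldNormedType.Exports.

Local Open Scope classical_set_scope.
Local Open Scope ring_scope.
Local Open Scope complex_scope.

Local Notation normc := ComplexField.Normc.normc.

(** * Weight sequences *)

Section WeightSequences.
Context {R : realType}.
Implicit Types M N S : nat -> R.

(* Meaningful for k >= 1 only. *)
Definition wquot M (k : nat) : R := M k / M k.-1.

(* "Increasing" is non-strict, i.e. M is logarithmically convex. *)
Definition weight_sequence M : Prop :=
  [/\ forall k, 0 < M k,
      M 0%N = 1 /\ 1 <= M 1%N,
      forall j k : nat, (1 <= j)%N -> (j <= k)%N -> wquot M j <= wquot M k &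
      wquot M k @[k --> \oo] --> +oo].

Definition wpow M (tau : R) : nat -> R := fun k => M k `^ tau.

(* For sequences indexed by k >= 1. *)
Definition almost_increasing (L : nat -> R) : Prop :=
  exists2 C : R, 0 < C &
    forall j k : nat, (1 <= j)%N -> (j <= k)%N -> L j <= C * L k.

(* The point 0 is added so that the supremum of the empty set is 0, whereas
   [ereal_sup set0] is [-oo]. *)
Definition gamma_index M : \bar R :=
  ereal_sup ([set 0%E] `|`
    [set g%:E | g in [set g : R | 0 < g /\
       almost_increasing (fun k => wquot M k / k%:R `^ g)]]).

Definition wle M N : Prop :=
  exists C h : R, [/\ 0 < C, 0 < h & forall k : nat, M k <= C * h ^+ k * N k].

Definition wlt M N : Prop := wle M N /\ ~ wle N M.

End WeightSequences.

(** * Complex-valued smooth functions on an open subset of R^n *)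

Section Smooth.
Context {R : realType} {n : nat}.
Implicit Types (f u : 'rV[R]_n -> R[i]) (Om K : set 'rV[R]_n).

Definition basis_vec (j : 'I_n) : 'rV[R]_n := delta_mx 0 j.

Definition re_part f (x : 'rV[R]_n) : R := complex.Re (f x).
Definition im_part f (x : 'rV[R]_n) : R := complex.Im (f x).

(* D_j = - i d/dx_j, the convention under which sum_a p_a(x) D^a has the
   symbol sum_a p_a(x) xi^a. *)
Definition Dj (j : 'I_n) f : 'rV[R]_n -> R[i] := fun x =>
  (0 -i* 1) * ('D_(basis_vec j) (re_part f) x +i* 'D_(basis_vec j) (im_part f) x).

Definition mdeg (a : 'I_n -> nat) : nat := (\sum_(j < n) a j)%N.

Definition Dmulti (a : 'I_n -> nat) f : 'rV[R]_n -> R[i] :=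
  foldr (fun j g => iter (a j) (Dj j) g) f (enum 'I_n).

(* Functions are total; only their values on the open set Om matter.  [f] is
   smooth on Om when every iterated partial derivative, in any order, is
   continuous on Om and again has partial derivatives there. *)
Definition smooth Om f : Prop :=
  forall (s : seq 'I_n) (x : 'rV[R]_n), Om x ->
    let g := foldr Dj f s in
    [/\ {for x, continuous (re_part g)}, {for x, continuous (im_part g)} &
        forall j, derivable (re_part g) x (basis_vec j) /\
                  derivable (im_part g) x (basis_vec j)].

(* The class E^{M}(Om). *)
Definition roumieu Om (M : nat -> R) f : Prop :=
  smooth Om f /\
  forall K, compact K -> K `<=` Om ->
    exists C h : R, [/\ 0 < C, 0 < h &
      forall (a : 'I_n -> nat) (x : 'rV[R]_n), K x ->
        normc (Dmulti a f x) <= C * h ^+ mdeg a * M (mdeg a)].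

Definition optimal Om (N : nat -> R) f : Prop :=
  roumieu Om N f /\
  forall S : nat -> R, weight_sequence S -> wlt S N -> ~ roumieu Om S f.

End Smooth.

(** * Lebesgue measure on R^n

    The library has no Lebesgue measure on ['rV[R]_n].  It is built on
    n-tuples, as an iterated product of the one-dimensional one, and integrals
    over ['rV[R]_n] are computed through [rV_of_tuple]. *)

Section LebesgueMeasure.
Context {R : realType}.

Local Notation tup n := (n.-tuple (measurableTypeR R)).

Definition tcons n (x : measurableTypeR R * tup n) : tup n.+1 :=
  [tuple of x.1 :: x.2].

Definition tuncons n (t : tup n.+1) : measurableTypeR R * tup n :=
  (thead t, [tuple of behead t]).

Lemma measurable_tcons n : measurable_fun [set: _] (@tcons n).
Proof. exact: measurable_cons. Qed.

Lemma measurable_tuncons n : measurable_fun [set: _] (@tuncons n).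
Proof.
apply: measurable_fun_pair; last exact: measurable_behead.
exact: measurable_tnth.
Qed.

Lemma tconsK n : cancel (@tcons n) (@tuncons n).
Proof.
move=> [x t]; rewrite /tuncons /tcons theadE; congr pair.
exact/val_inj.
Qed.

Section Step.
Variables (n : nat) (m : {sigma_finite_measure set (tup n) -> \bar R}).

Definition lebesgue_step : set (tup n.+1) -> \bar R :=
  pushforward (lebesgue_measure \x m)%E (@tcons n).

HB.instance Definition _ := Measure.copy lebesgue_step
  (measure_function_pushforward__canonical__measure_function_Measure
     (lebesgue_measure \x m)%E (@measurable_tcons n)).

Let lebesgue_step_sigma_finite : sigma_finite setT lebesgue_step.
Proof.
have [F UF mF] : sigma_finite setT (lebesgue_measure \x m)%E.
  have /sigma_finiteP[F [TF ndF Foo]] := sigma_finiteT (@lebesgue_measure R).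
  have /sigma_finiteP[G [TG ndG Goo]] := sigma_finiteT m.
  exists (fun k => F k `*` G k).
    rewrite -setXTT TF TG predeqE => -[x y]; split.
      move=> [/= [i _ Fix] [k _ Gky]]; exists (maxn i k) => //; split.
      - by move: x Fix; exact/subsetPset/ndF/leq_maxl.
      - by move: y Gky; exact/subsetPset/ndG/leq_maxr.
    by move=> [i _ []/= ? ?]; split; exists i.
  move=> k; have [? ?] := Foo k; have [? ?] := Goo k.
  split; first exact: measurableX.
  by rewrite product_measure1E// lte_mul_pinfty// ge0_fin_numE.
exists (fun i => @tuncons n @^-1` F i).
  by rewrite -preimage_bigcup -UF preimage_setT.
move=> i; have [mFi Fioo] := mF i; split.
  by rewrite -[X in measurable X]setTI; exact: measurable_tuncons.
rewrite /lebesgue_step /pushforward -comp_preimage.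
by rewrite (_ : @tuncons n \o @tcons n = id) //; apply/funext => x; exact: tconsK.
Qed.

HB.instance Definition _ := Measure_isSigmaFinite.Build _ _ _ lebesgue_step
  lebesgue_step_sigma_finite.

End Step.

Fixpoint lebesgue_nd (n : nat) : {sigma_finite_measure set (tup n) -> \bar R} :=
  match n with
  | 0 => [the {sigma_finite_measure set (tup 0) -> \bar R} of \d_ [tuple]]
  | k.+1 => [the {sigma_finite_measure set (tup k.+1) -> \bar R}
               of lebesgue_step (lebesgue_nd k)]
  end.

End LebesgueMeasure.

Section Integration.
Context {R : realType} {n : nat}.
Implicit Types (f g : 'rV[R]_n -> R[i]) (Om K A : set 'rV[R]_n).

Definition rV_of_tuple (t : n.-tuple (measurableTypeR R)) : 'rV[R]_n :=
  \row_j tnth t j.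

Definition measurable_on A f : Prop :=
  measurable_fun (rV_of_tuple @^-1` A) (re_part f \o rV_of_tuple) /\
  measurable_fun (rV_of_tuple @^-1` A) (im_part f \o rV_of_tuple).

Definition cintegral A f : R[i] :=
  (\int[lebesgue_nd n]_(t in rV_of_tuple @^-1` A) re_part f (rV_of_tuple t)) +i*
  (\int[lebesgue_nd n]_(t in rV_of_tuple @^-1` A) im_part f (rV_of_tuple t)).

Definition L2norm K f : \bar R :=
  sqrte (\int[lebesgue_nd n]_(t in rV_of_tuple @^-1` K)
           (normc (f (rV_of_tuple t)) ^+ 2)%:E)%E.

Definition L2loc Om f : Prop :=
  measurable_on Om f /\
  forall K, compact K -> K `<=` Om -> (L2norm K f < +oo)%E.

End Integration.

(** * Distributions *)

Section Distributions.
Context {R : realType} {n : nat}.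
Implicit Types (f g phi psi : 'rV[R]_n -> R[i]) (Om K : set 'rV[R]_n).

Definition supported_in K phi : Prop := forall x, ~ K x -> phi x = 0.

Definition test_function Om phi : Prop :=
  smooth setT phi /\
  exists K, [/\ compact K, K `<=` Om & supported_in K phi].

(* Only the values on test functions matter. *)
Definition functional : Type := ('rV[R]_n -> R[i]) -> R[i].

(* In the continuity estimate, B stands for any upper bound of
   max_{|a| <= N} sup |D^a phi|. *)
Definition is_distribution Om (T : functional) : Prop :=
  (forall (c : R[i]) phi psi, test_function Om phi -> test_function Om psi ->
     T (fun x => c * phi x + psi x) = c * T phi + T psi) /\
  forall K, compact K -> K `<=` Om ->
    exists (C : R) (N : nat), 0 < C /\
      forall phi, smooth setT phi -> supported_in K phi ->
      forall B : R,
        (forall (a : 'I_n -> nat) x, (mdeg a <= N)%N ->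
           normc (Dmulti a phi x) <= B) ->
        normc (T phi) <= C * B.

Definition regular_dist Om f : functional := fun phi =>
  cintegral Om (fun x => f x * phi x).

Definition represented_by Om (T : functional) f : Prop :=
  forall phi, test_function Om phi -> T phi = regular_dist Om f phi.

End Distributions.

(** * Linear differential operators *)

Section Operators.
Context {R : realType} {n d : nat}.

Definition mindex : Type := {ffun 'I_n -> 'I_d.+1}.

Definition mi (a : mindex) : 'I_n -> nat := fun j => a j.

(* The coefficients of sum_{|a| <= d} p_a(x) D^a; the [p a] with |a| > d are
   never used. *)
Definition diffop : Type := mindex -> 'rV[R]_n -> R[i].

Implicit Types (P : diffop) (Om K : set 'rV[R]_n).

Definition coefs_in Om (M : nat -> R) P : Prop :=
  forall a : mindex, (mdeg (mi a) <= d)%N -> roumieu Om M (P a).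

Definition has_order Om P : Prop :=
  exists (a : mindex) (x : 'rV[R]_n), [/\ mdeg (mi a) = d, Om x & P a x != 0].

Definition principal_symbol P (x xi : 'rV[R]_n) : R[i] :=
  \sum_(a : mindex | mdeg (mi a) == d) P a x * \prod_(j < n) (xi 0 j)%:C ^+ a j.

Definition elliptic Om P : Prop :=
  forall x xi : 'rV[R]_n, Om x -> xi != 0 -> principal_symbol P x xi != 0.

Definition transpose P (phi : 'rV[R]_n -> R[i]) : 'rV[R]_n -> R[i] := fun x =>
  \sum_(a : mindex | (mdeg (mi a) <= d)%N)
    (-1) ^+ mdeg (mi a) * Dmulti (mi a) (fun y => P a y * phi y) x.

(* P acting on distributions, <P T, phi> = <T, P^t phi>. *)
Definition apply_op P (T : @functional R n) : @functional R n := fun phi =>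
  T (transpose P phi).

(* The class E^{(M)}(Om; P) of distributions; [g k] is the function
   representing P^k T. *)
Definition beurling_iterates Om P (M : nat -> R) (T : @functional R n) : Prop :=
  is_distribution Om T /\
  exists g : nat -> 'rV[R]_n -> R[i],
    (forall k, L2loc Om (g k) /\
       represented_by Om (iter k (apply_op P) T) (g k)) /\
    forall K, compact K -> K `<=` Om -> forall h : R, 0 < h ->
      exists2 C : R, 0 < C & forall k : nat,
        (L2norm K (g k) <= (C * h ^+ k * M (d * k)%N)%:E)%E.

End Operators.

Arguments mindex : clear implicits.
Arguments diffop : clear implicits.

(* Main.v *)
(* Let x0 and xi <> 0 be such that the principal symbol of P vanishes at (x0, xi),
   let nu = 1 + 1/(4d) and N = M^nu.  Take
     u = sum_k a_k e^(i lam_k <x - x0, xi>) phi(kap_k (x - x0)),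
   where lam_k = (M_k / M_(k-1))^nu, kap_k = sqrt lam_k, a_k = N_k / (2 lam_k)^k and
   phi is a Gevrey function equal to 1 near 0.  Log-convexity of N gives
   a_k lam_k^m <= N_m / 2^k, with equality for m = k, so that u lies in E^{N} while
   the derivatives of u at x0 are at least of the size of N, up to a geometric
   factor: u is optimal, and in particular not in E^{M}.
   On the support of the k-th summand the symbol at xi is O(1 / kap_k), hence P acts
   on that summand with size lam_k^d / kap_k = lam_k^(d - 1/2) rather than lam_k^d,
   up to Gevrey factors and factors from T.  Thus P^m u is bounded in terms of
   M_(dm)^(nu (1 - 1/(2d))), where nu (1 - 1/(2d)) < 1, and gamma(M) = oo lets
   the remaining factors be absorbed by arbitrarily small powers of M. *)

Require Import Defs.
From mathcomp Require Import all_boot all_order all_algebra.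
From mathcomp Require Import all_classical all_reals all_analysis.
From mathcomp Require Import measurable_realfun complex ring lra.

Set Implicit Arguments.
Unset Strict Implicit.
Unset Printing Implicit Defensive.
Import Order.TTheory GRing.Theory Num.Theory.
Import numFieldNormedType.Exports.

Local Open Scope classical_set_scope.
Local Open Scope ring_scope.
Local Open Scope complex_scope.

Local Notation normc := ComplexField.Normc.normc.

(** * Derivatives of complex-valued smooth functions *)

(** Why kap_k is the square root of lam_k: on a box of radius about lam^(-s) the symbol, which
    vanishes at x0, is O(lam^(-s)), while a derivative that falls on the cutoff costs lam^s instead
    of lam. One application of P thus gains the smaller of lam^s and lam^(1-s) over lam^d, and s =
    1/2 balances the two. The obstacle is the iteration. P^m is not expanded; P is conjugated by the
    plane wave, and a one-step estimate for all derivatives at once is repeated m times. Each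
    multiplication by a coefficient raises the geometric rate of the derivatives by a fixed amount,
    so after m steps the constant is of size m^(dm) and no longer geometric. Such a factor is
    harmless because gamma(M) = oo puts every power of k! below every M^rho, up to a geometric
    factor. The same fact pays for the Gevrey cutoffs, which cannot be analytic since their supports
    are compact. Shrinking the supports does not spoil membership in E^{N}: a factor kap^j from j
    derivatives of the cutoff is half of lam^j on the logarithmic scale, and the other half is left
    for the Gevrey constants. *)

Section DirectionalCalculus.
Context {R : realType} {n : nat}.
Implicit Types (f g : 'rV[R]_n -> R[i]) (U : set 'rV[R]_n) (x : 'rV[R]_n).
Implicit Types (s : seq 'I_n) (j : 'I_n).

(** The condition that [smooth] puts on each iterated derivative, isolated at one function and one
    point so that the rules of calculus can propagate it. *)
Definition tame f x : Prop :=
  [/\ {for x, continuous (re_part f)}, {for x, continuous (im_part f)} &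
      forall j, derivable (re_part f) x (basis_vec j) /\
                derivable (im_part f) x (basis_vec j)].

Lemma DjE j f x : Dj j f x =
  'D_(basis_vec j) (im_part f) x -i* 'D_(basis_vec j) (re_part f) x.
Proof. by rewrite /Dj; congr Complex; rewrite /=; ring. Qed.

Lemma re_part_Dj j f :
  re_part (Dj j f) = (fun x => 'D_(basis_vec j) (im_part f) x).
Proof. by apply/funext => x; rewrite /re_part DjE. Qed.

Lemma im_part_Dj j f :
  im_part (Dj j f) = (fun x => - 'D_(basis_vec j) (re_part f) x).
Proof. by apply/funext => x; rewrite /im_part DjE. Qed.

Lemma re_partM f g : re_part (fun x => f x * g x) =
  re_part f * re_part g - im_part f * im_part g.
Proof.
apply/funext => x; rewrite -[RHS]/(complex.Re (f x) * complex.Re (g x) -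
  complex.Im (f x) * complex.Im (g x)) /re_part.
by case: (f x) (g x) => [? ?] [? ?].
Qed.

Lemma im_partM f g : im_part (fun x => f x * g x) =
  re_part f * im_part g + im_part f * re_part g.
Proof.
apply/funext => x; rewrite -[RHS]/(complex.Re (f x) * complex.Im (g x) +
  complex.Im (f x) * complex.Re (g x)) /im_part.
by case: (f x) (g x) => [? ?] [? ?].
Qed.

Lemma re_partD f g : re_part (fun x => f x + g x) = re_part f + re_part g.
Proof.
apply/funext => x; rewrite -[RHS]/(complex.Re (f x) + complex.Re (g x)) /re_part.
by case: (f x) (g x) => [? ?] [? ?].
Qed.

Lemma im_partD f g : im_part (fun x => f x + g x) = im_part f + im_part g.
Proof.
apply/funext => x; rewrite -[RHS]/(complex.Im (f x) + complex.Im (g x)) /im_part.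
by case: (f x) (g x) => [? ?] [? ?].
Qed.

Lemma tame_near f g x : (\near x, f x = g x) -> tame f x -> tame g x.
Proof.
move=> fg [cr ci df]; have fgx := nbhs_singleton fg.
have fgr : \near x, re_part f x = re_part g x by apply: filterS fg => y; rewrite /re_part => ->.
have fgi : \near x, im_part f x = im_part g x by apply: filterS fg => y; rewrite /im_part => ->.
split.
- rewrite /prop_for /continuous_at -(nbhs_singleton fgr).
  by apply: cvg_trans cr; exact: (near_eq_cvg fgr).
- rewrite /prop_for /continuous_at -(nbhs_singleton fgi).
  by apply: cvg_trans ci; exact: (near_eq_cvg fgi).
- by move=> j; have [dr di] := df j; split;
    [exact: near_eq_derivable fgr dr|exact: near_eq_derivable fgi di].
Qed.

Lemma Dj_near j f g x : (\near x, f x = g x) -> Dj j f x = Dj j g x.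
Proof.
move=> fg; rewrite !DjE; congr (_ -i* _); apply: near_eq_derive.
  by apply: filterS fg => y; rewrite /im_part => ->.
by apply: filterS fg => y; rewrite /re_part => ->.
Qed.

Lemma tame_cst (c : R[i]) x : tame (fun _ => c) x.
Proof.
have E (a : R) : {for x, continuous (fun _ : 'rV[R]_n => a)} by exact: (@cst_continuous _ _ a).
split => [||j]; [exact: E|exact: E|].
by split; [exact: (derivable_cst (complex.Re c))|exact: (derivable_cst (complex.Im c))].
Qed.

Lemma Dj_cst j (c : R[i]) x : Dj j (fun _ => c) x = 0.
Proof.
rewrite DjE (derive_cst (complex.Im c)) (derive_cst (complex.Re c)) oppr0.
by [].
Qed.

Lemma tameD f g x : tame f x -> tame g x -> tame (fun y => f y + g y) x.
Proof.
move=> [fr fi df] [gr gi dg]; split; rewrite ?re_partD ?im_partD.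
- exact: continuousD.
- exact: continuousD.
- move=> j; have [? ?] := df j; have [? ?] := dg j.
  by split; apply: derivableD.
Qed.

Lemma DjD j f g x : tame f x -> tame g x ->
  Dj j (fun y => f y + g y) x = Dj j f x + Dj j g x.
Proof.
move=> [_ _ /(_ j)[? ?]] [_ _ /(_ j)[? ?]].
rewrite !DjE re_partD im_partD (deriveD (f := re_part f)) // (deriveD (f := im_part f)) //.
by apply/eqP; rewrite eq_complex /= opprD !eqxx.
Qed.

Lemma tameM f g x : tame f x -> tame g x -> tame (fun y => f y * g y) x.
Proof.
move=> [fr fi df] [gr gi dg]; split; rewrite ?re_partM ?im_partM.
- by apply: continuousB; apply: continuousM.
- by apply: continuousD; apply: continuousM.
- move=> j; have [f1 f2] := df j; have [g1 g2] := dg j; split.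
    exact: (derivableB (derivableM f1 g1) (derivableM f2 g2)).
  exact: (derivableD (derivableM f1 g2) (derivableM f2 g1)).
Qed.

Lemma DjM j f g x : tame f x -> tame g x ->
  Dj j (fun y => f y * g y) x = Dj j f x * g x + f x * Dj j g x.
Proof.
move=> [_ _ /(_ j)[f1 f2]] [_ _ /(_ j)[g1 g2]].
rewrite !DjE re_partM im_partM.
rewrite (deriveD (derivableM f1 g2) (derivableM f2 g1)).
rewrite (deriveB (derivableM f1 g1) (derivableM f2 g2)).
rewrite (deriveM f1 g1) (deriveM f2 g2) (deriveM f1 g2) (deriveM f2 g1) /GRing.scale /=.
move: ('D_(basis_vec j) (re_part f) x) ('D_(basis_vec j) (im_part f) x) => a b.
move: ('D_(basis_vec j) (re_part g) x) ('D_(basis_vec j) (im_part g) x) => c d.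
rewrite /re_part /im_part; case: (f x) (g x) => [p q] [r t] /=.
by apply/eqP; rewrite eq_complex /=; apply/andP; split; apply/eqP; ring.
Qed.

(** Derivatives are indexed by words of directions instead of multi-indices: induction can then peel
    off one direction at either end. [dseq_Dmulti] translates back. *)
Definition dseq s f : 'rV[R]_n -> R[i] := foldr Dj f s.

Lemma dseq_rcons s j f : dseq (rcons s j) f = dseq s (Dj j f).
Proof. by rewrite /dseq foldr_rcons. Qed.

Lemma dseq_cat s t f : dseq (s ++ t) f = dseq s (dseq t f).
Proof. by rewrite /dseq foldr_cat. Qed.

Lemma smooth_tame U f x : smooth U f -> U x -> tame f x.
Proof. by move=> sf; exact: (sf [::]). Qed.

Lemma smooth_Dj U f j : smooth U f -> smooth U (Dj j f).
Proof. by move=> sf s x Ux; have := sf (rcons s j) x Ux; rewrite foldr_rcons. Qed.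

Lemma smooth_dseq U f s : smooth U f -> smooth U (dseq s f).
Proof. by move=> sf; elim: s => [//|j s IH]; exact: smooth_Dj. Qed.

Lemma smooth_subset U V f : U `<=` V -> smooth V f -> smooth U f.
Proof. by move=> UV sf s x /UV Vx; exact: sf. Qed.

Lemma dseq_eq U f g s x : open U -> (forall y, U y -> f y = g y) -> U x ->
  dseq s f x = dseq s g x.
Proof.
move=> oU fg; elim: s x => [|j s IH] x Ux; first exact: fg.
by apply: Dj_near; near=> y; apply: IH; near: y; exact: open_nbhs_nbhs.
Unshelve. all: by end_near. Qed.

Lemma smooth_eq U f g : open U -> (forall y, U y -> f y = g y) ->
  smooth U f -> smooth U g.
Proof.
move=> oU fg sf s x Ux; apply: (@tame_near (dseq s f)); last exact: sf.
by near=> y; apply: dseq_eq fg _ => //; near: y; exact: open_nbhs_nbhs.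
Unshelve. all: by end_near. Qed.

Lemma smooth_local U f : (forall x, U x -> exists V, [/\ open V, V x & smooth V f]) ->
  smooth U f.
Proof. by move=> h s x /h[V [oV Vx sV]]; exact: sV. Qed.

(** Smoothness cut into finite orders. The product rule replaces one product by a sum of two others,
    so closure under products needs an induction on the order in which both factors vary. *)
Fixpoint smoothN U N f : Prop :=
  match N with
  | 0 => forall x, U x -> tame f x
  | N'.+1 => (forall x, U x -> tame f x) /\ forall j, smoothN U N' (Dj j f)
  end.

Lemma smoothNP U f : smooth U f <-> forall N, smoothN U N f.
Proof.
split=> [sf N|sN s].
  elim: N f sf => [|N IH] f sf; first exact: (fun x => smooth_tame sf).
  split; first exact: (fun x => smooth_tame sf).
  by move=> j; apply: IH; exact: smooth_Dj.
move: s f sN; elim/last_ind => [|s j IH] f sN x Ux; first exact: (sN 0%N).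
by rewrite foldr_rcons; apply: IH => // N; have [_ /(_ j)] := sN N.+1.
Qed.

Lemma smoothN_S U N f : smoothN U N.+1 f -> smoothN U N f.
Proof.
elim: N f => [|N IH] f [tf sf]; first exact: tf.
by split; [exact: tf|move=> j; apply: IH; exact: sf].
Qed.

Lemma tame_eq U f g : open U -> (forall y, U y -> f y = g y) ->
  (forall x, U x -> tame f x) -> forall x, U x -> tame g x.
Proof.
move=> oU fg tf x Ux; apply: tame_near (tf x Ux).
by near=> y; apply: fg; near: y; exact: open_nbhs_nbhs.
Unshelve. all: by end_near. Qed.

Lemma smoothN_eq U N f g : open U -> (forall y, U y -> f y = g y) ->
  smoothN U N f -> smoothN U N g.
Proof.
move=> oU; elim: N f g => [|N IH] f g fg; first exact: tame_eq.
move=> [tf sf]; split; first exact: tame_eq fg tf.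
by move=> j; apply: IH (sf j) => y Uy; exact: (@dseq_eq U f g [:: j] y).
Qed.

Lemma smoothND U N f g : open U -> smoothN U N f -> smoothN U N g ->
  smoothN U N (fun x => f x + g x).
Proof.
move=> oU; elim: N f g => [|N IH] f g.
  by move=> tf tg x Ux; exact: tameD (tf _ Ux) (tg _ Ux).
move=> [tf sf] [tg sg]; split.
  by move=> x Ux; exact: tameD (tf _ Ux) (tg _ Ux).
move=> j; apply: (smoothN_eq oU _ (IH _ _ (sf j) (sg j))) => y Uy.
by rewrite (DjD _ (tf _ Uy) (tg _ Uy)).
Qed.

Lemma smoothNM U N f g : open U -> smoothN U N f -> smoothN U N g ->
  smoothN U N (fun x => f x * g x).
Proof.
move=> oU; elim: N f g => [|N IH] f g sf sg.
  by move=> x Ux; exact: tameM (sf _ Ux) (sg _ Ux).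
have [tf sf'] := sf; have [tg sg'] := sg.
split=> [x Ux|j]; first exact: tameM (tf _ Ux) (tg _ Ux).
have h := smoothND oU (IH _ _ (sf' j) (smoothN_S sg)) (IH _ _ (smoothN_S sf) (sg' j)).
apply: (smoothN_eq oU _ h) => y Uy.
by rewrite (DjM _ (tf _ Uy) (tg _ Uy)).
Qed.

Lemma smoothD U f g : open U -> smooth U f -> smooth U g ->
  smooth U (fun x => f x + g x).
Proof.
by move=> oU /smoothNP sf /smoothNP sg; apply/smoothNP => N; exact: smoothND.
Qed.

Lemma smoothM U f g : open U -> smooth U f -> smooth U g ->
  smooth U (fun x => f x * g x).
Proof.
by move=> oU /smoothNP sf /smoothNP sg; apply/smoothNP => N; exact: smoothNM.
Qed.

Lemma smooth_cst U (c : R[i]) : open U -> smooth U (fun _ => c).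
Proof.
move=> oU; apply/smoothNP => N; elim: N c => [|N IH] c.
  by move=> x _; exact: tame_cst.
split=> [x _|j]; first exact: tame_cst.
by apply: (smoothN_eq oU _ (IH 0)) => y Uy; rewrite Dj_cst.
Qed.

Lemma smooth_sum U I (r : seq I) (Q : pred I) (F : I -> 'rV[R]_n -> R[i]) :
  open U -> (forall i, Q i -> smooth U (F i)) ->
  smooth U (fun x => \sum_(i <- r | Q i) F i x).
Proof.
move=> oU sF; elim: r => [|i r IH].
  by apply: smooth_eq (smooth_cst 0 oU) => // y _; rewrite big_nil.
have [Qi|Qi] := boolP (Q i).
  by apply: smooth_eq (smoothD oU (sF _ Qi) IH) => // y _; rewrite big_cons Qi.
by apply: smooth_eq IH => // y _; rewrite big_cons (negbTE Qi).
Qed.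

Lemma dseqD U f g s x : open U -> smooth U f -> smooth U g -> U x ->
  dseq s (fun y => f y + g y) x = dseq s f x + dseq s g x.
Proof.
move=> oU sf sg; elim: s x => [//|j s IH] x Ux.
rewrite -[LHS]/(Dj j (dseq s (fun y => f y + g y)) x).
rewrite (@Dj_near j _ (fun y => dseq s f y + dseq s g y)).
  by rewrite (DjD _ (sf s _ Ux) (sg s _ Ux)).
by near=> y; apply: IH; near: y; exact: open_nbhs_nbhs.
Unshelve. all: by end_near. Qed.

Lemma dseqZ U (c : R[i]) f s x : open U -> smooth U f -> U x ->
  dseq s (fun y => c * f y) x = c * dseq s f x.
Proof.
move=> oU sf; elim: s x => [//|j s IH] x Ux.
rewrite -[LHS]/(Dj j (dseq s (fun y => c * f y)) x).
rewrite (@Dj_near j _ (fun y => c * dseq s f y)).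
  by rewrite (DjM _ (tame_cst _ _) (sf s _ Ux)) Dj_cst mul0r add0r.
by near=> y; apply: IH; near: y; exact: open_nbhs_nbhs.
Unshelve. all: by end_near. Qed.

Lemma dseq_cst s (c : R[i]) x : dseq s (fun _ => c) x = if s is [::] then c else 0.
Proof.
case: s => [//|j s]; elim: s j x => [|i s IH] j x; first exact: Dj_cst.
rewrite -[LHS]/(Dj j (dseq (i :: s) (fun=> c)) x).
rewrite (@Dj_near j _ (fun _ => 0)) ?Dj_cst //.
by near=> y; exact: IH.
Unshelve. all: by end_near. Qed.

Lemma dseq_sum U I (r : seq I) (Q : pred I) (F : I -> 'rV[R]_n -> R[i]) s x :
  open U -> (forall i, Q i -> smooth U (F i)) -> U x ->
  dseq s (fun y => \sum_(i <- r | Q i) F i y) x = \sum_(i <- r | Q i) dseq s (F i) x.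
Proof.
move=> oU sF Ux; elim: r => [|i r IH].
  rewrite big_nil (@dseq_eq U _ (fun _ => 0)) ?dseq_cst; first by case: s.
  - by [].
  - by move=> y _; rewrite big_nil.
  - by [].
rewrite big_cons; have [Qi|Qi] := boolP (Q i).
  rewrite (@dseq_eq U _ (fun y => F i y + \sum_(i <- r | Q i) F i y)) //.
    by rewrite (@dseqD U _ _ _ _ oU (sF _ Qi) (smooth_sum r oU sF) Ux) IH.
  by move=> y _; rewrite big_cons Qi.
rewrite -IH; apply: (@dseq_eq U) => // y _.
by rewrite big_cons (negbTE Qi).
Qed.

Definition mseq (a : 'I_n -> nat) : seq 'I_n :=
  flatten [seq nseq (a j) j | j <- enum 'I_n].

Lemma Dmulti_mseq (a : 'I_n -> nat) f : Dmulti a f = dseq (mseq a) f.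
Proof.
rewrite /Dmulti /mseq; elim: (enum 'I_n) => [//|j r IH] /=.
by rewrite dseq_cat -IH; elim: (a j) => [//|k IHk] /=; rewrite IHk.
Qed.

Lemma size_mseq (a : 'I_n -> nat) : size (mseq a) = mdeg a.
Proof.
rewrite /mseq size_flatten /shape -map_comp sumnE big_map /mdeg big_enum /=.
by apply: eq_bigr => j _; rewrite size_nseq.
Qed.

Lemma count_mseq (a : 'I_n -> nat) j : count_mem j (mseq a) = a j.
Proof.
rewrite /mseq count_flatten -map_comp sumnE big_map big_enum /=.
rewrite (bigD1 j) //= count_nseq /= eqxx mul1n big1 ?addn0 // => i ij.
by rewrite count_nseq /= (negbTE ij).
Qed.

End DirectionalCalculus.

(** * The modulus of complex numbers *)

Section Modulus.
Context {R : realType}.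
Implicit Types z : R[i].

Lemma normc_ge0 z : 0 <= normc z.
Proof. by case: z => a b; rewrite /= sqrtr_ge0. Qed.

Lemma normcD z1 z2 : normc (z1 + z2) <= normc z1 + normc z2.
Proof. exact: complex.le_normcD. Qed.

Lemma normcM z1 z2 : normc (z1 * z2) = normc z1 * normc z2.
Proof. exact: ComplexField.Normc.normcM. Qed.

Lemma normc_real (a : R) : normc (a%:C) = `|a|.
Proof. by rewrite /= expr0n addr0 sqrtr_sqr. Qed.

Lemma Re_le_normc z : `|complex.Re z| <= normc z.
Proof.
by case: z => a b /=; rewrite -sqrtr_sqr ler_wsqrtr // lerDl sqr_ge0.
Qed.

Lemma Im_le_normc z : `|complex.Im z| <= normc z.
Proof.
by case: z => a b /=; rewrite -sqrtr_sqr ler_wsqrtr // lerDr sqr_ge0.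
Qed.

Lemma normc_le_ReIm z : normc z <= `|complex.Re z| + `|complex.Im z|.
Proof.
case: z => a b /=.
rewrite -[leRHS]ger0_norm ?addr_ge0 // -[leRHS]sqrtr_sqr.
rewrite ler_wsqrtr // sqrrD !real_normK ?num_real //.
by rewrite lerD2r lerDl mulrn_wge0 // mulr_ge0.
Qed.

Lemma normc_sum I (r : seq I) (Q : pred I) (F : I -> R[i]) :
  normc (\sum_(i <- r | Q i) F i) <= \sum_(i <- r | Q i) normc (F i).
Proof.
elim/big_rec2: _ => [|i y1 y2 _ h]; first by rewrite ComplexField.Normc.normc0.
by apply: le_trans (normcD _ _) _; rewrite lerD2l.
Qed.

Lemma normcX z k : normc (z ^+ k) = normc z ^+ k.
Proof.
by elim: k => [|k IH]; rewrite ?expr0 ?ComplexField.Normc.normc1 // !exprS normcM IH.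
Qed.

End Modulus.

(** * Bounds on all derivatives at once, and their behaviour under products *)

Section LeibnizBounds.
Context {R : realType} {n : nat}.
Implicit Types (f g : 'rV[R]_n -> R[i]) (U : set 'rV[R]_n) (a b c : nat -> R).

(** The binomial convolution of [a] and [b], the sum of binom(m,i) a_i b_(m-i), written through the
    recursion that the product rule produces, so that no binomial coefficient appears. *)
Fixpoint lconv (m : nat) a b : R :=
  if m is m'.+1 then lconv m' (a \o S) b + lconv m' a (b \o S) else a 0%N * b 0%N.

(** The binomial theorem in recursive form: shifting [a] or [b] multiplies the constant [A] by [x]
    or by [y]. *)
Lemma lconv_le a b c (A x y : R) m :
  (forall i j, a i * b j <= A * x ^+ i * y ^+ j * c (i + j)%N) ->
  lconv m a b <= A * (x + y) ^+ m * c m.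
Proof.
elim: m a b c A => [|m IH] a b c A h /=.
  by have := h 0%N 0%N; rewrite !expr0 !mulr1 addn0.
have h1 : lconv m (a \o S) b <= (A * x) * (x + y) ^+ m * (c \o S) m.
  apply: IH => i j /=; apply: le_trans (h _ _) _.
  by rewrite addSn exprS le_eqVlt; apply/orP; left; apply/eqP; ring.
have h2 : lconv m a (b \o S) <= (A * y) * (x + y) ^+ m * (c \o S) m.
  apply: IH => i j /=; apply: le_trans (h _ _) _.
  by rewrite addnS exprS le_eqVlt; apply/orP; left; apply/eqP; ring.
apply: le_trans (lerD h1 h2) _.
by rewrite exprS le_eqVlt; apply/orP; left; apply/eqP => /=; ring.
Qed.

Definition bdd U c f : Prop :=
  forall (s : seq 'I_n) x, U x -> normc (dseq s f x) <= c (size s).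

Lemma bdd_Dj U c f j : bdd U c f -> bdd U (c \o S) (Dj j f).
Proof.
by move=> bf s x Ux; have := bf (rcons s j) x Ux; rewrite dseq_rcons size_rcons.
Qed.

Lemma bdd_le U c c' f : (forall k, c k <= c' k) -> bdd U c f -> bdd U c' f.
Proof. by move=> cc bf s x Ux; apply: le_trans (bf s x Ux) _. Qed.

Lemma bdd_subset U V c f : U `<=` V -> bdd V c f -> bdd U c f.
Proof. by move=> UV bf s x /UV; exact: bf. Qed.

Lemma bdd_eq U c f g : open U -> (forall x, U x -> f x = g x) ->
  bdd U c f -> bdd U c g.
Proof. by move=> oU fg bf s x Ux; rewrite -(dseq_eq s oU fg Ux); exact: bf. Qed.

Lemma bddD U a b f g : open U -> smooth U f -> smooth U g ->
  bdd U a f -> bdd U b g -> bdd U (fun k => a k + b k) (fun x => f x + g x).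
Proof.
move=> oU sf sg bf bg s x Ux; rewrite (dseqD s oU sf sg Ux).
by apply: le_trans (normcD _ _) _; apply: lerD; [exact: bf|exact: bg].
Qed.

Lemma bddZ U a (z : R[i]) f : open U -> smooth U f ->
  bdd U a f -> bdd U (fun k => normc z * a k) (fun x => z * f x).
Proof.
move=> oU sf bf s x Ux; rewrite (dseqZ z s oU sf Ux) normcM.
by apply: ler_wpM2l; [exact: normc_ge0|exact: bf].
Qed.

(** The product rule is applied to the innermost derivative, so that the induction hypothesis meets
    two products again and matches the recursion of [lconv]. *)
Lemma bddM U a b f g : open U -> smooth U f -> smooth U g ->
  bdd U a f -> bdd U b g -> bdd U (fun k => lconv k a b) (fun x => f x * g x).
Proof.
move=> oU + + + + s; move: s f g a b; elim/last_ind => [|s j IH] f g a b sf sg bf bg x Ux.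
  rewrite /= normcM; apply: ler_pM; [exact: normc_ge0|exact: normc_ge0| |].
    exact: (bf [::]).
  exact: (bg [::]).
rewrite dseq_rcons size_rcons.
have E y : U y -> Dj j (fun z => f z * g z) y = Dj j f y * g y + f y * Dj j g y.
  by move=> Uy; rewrite (DjM _ (smooth_tame sf Uy) (smooth_tame sg Uy)).
have sfj := smooth_Dj j sf; have sgj := smooth_Dj j sg.
rewrite (dseq_eq s oU E Ux) (dseqD s oU (smoothM oU sfj sg) (smoothM oU sf sgj) Ux).
apply: le_trans (normcD _ _) _; apply: lerD.
  exact: (IH _ _ _ _ sfj sg (bdd_Dj j bf) bg).
exact: (IH _ _ _ _ sf sgj bf (bdd_Dj j bg)).
Qed.

Lemma bdd_sum U I (r : seq I) (Q : pred I) (F : I -> 'rV[R]_n -> R[i]) (a : I -> nat -> R) :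
  open U -> (forall i, Q i -> smooth U (F i)) -> (forall i, Q i -> bdd U (a i) (F i)) ->
  bdd U (fun k => \sum_(i <- r | Q i) a i k) (fun x => \sum_(i <- r | Q i) F i x).
Proof.
move=> oU sF bF s x Ux; rewrite (dseq_sum r s oU sF Ux).
apply: le_trans (normc_sum _ _ _) _; apply: ler_sum => i Qi; exact: bF.
Qed.

End LeibnizBounds.

(** * Mean values along lines and second differences *)

Section MeanValue.
Context {R : realType} {n : nat}.
Implicit Types (F : 'rV[R]_n -> R) (x v w : 'rV[R]_n) (U : set 'rV[R]_n).

Lemma is_derive_line F x v (t : R) : derivable F (x + t *: v) v ->
  is_derive t 1 (fun r => F (x + r *: v)) ('D_v F (x + t *: v)).
Proof.
have E : (fun h : R => h^-1 *: (F (x + (h *: (1 : R) + t) *: v) - F (x + t *: v))) =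
   (fun h : R => h^-1 *: (F (h *: v + (x + t *: v)) - F (x + t *: v))).
  apply/funext => h; congr (_ *: (F _ - _)).
  by rewrite (_ : h *: (1 : R) = h); [rewrite scalerDl addrCA|exact: mulr1].
move=> dF; apply: DeriveDef; first by rewrite /derivable E.
by rewrite /derive E.
Qed.

Lemma mvt_line F x v (h : R) : 0 <= h ->
  (forall t, 0 <= t <= h -> derivable F (x + t *: v) v) ->
  exists2 t, 0 <= t <= h & F (x + h *: v) - F x = h * 'D_v F (x + t *: v).
Proof.
move=> h0 dF; pose g (r : R) := F (x + r *: v).
have dg t : 0 <= t <= h -> is_derive t 1 g ('D_v F (x + t *: v)).
  by move=> /dF; exact: is_derive_line.
have cg : {within `[0, h], continuous g}.
  apply: derivable_within_continuous => t; rewrite in_itv /= => /dg dt.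
  exact: ex_derive.
have dg' t : t \in `]0, h[%R -> is_derive t 1 g ('D_v F (x + t *: v)).
  by rewrite in_itv /= => /andP[/ltW t0 /ltW th]; apply: dg; rewrite t0.
have [t] := MVT_segment h0 dg' cg.
rewrite in_itv /= => t0h; rewrite /g scale0r addr0 subr0 mulrC => E.
by exists t.
Qed.

Lemma nbhs_plane x v w (A : set 'rV[R]_n) : nbhs x A ->
  exists2 e : R, 0 < e & forall a b : R, `|a| <= e -> `|b| <= e -> A (x + a *: v + b *: w).
Proof.
move=> /nbhs_ballP[d /= d0 dA]; pose K := `|v| + `|w| + 1.
have K0 : 0 < K by rewrite ltr_wpDl // addr_ge0.
exists (d / (2 * K)); first by rewrite divr_gt0 // mulr_gt0.
move=> a b ha hb; apply: dA; rewrite -ball_normE /ball_ /= !opprD addrA addrA subrr add0r.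
apply: le_lt_trans (ler_normB _ _) _; rewrite normrN !normrZ.
apply: le_lt_trans (lerD (ler_wpM2r _ ha) (ler_wpM2r _ hb)) _ => //.
rewrite -mulrDr; apply: (@le_lt_trans _ _ (d / (2 * K) * K)).
  by rewrite ler_wpM2l ?ltW ?divr_gt0 ?mulr_gt0 // ltrDl.
rewrite invfM mulrA -mulrA mulVf ?gt_eqF // mulr1 ltr_pdivrMr //.
by rewrite ltr_pMr // ltr1n.
Qed.

(** Two mean value theorems: one in direction [v] for the increment of [F] along [e *: w], then one
    in direction [w] for the derivative of [F] along [v]. *)
Lemma second_difference F x v w (e : R) : 0 < e ->
  (forall a b, `|a| <= e -> `|b| <= e -> derivable F (x + a *: v + b *: w) v) ->
  (forall a b, `|a| <= e -> `|b| <= e -> derivable ('D_v F) (x + a *: v + b *: w) w) ->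
  exists a b, [/\ `|a| <= e, `|b| <= e &
   F (x + e *: v + e *: w) - F (x + e *: v) - (F (x + e *: w) - F x) =
   e * e * 'D_w ('D_v F) (x + a *: v + b *: w)].
Proof.
move=> e0 dF ddF; have e0' := ltW e0.
pose G y := F (y + e *: w) - F y.
have dG t : 0 <= t <= e -> derivable G (x + t *: v) v /\
    'D_v G (x + t *: v) = 'D_v F (x + t *: v + e *: w) - 'D_v F (x + t *: v).
  move=> /andP[t0 te].
  have d1 : derivable F (x + t *: v + e *: w) v by apply: dF; rewrite ger0_norm.
  have d2 : derivable F (x + t *: v) v.
    by have := dF t 0; rewrite scale0r addr0; apply; rewrite ?normr0 // ger0_norm.
  have sh : is_derive (x + t *: v) v (fun y => F (y + e *: w)) ('D_v F (x + t *: v + e *: w)).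
    have E : (fun h : R => h^-1 *: (F (h *: v + (x + t *: v) + e *: w) - F (x + t *: v + e *: w)))
       = (fun h : R => h^-1 *: (F (h *: v + (x + t *: v + e *: w)) - F (x + t *: v + e *: w))).
      by apply/funext => h; rewrite -(addrA (h *: v)).
    apply: DeriveDef; last by rewrite /derive E.
    by rewrite /derivable E; exact: d1.
  have [dsh vsh] := sh.
  split; first exact: (derivableB dsh d2).
  by rewrite (deriveB dsh d2) vsh.
have [a a0e E] := mvt_line e0' (fun t ht => (dG t ht).1).
have [/andP[a0 ae]] := (a0e, tt); move=> _.
have [b b0e E'] : exists2 b, 0 <= b <= e & 'D_v F (x + a *: v + e *: w) - 'D_v F (x + a *: v)
     = e * 'D_w ('D_v F) (x + a *: v + b *: w).
  apply: (@mvt_line ('D_v F) (x + a *: v) w e e0') => t /andP[t0 te].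
  by apply: ddF; rewrite ger0_norm.
have [/andP[b0 be]] := (b0e, tt); move=> _.
exists a, b; rewrite !ger0_norm //; split => //.
by rewrite -mulrA -E' -(dG a a0e).2 -E /G.
Qed.

(** The second difference is symmetric in [v] and [w], so the two mixed derivatives agree at two
    points arbitrarily close to [x]; continuity at [x] does the rest. *)
Lemma schwarz F x v w U : open U -> U x ->
  (forall y, U y -> derivable F y v /\ derivable F y w) ->
  (forall y, U y -> derivable ('D_v F) y w /\ derivable ('D_w F) y v) ->
  {for x, continuous ('D_w ('D_v F))} -> {for x, continuous ('D_v ('D_w F))} ->
  'D_w ('D_v F) x = 'D_v ('D_w F) x.
Proof.
move=> oU Ux d1 d2 c1 c2; apply/eqP; rewrite -subr_eq0 -normr_eq0 eq_le normr_ge0 andbT.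
apply/ler_addgt0Pr => eps eps0; rewrite add0r.
have e2 : 0 < eps / 2 by rewrite divr_gt0.
have n1 : \forall y \near x, U y /\ `|'D_w ('D_v F) x - 'D_w ('D_v F) y| < eps / 2 /\
    `|'D_v ('D_w F) x - 'D_v ('D_w F) y| < eps / 2.
  apply: filterI; first exact: open_nbhs_nbhs.
  move/cvgrPdist_lt: c1 => /(_ _ e2) c1; move/cvgrPdist_lt: c2 => /(_ _ e2) c2.
  exact: (filterI c1 c2).
have [e e0 he] := nbhs_plane v w n1.
have [a [b [ha hb E1]]] := second_difference e0
  (fun p q hp hq => (d1 _ (he p q hp hq).1).1) (fun p q hp hq => (d2 _ (he p q hp hq).1).1).
have he' p q : `|p| <= e -> `|q| <= e -> U (x + p *: w + q *: v).
  by move=> hp hq; rewrite addrAC; exact: (he q p hq hp).1.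
have [b' [a' [hb' ha' E2]]] := second_difference e0
  (fun p q hp hq => (d1 _ (he' p q hp hq)).2) (fun p q hp hq => (d2 _ (he' p q hp hq)).2).
have [_ [h1 _]] := he a b ha hb.
have [_ [_ h2]] := he a' b' ha' hb'.
have pE : x + b' *: w + a' *: v = x + a' *: v + b' *: w by rewrite addrAC.
have qE : x + e *: w + e *: v = x + e *: v + e *: w by rewrite addrAC.
rewrite pE qE in E2; move: h1 h2 E1 E2.
move: ('D_w ('D_v F) x) ('D_v ('D_w F) x) ('D_w ('D_v F) (x + a *: v + b *: w))
  ('D_v ('D_w F) (x + a' *: v + b' *: w)) => p q p' q' h1 h2 E1 E2.
have {E1 E2} E : p' = q'.
  by apply: (mulfI (lt0r_neq0 (mulr_gt0 e0 e0))); rewrite -E1 -E2; ring.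
rewrite (_ : p - q = (p - p') - (q - q')); last by rewrite E; ring.
apply: le_trans (ler_normB _ _) _; apply: ltW.
by rewrite [ltRHS]splitr ltrD.
Qed.

End MeanValue.

(** * Symmetry of iterated derivatives; from words to multi-indices *)

Section Schwarz.
Context {R : realType} {n : nat}.
Implicit Types (f g : 'rV[R]_n -> R[i]) (U : set 'rV[R]_n) (i j : 'I_n).

Lemma derivable_derive_im U f i j y : smooth U f -> U y ->
  derivable ('D_(basis_vec j) (im_part f)) y (basis_vec i).
Proof.
by move=> sf Uy; have [_ _ /(_ i)[]] := sf [:: j] y Uy; rewrite /= re_part_Dj.
Qed.

Lemma im_schwarz U f i j x : open U -> smooth U f -> U x ->
  'D_(basis_vec i) ('D_(basis_vec j) (im_part f)) x =
  'D_(basis_vec j) ('D_(basis_vec i) (im_part f)) x.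
Proof.
move=> oU sf Ux.
have cont k l : {for x, continuous ('D_(basis_vec k) ('D_(basis_vec l) (im_part f)))}.
  have [_ + _] := sf [:: k; l] x Ux; rewrite /= im_part_Dj re_part_Dj => h.
  suff -> : 'D_(basis_vec k) ('D_(basis_vec l) (im_part f)) =
      (fun y => - (- 'D_(basis_vec k) ('D_(basis_vec l) (im_part f)) y)).
    exact: (continuousN h).
  by apply/funext => y; rewrite opprK.
apply: (schwarz oU Ux _ _ (cont i j) (cont j i)).
- by move=> y Uy; have [_ _ d] := sf [::] y Uy; split; [case: (d j)|case: (d i)].
- by move=> y Uy; split; exact: derivable_derive_im sf Uy.
Qed.

(** Multiplication by the imaginary unit turns the real part into an imaginary part, for which the
    claim is known. *)
Lemma re_schwarz U f i j x : open U -> smooth U f -> U x ->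
  'D_(basis_vec i) ('D_(basis_vec j) (re_part f)) x =
  'D_(basis_vec j) ('D_(basis_vec i) (re_part f)) x /\
  derivable ('D_(basis_vec j) (re_part f)) x (basis_vec i).
Proof.
move=> oU sf Ux; pose g y := (0 +i* 1) * f y.
have sg : smooth U g := smoothM oU (smooth_cst _ oU) sf.
have E : re_part f = im_part g.
  by apply/funext => y; rewrite /re_part /im_part /g; case: (f y) => a b /=; ring.
rewrite E; split; first exact: im_schwarz sg Ux.
exact: derivable_derive_im sg Ux.
Qed.

Lemma DjC U f i j x : open U -> smooth U f -> U x -> Dj i (Dj j f) x = Dj j (Dj i f) x.
Proof.
move=> oU sf Ux.
rewrite (DjE i) (DjE j (Dj i f)) (re_part_Dj j) (re_part_Dj i) (im_part_Dj j) (im_part_Dj i).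
have [r1 d1] := re_schwarz i j oU sf Ux; have [_ d2] := re_schwarz j i oU sf Ux.
by rewrite (im_schwarz i j oU sf Ux) (deriveN d1) (deriveN d2) r1.
Qed.

Lemma dseq_perm U f s t x : open U -> smooth U f -> perm_eq s t -> U x ->
  dseq s f x = dseq t f x.
Proof.
move=> oU sf.
have mv i (t1 t2 : seq 'I_n) y : U y -> dseq (t1 ++ i :: t2) f y = dseq (i :: t1 ++ t2) f y.
  elim: t1 y => [//|j t1 IH] y Uy.
  rewrite -[LHS]/(dseq [:: j] (dseq (t1 ++ i :: t2) f) y).
  rewrite (@dseq_eq _ _ U _ (dseq (i :: t1 ++ t2) f) [:: j] y oU IH Uy).
  exact: (DjC j i oU (smooth_dseq (t1 ++ t2) sf) Uy).
elim: s t x => [|i s IH] t x pst Ux; first by move: pst; rewrite perm_sym => /perm_nilP ->.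
have it : i \in t by rewrite -(perm_mem pst) mem_head.
case/splitPr: it pst => t1 t2 pst; rewrite mv //.
apply: (@dseq_eq _ _ U _ _ [:: i] x oU _ Ux) => y Uy; apply: IH Uy.
by move: pst; rewrite perm_sym -cat1s perm_catCA /= perm_cons perm_sym.
Qed.

(** Carries the estimates of [roumieu], stated for multi-indices, over to all words and back. *)
Lemma dseq_Dmulti U f s x : open U -> smooth U f -> U x ->
  dseq s f x = Dmulti (fun j => count_mem j s) f x.
Proof.
move=> oU sf Ux; rewrite Dmulti_mseq; apply: dseq_perm oU sf _ Ux.
by apply/allP => j _ /=; rewrite count_mseq.
Qed.

Lemma mdeg_count (s : seq 'I_n) : mdeg (fun j => count_mem j s) = size s.
Proof.
rewrite -size_mseq; apply: perm_size.
by apply/allP => j _ /=; rewrite count_mseq.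
Qed.

End Schwarz.

(** * Weight sequences *)

Section RealPowers.
Context {R : realType}.
Implicit Types x y r : R.

Lemma powR_homo r x y : 0 <= r -> 0 <= x -> x <= y -> x `^ r <= y `^ r.
Proof.
by move=> r0 x0 xy; apply: ge0_ler_powR => //; rewrite nnegrE // (le_trans x0).
Qed.

Lemma powR_exprn r x k : 0 <= x -> (x ^+ k) `^ r = (x `^ r) ^+ k.
Proof.
by move=> x0; rewrite -powR_mulrn // -powRrM mulrC powRrM powR_mulrn // powR_ge0.
Qed.

Lemma powR_sum r s x : 0 < x -> x `^ (r + s) = x `^ r * x `^ s.
Proof. by move=> x0; rewrite powRD // (gt_eqF x0) implybT. Qed.

Lemma powR_ge1 r x : 1 <= x -> 0 <= r -> 1 <= x `^ r.
Proof. by move=> x1 r0; have := powR_homo r0 ler01 x1; rewrite powR1. Qed.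

End RealPowers.

Section WeightTheory.
Context {R : realType}.
Variable M : nat -> R.
Hypothesis hM : weight_sequence M.
Local Notation mu := (wquot M).

Lemma weight_gt0 k : 0 < M k. Proof. by case: hM. Qed.
Local Hint Resolve weight_gt0 : core.

Lemma weight0 : M 0%N = 1. Proof. by case: hM => _ []. Qed.

(** The default value [0.-1 = 0] makes this quotient 1, which extends the monotonicity of [mu] to
    the index 0. *)
Lemma wquot0 : mu 0%N = 1.
Proof. by rewrite /wquot /= divff // weight0 oner_neq0. Qed.

Lemma wquotS k : M k.+1 = M k * mu k.+1.
Proof. by rewrite /wquot /= mulrC divfK // gt_eqF. Qed.

Lemma wquot_gt0 k : 0 < mu k. Proof. by rewrite /wquot divr_gt0. Qed.

Lemma wquot_homo j k : (j <= k)%N -> mu j <= mu k.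
Proof.
have [_ [_ M1] mono _] := hM.
case: j => [|j]; last by move=> jk; apply: mono.
case: k => [//|k] _; apply: (@le_trans _ _ (mu 1%N)); last exact: mono.
by rewrite wquot0 /wquot /= weight0 divr1.
Qed.

Lemma wquot_ge1 k : 1 <= mu k.
Proof. by rewrite -wquot0 wquot_homo. Qed.

Lemma weight_homo j k : (j <= k)%N -> M j <= M k.
Proof.
elim: k => [|k IH]; first by rewrite leqn0 => /eqP ->.
rewrite leq_eqVlt ltnS => /predU1P[->//|/IH h]; apply: le_trans h _.
by rewrite wquotS ler_pMr // wquot_ge1.
Qed.

Lemma weight_ge1 k : 1 <= M k.
Proof. by rewrite -weight0 weight_homo. Qed.

(** The line of slope log mu_k supports log M at k: for m >= k, M_m / M_k is a product of m - k
    quotients that are at least mu_k; for m < k, M_k / M_m is a product of k - m quotients that are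
    at most mu_k. *)
Lemma weight_logconvex k m : M k * mu k ^+ m <= M m * mu k ^+ k.
Proof.
have up j : M k * mu k ^+ j <= M (k + j)%N.
  elim: j => [|j IH]; first by rewrite mulr1 addn0.
  rewrite addnS wquotS exprSr mulrA; apply: ler_pM => //.
  - by rewrite mulr_ge0 // ?exprn_ge0 // ltW // wquot_gt0.
  - exact: ltW (wquot_gt0 _).
  - by apply: wquot_homo; rewrite leqW // leq_addr.
have down j : (j <= k)%N -> M k <= M (k - j)%N * mu k ^+ j.
  elim: j => [|j IH] jk; first by rewrite subn0 mulr1.
  apply: le_trans (IH (ltnW jk)) _.
  have -> : (k - j = (k - j.+1).+1)%N by rewrite subnSK.
  rewrite wquotS exprS mulrA ler_wpM2r ?exprn_ge0 ?(ltW (wquot_gt0 _)) //.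
  rewrite ler_pM2l //; apply: wquot_homo; rewrite subnSK //; exact: leq_subr.
have [km|mk] := leqP k m.
  have h := up (m - k)%N; rewrite subnKC // in h.
  have -> : mu k ^+ m = mu k ^+ (m - k) * mu k ^+ k by rewrite -exprD subnK.
  by rewrite mulrA ler_wpM2r // exprn_ge0 // ltW // wquot_gt0.
have /down := leq_subr m k; rewrite (subKn (ltnW mk)) => h.
apply: le_trans (ler_wpM2r _ h) _; first by rewrite exprn_ge0 // ltW // wquot_gt0.
by rewrite -mulrA -exprD (subnK (ltnW mk)).
Qed.

Lemma weight_supermul i j : M i * M j <= M (i + j)%N.
Proof.
elim: j => [|j IH]; first by rewrite weight0 mulr1 addn0.
rewrite addnS !wquotS mulrA; apply: ler_pM => //.
- by rewrite mulr_ge0 // ltW.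
- exact: ltW (wquot_gt0 _).
- by apply: wquot_homo; rewrite ltnS leq_addl.
Qed.

Lemma wpow_gt0 r k : 0 < wpow M r k. Proof. by rewrite /wpow powR_gt0. Qed.

Lemma wpowD r s k : wpow M (r + s) k = wpow M r k * wpow M s k.
Proof. exact: powR_sum. Qed.

Hypothesis hgamma : gamma_index M = +oo%E.

(** Some exponent g' > g is admissible in the index; almost monotonicity is used only against the
    index 1, where mu_1 >= 1. *)
Lemma wquot_growth (g : nat) : exists2 c : R, 0 < c & forall k, (0 < k)%N -> c * k%:R ^+ g <= mu k.
Proof.
have : ((g%:R : R)%:E < gamma_index M)%E by rewrite hgamma ltry.
move=> /ereal_sup_gt[_ [->|[g' [g'0 [C C0 hC]] <-]]].
  by rewrite lte_fin ltNge ler0n.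
rewrite lte_fin => gg'; exists C^-1; first by rewrite invr_gt0.
move=> k k0; have := hC 1%N k isT k0; rewrite powR1 divr1 => h.
have k1 : 1 <= k%:R :> R by rewrite ler1n.
have kg : k%:R ^+ g <= k%:R `^ g' :> R.
  by rewrite -powR_mulrn ?ler0n //; apply: ler_powR => //; exact: ltW.
have kp : 0 < k%:R `^ g' :> R by rewrite powR_gt0 // ltr0n.
have := le_trans (wquot_ge1 1) h; rewrite mulrA ler_pdivlMr // mul1r => h2.
by rewrite mulrC ler_pdivrMr // mulrC; exact: le_trans kg h2.
Qed.

Lemma weight_growth (g : nat) :
  exists2 c : R, 0 < c & forall k, c ^+ k * (k`!)%:R ^+ g <= M k.
Proof.
have [c c0 hc] := wquot_growth g; exists c => //.
elim=> [|k IH]; first by rewrite expr0 mul1r fact0 expr1n weight0.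
rewrite wquotS factS natrM exprMn exprS.
rewrite (_ : _ * _ = (c ^+ k * k`!%:R ^+ g) * (c * k.+1%:R ^+ g)); last by ring.
have c0' := ltW c0.
by apply: ler_pM; [rewrite mulr_ge0 // exprn_ge0|rewrite mulr_ge0 // exprn_ge0|exact: IH|exact: hc].
Qed.

(* Replaces k! in the Gevrey estimates. *)
Definition gev (k : nat) : R := k.+1%:R ^+ k.

Lemma gev_ge1 k : 1 <= gev k.
Proof. by rewrite /gev exprn_ege1 // ler1n. Qed.

Lemma gev_supermul i j : gev i * gev j <= gev (i + j).
Proof.
rewrite /gev exprD; apply: ler_pM; rewrite ?exprn_ge0 //.
  by apply: lerXn2r; rewrite ?nnegrE // ler_nat ltnS leq_addr.
by apply: lerXn2r; rewrite ?nnegrE // ler_nat ltnS leq_addl.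
Qed.

Lemma gev_homo i j : (i <= j)%N -> gev i <= gev j.
Proof.
move=> ij; have -> : j = (i + (j - i))%N by rewrite subnKC.
apply: le_trans (gev_supermul _ _); rewrite ler_peMr ?gev_ge1 //.
exact: le_trans (gev_ge1 _).
Qed.

(** Passing from k to k + 1 costs (1 + 1/(k+1))^(k+1) <= e beyond the factor k + 1 of the
    factorial. *)
Lemma gev_fact k : gev k <= expR 1 ^+ k * k`!%:R.
Proof.
elim: k => [|k IH]; first by rewrite /gev !expr0 fact0 mulr1.
have h : k.+2%:R ^+ k.+1 <= expR 1 * k.+1%:R ^+ k.+1 :> R.
  have k0 : 0 < k.+1%:R :> R by rewrite ltr0n.
  rewrite -ler_pdivrMr ?exprn_gt0 // -expr_div_n.
  have -> : k.+2%:R / k.+1%:R = 1 + k.+1%:R^-1 :> R.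
    by rewrite -natr1 mulrDl divff ?gt_eqF // mul1r.
  have -> : (1 : R) = k.+1%:R^-1 * k.+1%:R by rewrite mulVf // gt_eqF.
  rewrite mulVf ?gt_eqF // -[in leRHS](mulVf (lt0r_neq0 k0)) expRM powR_mulrn ?expR_ge0 //.
  by apply: lerXn2r; rewrite ?nnegrE ?addr_ge0 ?expR_ge0 // expR_ge1Dx.
rewrite /gev; apply: le_trans h _; rewrite exprS (exprS (expR 1)) factS natrM.
rewrite (_ : _ * _ * (_ * _) = expR 1 * (k.+1%:R * (expR 1 ^+ k * k`!%:R))); last by ring.
by rewrite ler_pM2l ?expR_gt0 // ler_pM2l.
Qed.

(** An integer g >= p / rho puts (k!)^p below ((k!)^g)^rho, and [weight_growth] bounds (k!)^g by M
    up to a geometric factor. *)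
Lemma wle_gev (p : nat) (rho : R) : 0 < rho -> wle (fun k => gev k ^+ p) (wpow M rho).
Proof.
move=> rho0; pose g := (Num.truncn (p%:R / rho)).+1.
have pg : p%:R <= g%:R * rho.
  by rewrite -ler_pdivrMr // ltW // truncnS_gt.
have [c c0 hc] := weight_growth g.
exists 1, (expR 1 ^+ p * (c^-1) `^ rho); split=> //.
  by rewrite mulr_gt0 ?exprn_gt0 ?expR_gt0 // powR_gt0 // invr_gt0.
move=> k; rewrite mul1r.
have f1 : 1 <= k`!%:R :> R by rewrite ler1n fact_gt0.
apply: (@le_trans _ _ (expR 1 ^+ p ^+ k * (k`!%:R ^+ p))).
  rewrite exprAC -exprMn; apply: lerXn2r; rewrite ?nnegrE ?gev_fact //.
    by apply: le_trans (gev_ge1 _).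
rewrite exprMn -mulrA ler_wpM2l ?exprn_ge0 ?expR_ge0 //.
apply: (@le_trans _ _ ((k`!%:R ^+ g) `^ rho)).
  rewrite -!powR_mulrn // -powRrM; exact: ler_powR.
rewrite -powR_exprn ?invr_ge0 ?(ltW c0) // /wpow -powRM ?exprn_ge0 ?invr_ge0 ?(ltW c0) //; last exact: ltW.
apply: powR_homo; rewrite ?(ltW rho0) ?exprn_ge0 //.
by rewrite exprVn mulrC ler_pdivlMr ?exprn_gt0 // mulrC.
Qed.

Lemma wleM (a b : nat -> R) (r s : R) : (forall k, 0 <= a k) -> (forall k, 0 <= b k) ->
  wle a (wpow M r) -> wle b (wpow M s) -> wle (fun k => a k * b k) (wpow M (r + s)).
Proof.
move=> a0 b0 [C [h [C0 h0 ha]]] [C' [h' [C0' h0' hb]]].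
exists (C * C'), (h * h'); split; rewrite ?mulr_gt0 //.
move=> k; apply: le_trans (ler_pM (a0 k) (b0 k) (ha k) (hb k)) _.
by rewrite wpowD exprMn le_eqVlt; apply/orP; left; apply/eqP; ring.
Qed.

(** M^rho beats every geometric sequence, because it dominates [gev] and L^k <= L^L [gev k] for each
    fixed L; here L is at least h' / h, with h' the rate lost in that domination. *)
Lemma wpow_little (rho h : R) : 0 < rho -> 0 < h ->
  exists2 C : R, 0 < C & forall k, 1 <= C * h ^+ k * wpow M rho k.
Proof.
move=> rho0 h0; have [C [h' [C0 h0' hC]]] := wle_gev 1 rho0.
pose L := (Num.truncn (h' / h)).+1.
have hL : h' <= h * L%:R by rewrite mulrC -ler_pdivrMr // ltW // truncnS_gt.
have L0 : 0 < L%:R :> R by rewrite ltr0n.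
exists (L%:R ^+ L * C); first by rewrite mulr_gt0 // exprn_gt0.
move=> k.
have gL : L%:R ^+ k <= L%:R ^+ L * gev k.
  have [kL|Lk] := leqP k L.
    apply: le_trans (_ : L%:R ^+ L * 1 <= _); first by rewrite mulr1 ler_weXn2l // ler1n.
    by rewrite ler_pM2l ?exprn_gt0 // gev_ge1.
  apply: le_trans (_ : 1 * gev k <= _).
    rewrite mul1r /gev; apply: lerXn2r; rewrite ?nnegrE // ler_nat.
    by rewrite ltnW // ltnW.
  by apply: ler_wpM2r; [exact: le_trans (gev_ge1 k)|rewrite exprn_ege1 // ler1n].
have := hC k; rewrite expr1 => hk.
rewrite -(ler_pM2l (exprn_gt0 k L0)) mulr1; apply: le_trans gL _.
rewrite [leRHS](_ : _ = L%:R ^+ L * (C * (h * L%:R) ^+ k * wpow M rho k)); last by rewrite exprMn; ring.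
rewrite ler_pM2l ?exprn_gt0 //; apply: le_trans hk _.
rewrite ler_wpM2r ?(ltW (wpow_gt0 _ _)) // ler_pM2l //.
by apply: lerXn2r; rewrite ?nnegrE // ltW // mulr_gt0.
Qed.

(** Were M^nu below M, then M^(nu-1) would be at most C h^k; [wpow_little] with the rate 1/(2h)
    would then bound 2^k. *)
Lemma wlt_wpow (nu : R) : 1 < nu -> wlt M (wpow M nu).
Proof.
move=> nu1; split.
  exists 1, 1; split=> // k; rewrite expr1n !mul1r /wpow.
  by apply: le1r_powR; [exact: weight_ge1|exact: ltW].
move=> [C [h [C0 h0 hC]]].
have nu0 : 0 < nu - 1 by rewrite subr_gt0.
have h20 : 0 < (2 * h)^-1 by rewrite invr_gt0 mulr_gt0.
have [C' C0' hC'] := wpow_little nu0 h20.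
have bd k : 2 ^+ k <= C' * C.
  have h1 : wpow M (nu - 1) k <= C * h ^+ k.
    rewrite -(ler_pM2r (weight_gt0 k)); apply: le_trans (hC k).
    rewrite -[X in _ * X](powRr1 (ltW (weight_gt0 k))) -[X in _ * X]/(wpow M 1 k) -wpowD.
    by rewrite subrK.
  have := hC' k; rewrite exprVn mulrAC ler_pdivlMr ?exprn_gt0 ?mulr_gt0 // mul1r.
  move=> h2; have := le_trans h2 (ler_wpM2l (ltW C0') h1).
  by rewrite exprMn mulrA ler_pM2r // exprn_gt0.
have := bd (Num.truncn (C' * C)).+1; apply/negP; rewrite -ltNge.
apply: lt_trans (truncnS_gt _) _.
by rewrite -natrX ltr_nat ltn_expl.
Qed.

End WeightTheory.

(** * Frequencies and amplitudes of the summands *)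

Section Frequencies.
Context {R : realType}.
Variable M : nat -> R.
Hypothesis hM : weight_sequence M.
Variable nu : R.
Hypothesis nu0 : 0 < nu.
Local Notation mu := (wquot M).
Local Notation N := (wpow M nu).

(** [frq], [rfrq] and [amp] are lam_k, kap_k and a_k. *)
Definition frq k : R := mu k `^ nu.
Definition rfrq k : R := mu k `^ (nu / 2).
Definition amp k : R := N k / (frq k ^+ k * 2 ^+ k).

Lemma rfrq_sqr k : rfrq k ^+ 2 = frq k.
Proof.
by rewrite expr2 -powR_sum ?(wquot_gt0 hM) // -splitr.
Qed.

Lemma rfrq_ge1 k : 1 <= rfrq k.
Proof. by apply: powR_ge1; [exact: wquot_ge1|rewrite divr_ge0 // ltW]. Qed.

Lemma rfrq_gt0 k : 0 < rfrq k.
Proof. exact: lt_le_trans (rfrq_ge1 k). Qed.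

Lemma frq_gt0 k : 0 < frq k.
Proof. by rewrite -rfrq_sqr exprn_gt0 // rfrq_gt0. Qed.

Lemma amp_gt0 k : 0 < amp k.
Proof. by rewrite divr_gt0 ?(wpow_gt0 hM) // mulr_gt0 // exprn_gt0 // frq_gt0. Qed.

Lemma amp_frq k m : amp k * frq k ^+ m <= N m / 2 ^+ k.
Proof.
have p := exprn_gt0 k (frq_gt0 k); have p2 : 0 < 2 ^+ k :> R by rewrite exprn_gt0.
rewrite /amp invfM mulrA mulrAC ler_pM2r ?invr_gt0 // mulrAC ler_pdivrMr //.
have w j := ltW (weight_gt0 hM j); have q := ltW (wquot_gt0 hM k).
rewrite /frq -!powR_exprn // /wpow -!powRM ?exprn_ge0 //.
apply: powR_homo; [exact: ltW|by rewrite mulr_ge0 // exprn_ge0|].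
exact: weight_logconvex.
Qed.

Lemma amp_frq_diag k : amp k * frq k ^+ k = N k / 2 ^+ k.
Proof.
rewrite /amp invfM mulrA mulrAC; congr (_ / _).
by rewrite divfK // gt_eqF // exprn_gt0 // frq_gt0.
Qed.

Lemma wpow_supermul r i j : 0 <= r -> wpow M r i * wpow M r j <= wpow M r (i + j).
Proof.
move=> r0; rewrite /wpow -powRM ?(ltW (weight_gt0 hM _)) //.
apply: powR_homo => //; last exact: weight_supermul.
by rewrite mulr_ge0 // ltW // weight_gt0.
Qed.

(** Bounds a summand when i derivatives fall on the wave and j on the cutoff. Squaring turns kap^j
    into lam^j: the square is (a lam^i)(a lam^(i+j)) G_j^2, at most a geometric factor times N_i
    N_(i+j) N_j / 4^k, and N_i N_j <= N_(i+j). *)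
Lemma amp_gevrey (G : nat -> R) (C h : R) k i j : 0 <= C -> 0 <= h -> 0 <= G j ->
  G j <= C * h ^+ j * wpow M (nu / 2) j ->
  amp k * frq k ^+ i * rfrq k ^+ j * G j <= C * h ^+ j * N (i + j) / 2 ^+ k.
Proof.
move=> C0 h0 G0 Gle.
have a0 := ltW (amp_gt0 k); have f0 := ltW (frq_gt0 k); have r0 := ltW (rfrq_gt0 k).
have p2 : 0 < 2 ^+ k :> R by rewrite exprn_gt0.
have n0 s := ltW (wpow_gt0 hM nu s).
have lhs0 : 0 <= amp k * frq k ^+ i * rfrq k ^+ j * G j.
  by do !apply: mulr_ge0 => //; rewrite exprn_ge0.
have rhs0 : 0 <= C * h ^+ j * N (i + j) / 2 ^+ k.
  by rewrite divr_ge0 ?(ltW p2) // mulr_ge0 // mulr_ge0 // exprn_ge0.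
rewrite -ler_sqr ?nnegrE //.
have E1 : (amp k * frq k ^+ i * rfrq k ^+ j * G j) ^+ 2 =
    (amp k * frq k ^+ i) * (amp k * frq k ^+ (i + j)) * G j ^+ 2.
  have e : rfrq k ^+ j ^+ 2 = frq k ^+ j by rewrite exprAC rfrq_sqr.
  rewrite (exprD _ i j); move: e.
  move: (amp k) (frq k ^+ i) (frq k ^+ j) (rfrq k ^+ j) => a x y z e.
  by rewrite !exprMn e; ring.
have G2 : G j ^+ 2 <= C ^+ 2 * h ^+ j ^+ 2 * N j.
  have -> : C ^+ 2 * h ^+ j ^+ 2 * N j = (C * h ^+ j * wpow M (nu / 2) j) ^+ 2.
    by rewrite !exprMn (expr2 (wpow M _ j)) -(wpowD hM) -splitr.
  by rewrite ler_sqr ?nnegrE // (le_trans G0).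
rewrite E1; apply: le_trans (ler_pM _ _ (ler_pM _ _ (amp_frq k i) (amp_frq k (i + j))) G2) _.
- by do !apply: mulr_ge0 => //; rewrite exprn_ge0.
- by rewrite sqr_ge0.
- by rewrite mulr_ge0 // exprn_ge0.
- by rewrite mulr_ge0 // exprn_ge0.
have key := wpow_supermul i j (ltW nu0); have nij := n0 (i + j)%N; move: key nij.
move: (N i) (N j) (N (i + j)) (h ^+ j) ((2 ^+ k)^-1) => x y z u v key z0.
rewrite [leLHS](_ : _ = (C * u * v) ^+ 2 * z * (x * y)); last by ring.
rewrite [leRHS](_ : _ = (C * u * v) ^+ 2 * z * z); last by ring.
by rewrite ler_wpM2l // mulr_ge0 // sqr_ge0.
Qed.

(** Interpolation: with theta = 1 - 1/(2d) the left side is X^theta a^(1-theta), where X = a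
    lam^(dm). Both factors are bounded by [amp_frq], with exponents dm and 0, and the two powers of
    2^(-k) recombine to 2^(-k). *)
Lemma amp_iter k d m : (0 < d)%N ->
  amp k * frq k ^+ (d * m) / rfrq k ^+ m <= wpow M (nu * (1 - (2 * d%:R)^-1)) (d * m) / 2 ^+ k.
Proof.
move=> d0; have d0' : 0 < d%:R :> R by rewrite ltr0n.
set th := 1 - (2 * d%:R)^-1.
have t1 : (2 * d%:R)^-1 <= 1 / 2 :> R.
  by rewrite mul1r lef_pV2 ?posrE ?mulr_gt0 // ler_peMr // ler1n.
have th0 : 0 <= th by rewrite /th; lra.
have th1 : 0 <= 1 - th by rewrite /th opprB addrC subrK invr_ge0 mulr_ge0 // ler0n.
have a0 := amp_gt0 k; have f0 := frq_gt0 k; have r0 := rfrq_gt0 k.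
have p2 : 0 < 2 ^+ k :> R by rewrite exprn_gt0.
pose X := amp k * frq k ^+ (d * m).
have X0 : 0 < X by rewrite mulr_gt0 // exprn_gt0.
have E : amp k * frq k ^+ (d * m) / rfrq k ^+ m = X `^ th * amp k `^ (1 - th).
  rewrite /X powRM ?exprn_ge0 ?(ltW a0) ?(ltW f0) //.
  rewrite [RHS]mulrAC -powR_sum // (addrC th) subrK (powRr1 (ltW a0)) -mulrA; congr (_ * _).
  apply: (mulIf (lt0r_neq0 (exprn_gt0 m r0))); rewrite divfK ?gt_eqF ?exprn_gt0 //.
  rewrite -rfrq_sqr -!exprM -!(powR_mulrn _ (ltW r0)) -powRrM -powR_sum //; congr (_ `^ _).
  rewrite /th !natrM mulrBr mulr1 invfM (_ : 2 * _ * _ = m%:R); first by rewrite subrK.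
  by field; rewrite gt_eqF.
rewrite E.
have h1 : X `^ th <= (N (d * m) / 2 ^+ k) `^ th by apply: powR_homo => //; [exact: ltW|exact: amp_frq].
have h2 : amp k `^ (1 - th) <= (2 ^+ k)^-1 `^ (1 - th).
  apply: powR_homo => //; first exact: ltW.
  by have := amp_frq k 0; rewrite expr0 mulr1 /wpow (weight0 hM) powR1 mul1r.
apply: le_trans (ler_pM (powR_ge0 _ _) (powR_ge0 _ _) h1 h2) _.
rewrite powRM ?(ltW (wpow_gt0 hM _ _)) // ?invr_ge0 ?(ltW p2) // -mulrA -powR_sum ?invr_gt0 //.
by rewrite addrC subrK powRr1 ?invr_ge0 ?(ltW p2) // /wpow powRrM.
Qed.

Hypothesis hgamma : gamma_index M = +oo%E.

(** M is split as M^s M^sg M^sg with sg = (1 - s)/2: one spare factor swallows [W], the other yields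
    an arbitrarily small geometric rate. *)
Lemma wle_absorb (s A B h : R) (W : nat -> R) (d : nat) : (0 < d)%N ->
  (forall k, 0 <= W k) -> (forall rho, 0 < rho -> wle W (wpow M rho)) -> s < 1 ->
  0 < A -> 0 < B -> 0 < h ->
  exists2 C : R, 0 < C & forall m, A * B ^+ m * W (d * m)%N * wpow M s (d * m) <= C * h ^+ m * M (d * m)%N.
Proof.
move=> d0 W0 hW s1 A0 B0 h0.
have sg0 : 0 < (1 - s) / 2 by rewrite divr_gt0 // subr_gt0.
have [C1 [h1 [C10 h10 hC1]]] := hW _ sg0.
(* Chosen so that [t * B * h1 ^+ d = h], the rate wanted per step of m. *)
pose t := h / (B * h1 ^+ d).
have t0 : 0 < t by rewrite divr_gt0 // mulr_gt0 // exprn_gt0.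
(* The cap at 1 gives h2^(dm) <= h2^m <= t^m. *)
pose h2 := Num.min 1 t.
have h20 : 0 < h2 by rewrite lt_min ltr01.
have [C2 C20 hC2] := wpow_little hM hgamma sg0 h20.
exists (A * C1 * C2); first by rewrite !mulr_gt0.
move=> m; set k := (d * m)%N.
have Bm : 0 < B ^+ m by rewrite exprn_gt0.
have w0 r := wpow_gt0 hM r k.
have hk : h2 ^+ k <= t ^+ m.
  apply: (@le_trans _ _ (h2 ^+ m)).
    by apply: ler_wiXn2l; [exact: ltW|by rewrite ge_min lexx|rewrite leq_pmull].
  by apply: lerXn2r; rewrite ?nnegrE ?(ltW h20) ?(ltW t0) // ge_min lexx orbT.
have l2 : 1 <= C2 * t ^+ m * wpow M ((1 - s) / 2) k.
  apply: le_trans (hC2 k) _; rewrite ler_pM2r // ler_pM2l //.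
apply: (@le_trans _ _ (A * B ^+ m * (C1 * h1 ^+ k * wpow M ((1 - s) / 2) k) * wpow M s k * 1)).
  by rewrite mulr1 ler_pM2r // ler_pM2l // mulr_gt0.
apply: le_trans (ler_wpM2l _ l2) _.
  by do ?[apply: mulr_ge0 => //]; rewrite ?exprn_ge0 // ltW.
have -> : M k = wpow M ((1 - s) / 2) k * wpow M ((1 - s) / 2) k * wpow M s k.
  rewrite -!(wpowD hM) -splitr subrK /wpow powRr1 //; exact/ltW/weight_gt0.
have -> : h ^+ m = t ^+ m * B ^+ m * h1 ^+ k.
  rewrite /k exprM -!exprMn; congr (_ ^+ _); rewrite /t -mulrA divfK // gt_eqF // mulr_gt0 // exprn_gt0 //.
by rewrite le_eqVlt; apply/orP; left; apply/eqP; ring.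
Qed.

End Frequencies.

Section QuadraticError.
Context {R : realType} {V : normedModType R}.

(** Serves twice: for [flat] at its singular point 0, and for the termwise differentiation of
    series. *)
Lemma is_derive_quad (f : V -> R) (x v : V) (l B : R) : 0 <= B ->
  (forall h : R, `|f (h *: v + x) - f x - h * l| <= B * h ^+ 2) -> is_derive x v f l.
Proof.
move=> B0 fB.
have cv : h^-1 *: (f (h *: v + x) - f x) @[h --> 0^'] --> l.
  apply/cvgrPdist_le => e e0.
  have d0 : 0 < e / (B + 1) by rewrite divr_gt0 // ltr_wpDl.
  near=> h.
  have h0 : h != 0 by near: h; exact: nbhs_dnbhs_neq.
  have hd : `|h| <= e / (B + 1) by near: h; exact: dnbhs0_le.
  have -> : l - h^-1 *: (f (h *: v + x) - f x) = - (h^-1 * (f (h *: v + x) - f x - h * l)).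
    by rewrite /GRing.scale /= [in RHS]mulrBr mulKf // opprB.
  rewrite normrN normrM normfV ler_pdivrMl ?normr_gt0 //.
  apply: le_trans (fB h) _; rewrite -real_normK ?num_real // expr2 mulrCA ler_wpM2l //.
  apply: le_trans (ler_wpM2l B0 hd) _; rewrite mulrCA ler_piMr ?(ltW e0) //.
  by rewrite ler_pdivrMr ?mul1r ?lerDl // ltr_wpDl.
apply: DeriveDef; first by apply/cvg_ex; exists l.
exact: cvg_lim.
Unshelve. all: by end_near. Qed.

End QuadraticError.

(** * A plateau function of Gevrey class *)

Section DerivativeFamilies.
Context {R : realType}.
Implicit Types (g : R -> R) (a b c : nat -> R).

(** The successive derivatives are carried as an explicit family, so closure properties are proved
    by exhibiting the new family. *)
Definition gfam c g : Prop := exists G : nat -> R -> R,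
  [/\ G 0%N = g, forall k (x : R), is_derive x 1 (G k) (G k.+1 x) & forall k (x : R), `|G k x| <= c k].

Lemma gfamM a b f g : gfam a f -> gfam b g -> gfam (fun k => lconv k a b) (fun x => f x * g x).
Proof.
move=> [F [F0 dF bF]] [G [G0 dG bG]].
(* [L k i j] is the k-th derivative of [F i * G j], left uncollected to match [lconv]. *)
pose L := fix L k i j : R -> R :=
  if k is k'.+1 then fun x => L k' i.+1 j x + L k' i j.+1 x else fun x => F i x * G j x.
exists (fun k => L k 0%N 0%N); split.
- by apply/funext => x /=; rewrite F0 G0.
- suff H k i j (x : R) : is_derive x 1 (L k i j) (L k.+1 i j x) by move=> k; exact: H.
  elim: k i j x => [|k IH] i j x.
    apply: (is_derive_eq (is_deriveM (dF i x) (dG j x))).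
    by rewrite /GRing.scale /= addrC (mulrC (G j x)).
  exact: is_deriveD (IH i.+1 j x) (IH i j.+1 x).
- move=> k x.
  suff H i j : `|L k i j x| <= lconv k (fun m => a (m + i)%N) (fun m => b (m + j)%N).
    apply: le_trans (H 0%N 0%N) _; rewrite le_eqVlt; apply/orP; left; apply/eqP.
    by congr lconv; apply/funext => m; rewrite addn0.
  elim: k i j => [|k IH] i j /=; first by rewrite normrM ler_pM.
  apply: le_trans (ler_normD _ _) _; apply: lerD.
    apply: le_trans (IH _ _) _; rewrite le_eqVlt; apply/orP; left; apply/eqP.
    by congr lconv; apply/funext => m /=; rewrite addnS.
  apply: le_trans (IH _ _) _; rewrite le_eqVlt; apply/orP; left; apply/eqP.
  by congr lconv; apply/funext => m /=; rewrite addnS.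
Qed.

Lemma gfam_le a b g : (forall k, a k <= b k) -> gfam a g -> gfam b g.
Proof. by move=> ab [G [G0 dG bG]]; exists G; split=> // k x; exact: le_trans (ab k). Qed.

Lemma gfamZ (z : R) a g : gfam a g -> gfam (fun k => `|z| * a k) (fun x => z * g x).
Proof.
move=> [G [G0 dG bG]]; exists (fun k x => z * G k x); split.
- by rewrite G0.
- by move=> k x; exact: is_deriveZ (dG k x).
- by move=> k x; rewrite normrM ler_wpM2l.
Qed.

Lemma gfam_affine (s t : R) a g : gfam a g ->
  gfam (fun k => `|s| ^+ k * a k) (fun x => g (s * x + t)).
Proof.
move=> [G [G0 dG bG]]; exists (fun k x => s ^+ k * G k (s * x + t)); split.
- by rewrite G0; apply/funext => x; rewrite mul1r.
- move=> k x.
  have dl : is_derive x 1 (fun y => s * y + t) s.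
    apply: (is_derive_eq (is_deriveD (is_deriveZ s (is_derive_id x 1)) (is_derive_cst t x 1))).
    by rewrite addr0 /GRing.scale /= mulr1.
  apply: (is_derive_eq (is_deriveZ (s ^+ k) (@is_derive1_comp _ (G k) _ x _ _ (dG k _) dl))).
  by rewrite /GRing.scale /= exprSr mulrA mulrAC -mulrA mulrC -mulrA (mulrC s).
- by move=> k x; rewrite normrM normrX ler_wpM2l // exprn_ge0.
Qed.

(* t^-i e^(-1/t): its derivative is the same expression with i+2 minus i times
   the one with i+1, so all derivatives are bounded through y^i e^-y <= i!. *)
Definition flat (i : nat) (t : R) : R :=
  if 0 < t then t^-1 ^+ i * expR (- t^-1) else 0.

Lemma flat_ge0 i t : 0 <= flat i t.
Proof.
rewrite /flat; case: ifP => // t0.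
by rewrite mulr_ge0 ?expR_ge0 // exprn_ge0 // invr_ge0 ltW.
Qed.

Lemma flat_le i t : flat i t <= i`!%:R.
Proof.
rewrite /flat; case: ifP => // t0.
have y0 : 0 <= t^-1 by rewrite invr_ge0 ltW.
have h : t^-1 ^+ i <= i`!%:R * expR t^-1.
  case: i => [|i]; first by rewrite fact0 mul1r (le_trans _ (expR_ge1Dx _)) // lerDl.
  rewrite mulrC -ler_pdivrMr ?ltr0n ?fact_gt0 //; apply: le_trans (expR_ge1Dxn i y0).
  by rewrite lerDr.
by rewrite expRN ler_pdivrMr ?expR_gt0.
Qed.

Lemma flatS i t : flat i t = t * flat i.+1 t.
Proof.
rewrite /flat; case: ifP => t0; last by rewrite mulr0.
by rewrite exprS !mulrA divff ?mul1r // gt_eqF.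
Qed.

Lemma is_derive_flat i (t : R) : is_derive t 1 (flat i) (flat i.+2 t - i%:R * flat i.+1 t).
Proof.
have [t0|t0|t0] := ltrgtP t 0.
- have -> : flat i.+2 t - i%:R * flat i.+1 t = 0.
    by rewrite /flat ltNge (ltW t0) /= mulr0 subrr.
  have d0 : is_derive t 1 (fun _ : R => 0 : R) 0 by exact: (is_derive_cst (0 : R)).
  apply: near_eq_is_derive d0.
  by near=> s; rewrite /flat ltNge ltW //=; near: s; exact: lt_nbhsl.
- have dV : is_derive t 1 (fun s : R => s^-1) (- t ^- 2).
    apply: (is_derive_eq (is_deriveV (lt0r_neq0 t0) (is_derive_id t 1))).
    by rewrite /GRing.scale /= mulr1.
  have dE : is_derive t 1 (fun s : R => expR (- s^-1)) (expR (- t^-1) * t ^- 2).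
    apply: (is_derive_eq (@is_derive1_comp _ expR (fun s => - s^-1) t _ _ (is_derive_expR _) (is_deriveN dV))).
    by rewrite opprK.
  have dX : is_derive t 1 (fun s : R => s^-1 ^+ i) (- (i%:R * t^-1 ^+ i.+1)).
    have -> : (fun s : R => s^-1 ^+ i) = (fun s : R => s^-1) ^+ i by rewrite exprfctE.
    apply: (is_derive_eq (is_deriveX i dV)).
    rewrite /GRing.scale /=; case: i => [|i] /=; first by rewrite !mul0r oppr0.
    by rewrite -exprVn; move: (t^-1) => y; rewrite !exprS; ring.
  apply: (near_eq_is_derive (f := fun s : R => s^-1 ^+ i * expR (- s^-1))).
    by near=> s; rewrite /flat ifT //; near: s; exact: lt_nbhsr.
  apply: (is_derive_eq (is_deriveM dX dE)).
  rewrite /GRing.scale /= /flat t0 -exprVn; move: (t^-1) => y.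
  by rewrite !exprS; ring.
(* At 0 the derivative is 0, since by [flatS] used twice [flat i h = h ^+ 2 * flat i.+2 h], which is
   at most (i+2)! h^2. *)
- rewrite t0 {2 3}/flat ltxx mulr0 subrr.
  apply: (@is_derive_quad _ _ _ _ _ _ (i.+2)`!%:R) => // h.
  rewrite mulr0 subr0 addr0 (_ : h *: (1 : R) = h); last exact: mulr1.
  rewrite {2}/flat ltxx subr0 ger0_norm ?flat_ge0 //.
  by rewrite flatS flatS mulrA -expr2 mulrC ler_wpM2r ?sqr_ge0 // flat_le.
Unshelve. all: by end_near. Qed.

(** A derivative raises the index by at most 2 and produces two terms, whence 2^k; the coefficient i
    of the second term is absorbed by the factorial, as its index rises by only 1. *)
Lemma gfam_flat i : gfam (fun k => 2 ^+ k * (i + 2 * k)`!%:R) (flat i).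
Proof.
pose E := fix E k i : R -> R :=
  if k is k'.+1 then fun x => E k' i.+2 x - i%:R * E k' i.+1 x else flat i.
exists (E^~ i); split=> //.
- move=> k; elim: k i => [|k IH] i x; first exact: is_derive_flat.
  exact: is_deriveB (IH i.+2 x) (is_deriveZ i%:R (IH i.+1 x)).
- move=> k x; elim: k i => [|k IH] i /=.
    by rewrite muln0 addn0 mul1r ger0_norm ?flat_ge0 // flat_le.
  apply: le_trans (ler_normB _ _) _.
  have h1 := IH i.+2; have h2 := IH i.+1.
  have e : (i + 2 * k.+1 = i.+2 + 2 * k)%N by rewrite mulnS addnCA addnA.
  rewrite [leRHS](_ : _ = 2 ^+ k * (i.+2 + 2 * k)`!%:R + 2 ^+ k * (i.+2 + 2 * k)`!%:R); last by rewrite e exprS; ring.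
  apply: lerD => //.
  rewrite normrM ger0_norm //; apply: le_trans (ler_wpM2l (ler0n _ _) h2) _.
  rewrite mulrCA ler_wpM2l ?exprn_ge0 // -natrM ler_nat.
  have -> : (i.+2 + 2 * k = (i.+1 + 2 * k).+1)%N by [].
  rewrite factS; apply: leq_mul => //; rewrite addSn; do 2 apply: leqW; exact: leq_addr.
Qed.

End DerivativeFamilies.

Section Plateau.
Context {R : realType}.

Definition bump (t : R) : R := flat 0 t * flat 0 (1 - t).

Lemma conv_mono (a a' b b' : nat -> R) m : (forall k, 0 <= a k) -> (forall k, 0 <= b k) ->
  (forall k, a k <= a' k) -> (forall k, b k <= b' k) -> lconv m a b <= lconv m a' b'.
Proof.
elim: m a a' b b' => [|m IH] a a' b b' a0 b0 aa bb /=; first exact: ler_pM.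
by apply: lerD; apply: IH => // k; [exact: a0|exact: aa|exact: b0|exact: bb].
Qed.

Lemma gfam_bump : gfam (fun k => 16 ^+ k * gev k ^+ 2) bump.
Proof.
have h1 := gfam_flat (R := R) 0.
have h2 : gfam (fun k => `|-1| ^+ k * (2 ^+ k * (0 + 2 * k)`!%:R)) (fun t : R => flat 0 (1 - t)).
  have -> : (fun t : R => flat 0 (1 - t)) = (fun t => flat 0 (-1 * t + 1)).
    by apply/funext => t; rewrite mulN1r addrC.
  exact: gfam_affine h1.
(* From (2k)! <= (2(k+1))^(2k) = 4^k (k+1)^(2k). The product rule then adds the two rates, 8 + 8 =
   16. *)
have fact_le k : 2 ^+ k * (0 + 2 * k)`!%:R <= 8 ^+ k * gev k ^+ 2 :> R.
  have -> : (8 : R) = 2 * 4 by rewrite -natrM.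
  rewrite exprMn -mulrA ler_wpM2l ?exprn_ge0 // add0n /gev -!natrX -!natrM ler_nat.
  have -> : (4 ^ k * (k.+1 ^ k) ^ 2 = (2 * k.+1) ^ (2 * k))%N.
    by rewrite expnMn (expnM 2 2 k) -expnM (mulnC k).
  apply: (@leq_trans ((2 * k) ^ (2 * k))).
    elim: (2 * k)%N => [//|m IH]; rewrite factS expnS leq_mul // (leq_trans IH) //.
    by case: m {IH} => [//|m]; rewrite leq_exp2r.
  by case: k => [//|k]; rewrite leq_exp2r // leq_mul2l leqnSn orbT.
apply: gfam_le (gfamM h1 h2) => k.
apply: (@le_trans _ _ (lconv k (fun k => 8 ^+ k * gev k ^+ 2) (fun k => 8 ^+ k * gev k ^+ 2))).
  apply: conv_mono => m.
  - by rewrite mulr_ge0 // exprn_ge0.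
  - by rewrite normrN normr1 expr1n mul1r mulr_ge0 // exprn_ge0.
  - exact: fact_le.
  - by rewrite normrN normr1 expr1n mul1r fact_le.
apply: le_trans (@lconv_le _ _ _ (fun k => gev k ^+ 2) 1 8 8 k _) _.
  move=> i j; rewrite mul1r mulrACA ler_wpM2l ?mulr_ge0 ?exprn_ge0 //.
  rewrite -exprMn; apply: lerXn2r; rewrite ?nnegrE ?mulr_ge0 // ?(le_trans ler01) ?gev_ge1 //.
  exact: gev_supermul.
by rewrite mul1r -natrD.
Qed.

Lemma bump_ge0 t : 0 <= bump t.
Proof. by rewrite mulr_ge0 // flat_ge0. Qed.

Lemma bump0 t : t <= 0 -> bump t = 0.
Proof. by move=> t0; rewrite /bump /flat ltNge t0 /= mul0r. Qed.

Lemma bump1 t : 1 <= t -> bump t = 0.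
Proof. by move=> t1; rewrite /bump {2}/flat ltNge subr_le0 t1 /= mulr0. Qed.

Lemma bump_gt0 t : 0 < t < 1 -> 0 < bump t.
Proof.
move=> /andP[t0 t1]; rewrite /bump /flat t0 subr_gt0 t1.
by rewrite !mulr_gt0 ?expR_gt0.
Qed.

Lemma bump_le1 t : bump t <= 1.
Proof.
rewrite -(mulr1 1); apply: ler_pM; rewrite ?flat_ge0 //; exact: flat_le.
Qed.

Lemma continuous_bump : continuous bump.
Proof.
have [G [G0 dG _]] := gfam_bump; rewrite -G0 => t.
by apply/differentiable_continuous/derivable1_diffP; have [] := dG 0%N t.
Qed.

(** [bump] vanishes on the negative axis; starting at -1 makes 0 an interior point, where the
    fundamental theorem of calculus applies. *)
Definition step (x : R) : R := \int[lebesgue_measure]_(t in `[-1, x]) bump t.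

Lemma step0 (x : R) : x <= 0 -> step x = 0.
Proof.
move=> x0; rewrite /step (eq_Rintegral _ (g := fun _ => 0)); first by rewrite Rintegral_cst ?mul0r.
move=> t; rewrite inE /= in_itv /= => /andP[_ tx]; apply: bump0; exact: le_trans tx x0.
Qed.

Lemma is_derive_step (x : R) : is_derive x 1 step (bump x).
Proof.
have [x0|x0] := ltP x 0.
  rewrite (bump0 (ltW x0)).
  have d0 : is_derive x 1 (fun _ : R => 0 : R) 0 by exact: (is_derive_cst (0 : R)).
  apply: near_eq_is_derive d0.
  by near=> s; rewrite step0 // ltW //; near: s; exact: lt_nbhsl.
have ax : -1 < x by rewrite (lt_le_trans _ x0) // ltrN10.
have xx : x < x + 1 by rewrite ltrDl.
have i1 : (@lebesgue_measure R).-integrable `[-1, x + 1] (EFin \o bump).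
  apply: continuous_compact_integrable; first exact: segment_compact.
  exact: continuous_subspaceT continuous_bump.
have [d e] := continuous_FTC1_closed xx i1 ax (continuous_bump (x := x)).
by apply: DeriveDef; [exact: d|rewrite -e derive1E].
Unshelve. all: by end_near. Qed.

Lemma step_mvt x y : x < y -> exists2 c, x < c < y & step y - step x = bump c * (y - x).
Proof.
move=> xy; have [|c] := @MVT R step bump x y xy (fun z _ => is_derive_step z).
  apply: continuous_subspaceT => z.
  by apply/differentiable_continuous/derivable1_diffP; have [] := is_derive_step z.
by rewrite in_itv /= => hc E; exists c.
Qed.

Lemma step1_gt0 : 0 < step 1.
Proof.
have [c hc] := step_mvt (ltr01 : (0 : R) < 1).
by rewrite (step0 (lexx 0)) !subr0 mulr1 => ->; exact: bump_gt0.
Qed.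

Lemma step_ge1 x : 1 <= x -> step x = step 1.
Proof.
rewrite le_eqVlt => /predU1P[<-//|/step_mvt[c /andP[c1 _]]].
by rewrite (bump1 (ltW c1)) mul0r => /eqP; rewrite subr_eq0 => /eqP.
Qed.

Lemma step_bound x : `|step x| <= 1.
Proof.
have [x0|x0] := leP x 0; first by rewrite step0 // normr0.
have h y : 0 < y -> y <= 1 -> `|step y| <= 1.
  move=> y0 y1; have [c _] := step_mvt y0.
  have b0 := bump_ge0 c; rewrite (step0 (lexx 0)) !subr0 => ->.
  rewrite ger0_norm; last by apply: mulr_ge0 => //; exact: ltW.
  by rewrite -(mulr1 1); apply: ler_pM; rewrite ?bump_ge0 ?bump_le1 ?(ltW y0).
have [x1|x1] := leP x 1; first exact: h.
by rewrite (step_ge1 (ltW x1)) h.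
Qed.

(** The bounds are those of [bump] shifted by one order, and the majorant is monotone. *)
Lemma gfam_step : gfam (fun k => 16 ^+ k * gev k ^+ 2) step.
Proof.
have [G [G0 dG bG]] := gfam_bump.
exists (fun k => if k is k'.+1 then G k' else step); split=> // [[|k] x|[|k] x] //.
- by rewrite G0; exact: is_derive_step.
- by rewrite expr0 mul1r /gev expr0 expr1n step_bound.
- apply: le_trans (bG k x) _; apply: ler_pM; rewrite ?exprn_ge0 ?(le_trans ler01 (gev_ge1 _)) //.
    by rewrite exprS ler_peMl ?exprn_ge0 // ler1n.
  by apply: lerXn2r; rewrite ?nnegrE ?(le_trans ler01 (gev_ge1 _)) // gev_homo.
Qed.

End Plateau.

(** * Gevrey functions of several variables and the cutoff *)

Section Composition.
Context {R : realType} {n : nat}.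
Implicit Types (x y v : 'rV[R]_n) (s : seq 'I_n).

Lemma is_derive_affine (F : 'rV[R]_n -> R) (g : R -> R) x v (a b c : R) :
  (forall h : R, F (h *: v + x) = g (c * h + a)) -> is_derive a 1 g b ->
  is_derive x v F (b * c).
Proof.
move=> Fg dg; pose k (h : R) := g (c * h + a).
have dl : is_derive (0 : R) 1 (fun h : R => c * h + a) c.
  apply: (is_derive_eq (is_deriveD (is_deriveZ c (is_derive_id (0 : R) 1)) (is_derive_cst a (0 : R) 1))).
  by rewrite addr0 /GRing.scale /= mulr1.
have dg' : is_derive (c * 0 + a) 1 g b by rewrite mulr0 add0r.
have [dk vk] := @is_derive1_comp _ g (fun h => c * h + a) 0 _ _ dg' dl.
have Fx : F x = g a by have := Fg 0; rewrite scale0r add0r mulr0 add0r.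
have E : (fun h : R => h^-1 *: (F (h *: v + x) - F x)) =
    (fun h : R => h^-1 *: ((g \o (fun h => c * h + a)) (h *: (1 : R) + 0) - (g \o (fun h => c * h + a)) 0)).
  apply/funext => h; rewrite Fg Fx /= addr0 mulr0 add0r.
  by rewrite (_ : h *: (1 : R) = h) //; exact: mulr1.
by apply: DeriveDef; [rewrite /derivable E|rewrite /derive E].
Qed.

Lemma tame_real (r : 'rV[R]_n -> R) x : {for x, continuous r} ->
  (forall j, derivable r x (basis_vec j)) -> tame (fun y => (r y)%:C) x.
Proof.
move=> cr dr; have E : im_part (fun y => (r y)%:C) = fun _ => 0 by [].
split; rewrite ?E; [exact: cr|exact: cst_continuous|move=> j].
by split; [exact: dr|exact: (derivable_cst (0 : R))].
Qed.

Lemma Dj_real (r : 'rV[R]_n -> R) x j (l : R) : is_derive x (basis_vec j) r l ->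
  Dj j (fun y => (r y)%:C) x = (0 -i* 1) * l%:C.
Proof.
move=> [_ dr]; rewrite DjE.
rewrite (_ : im_part _ = fun _ => 0) // (derive_cst (0 : R)).
rewrite (_ : re_part _ = r) // dr.
by apply/eqP; rewrite eq_complex /=; apply/andP; split; apply/eqP; ring.
Qed.

Lemma gfam_coord (c : nat -> R) (g : R -> R) (w t : R) (j : 'I_n) : gfam c g ->
  smooth setT (fun x : 'rV[R]_n => (g (w * x 0 j + t))%:C) /\
  bdd setT (fun k => `|w| ^+ k * c k) (fun x : 'rV[R]_n => (g (w * x 0 j + t))%:C).
Proof.
move=> [G [G0 dG bG]].
pose F k x := (G k (w * x 0 j + t))%:C.
have dF k x i : is_derive x (basis_vec i) (fun x => G k (w * x 0 j + t))
    (G k.+1 (w * x 0 j + t) * (w * (i == j)%:R)).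
  apply: is_derive_affine (dG k _) => h; congr (G k _).
  by rewrite !mxE /= (eq_sym j); ring.
have tF k x : tame (F k) x.
  apply: tame_real => [|i]; last by have [] := dF k x i.
  apply: (@continuous_comp _ _ _ (fun x : 'rV[R]_n => w * x 0 j + t) (G k)).
    apply: (@continuousD _ _ _ (fun x : 'rV[R]_n => w * x 0 j) (fun _ => t)).
      apply: (@continuousM _ _ (fun _ => w) (fun x : 'rV[R]_n => x 0 j)).
        exact: cst_continuous.
      exact: (@coord_continuous R 1 n 0 j).
    exact: cst_continuous.
  by apply/differentiable_continuous/derivable1_diffP; have [] := dG k (w * x 0 j + t).
have DF i k : Dj i (F k) = fun x => (0 -i* 1) * (w * (i == j)%:R)%:C * F k.+1 x.
  apply/funext => x; rewrite (Dj_real (dF k x i)) /F rmorphM /=.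
  by rewrite -mulrA; congr (_ * _); rewrite mulrC.
(* [z] collects one factor -i w per derivative, and is 0 as soon as a direction other than [j]
   occurs. *)
have H s k : exists2 z : R[i], normc z <= `|w| ^+ size s &
    dseq s (F k) = fun x => z * F (k + size s)%N x.
  elim: s => [|i s [z hz IH]].
    exists 1; first by rewrite ComplexField.Normc.normc1.
    by apply/funext => x; rewrite mul1r addn0.
  exists (z * ((0 -i* 1) * (w * (i == j)%:R)%:C)).
    have h2 : normc ((0 -i* 1) * (w * (i == j)%:R)%:C) <= `|w|.
      rewrite normcM normc_real normrM.
      have -> : normc (0 -i* 1 : R[i]) = 1 by rewrite /= expr0n /= add0r sqrrN expr1n sqrtr1.
      by rewrite mul1r; case: eqP => _; rewrite ?normr1 ?mulr1 // normr0 mulr0.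
    by rewrite normcM -[size (i :: s)]/(size s).+1 exprSr; apply: ler_pM; rewrite ?normc_ge0.
  apply/funext => x; rewrite -[LHS]/(Dj i (dseq s (F k)) x) IH.
  rewrite (DjM _ (tame_cst z x) (tF _ x)) Dj_cst mul0r add0r DF addnS.
  by rewrite !mulrA.
have -> : (fun x : 'rV[R]_n => (g (w * x 0 j + t))%:C) = F 0%N by rewrite /F G0.
split=> s x _; have [z hz E] := H s 0%N.
  have T : tame (dseq s (F 0%N)) x by rewrite E; exact: tameM (tame_cst _ _) (tF _ _).
  exact: T.
rewrite E add0n normcM normc_real; apply: ler_pM => //; exact: normc_ge0.
Qed.

(* Up to geometric factors gev k is k!, so this is the Gevrey class of order 2. *)
Definition gevrey (A H : R) (f : 'rV[R]_n -> R[i]) : Prop :=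
  smooth setT f /\ bdd setT (fun k => A * H ^+ k * gev k ^+ 2) f.

Lemma gevreyM (A B H L : R) f g : 0 <= A -> 0 <= B -> 0 <= H -> 0 <= L ->
  gevrey A H f -> gevrey B L g -> gevrey (A * B) (H + L) (fun x => f x * g x).
Proof.
move=> A0 B0 H0 L0 [sf bf] [sg bg]; split; first exact: (smoothM openT sf sg).
apply: bdd_le (bddM openT sf sg bf bg) => k.
apply: (@lconv_le _ _ _ (fun k => gev k ^+ 2)) => i j.
rewrite (_ : _ * _ = A * B * H ^+ i * L ^+ j * (gev i ^+ 2 * gev j ^+ 2)); last by ring.
have g0 m : 0 <= gev m :> R by rewrite (le_trans ler01) ?gev_ge1.
rewrite ler_wpM2l ?mulr_ge0 ?exprn_ge0 //.
by rewrite -exprMn; apply: lerXn2r; rewrite ?nnegrE ?mulr_ge0 // gev_supermul.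
Qed.

Lemma gevrey_cst1 : gevrey 1 0 (fun _ => 1).
Proof.
split; first exact: (smooth_cst 1 openT).
move=> s x _; rewrite dseq_cst; case: s => [|j s].
  by rewrite ComplexField.Normc.normc1 /= expr0 !mul1r /gev expr0 expr1n.
by rewrite ComplexField.Normc.normc0 mulr_ge0 ?sqr_ge0 // mulr_ge0 // exprn_ge0.
Qed.

Lemma gevrey_prod (I : Type) (r : seq I) (F : I -> 'rV[R]_n -> R[i]) (A H : R) :
  0 <= A -> 0 <= H -> (forall i, gevrey A H (F i)) ->
  gevrey (A ^+ size r) (H *+ size r) (fun x => \prod_(i <- r) F i x).
Proof.
move=> A0 H0 hF; elim: r => [|i r IH].
  rewrite (_ : (fun _ => _) = fun _ => 1); first exact: gevrey_cst1.
  by apply/funext => x; rewrite big_nil.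
rewrite (_ : (fun _ => _) = fun x => F i x * \prod_(i <- r) F i x); last first.
  by apply/funext => x; rewrite big_cons.
by rewrite /= exprS mulrS; apply: gevreyM => //; [exact: exprn_ge0|exact: mulrn_wge0].
Qed.

(** A tensor product of cutoffs. With t = sg (x_j - y_j), each factor is 1 for |t| <= 1 and 0 for
    |t| >= 2, so [sg] is an inverse width. *)
Definition plateau (sg : R) y x : R[i] :=
  \prod_(j < n) ((step (2 + sg * (x 0 j - y 0 j)) / step 1)%:C *
                 (step (2 - sg * (x 0 j - y 0 j)) / step 1)%:C).

Lemma plateau_gevrey (sg : R) y : 0 <= sg ->
  gevrey (((step 1)^-1 * (step 1)^-1) ^+ n) ((16 * sg + 16 * sg) *+ n) (plateau sg y).
Proof.
move=> sg0; have I0 : 0 <= (step (1 : R))^-1 by rewrite invr_ge0 ltW // step1_gt0.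
have G (w : R) (j : 'I_n) : `|w| = sg ->
    gevrey (step 1)^-1 (16 * sg) (fun x : 'rV[R]_n => (step (2 + w * (x 0 j - y 0 j)) / step 1)%:C).
  move=> wsg.
  have [sm bd] := gfam_coord w (2 - w * y 0 j) j (gfamZ (step 1)^-1 (@gfam_step R)).
  have E : (fun x : 'rV[R]_n => ((step 1)^-1 * step (w * x 0 j + (2 - w * y 0 j)))%:C) =
    (fun x : 'rV[R]_n => (step (2 + w * (x 0 j - y 0 j)) / step 1)%:C).
    apply/funext => x; congr (_%:C); rewrite mulrC; congr (step _ / _).
    by rewrite mulrBr addrCA.
  rewrite E in sm bd; split=> //; apply: bdd_le bd => k.
  rewrite wsg (ger0_norm I0) exprMn le_eqVlt; apply/orP; left; apply/eqP; ring.
have sz : size (index_enum 'I_n) = n by rewrite -[RHS]card_ord cardE enumT.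
have sg16 : 0 <= 16 * sg by rewrite mulr_ge0.
rewrite -[X in gevrey (_ ^+ X)]sz -[X in _ *+ X]sz; apply: gevrey_prod.
- exact: mulr_ge0.
- exact: addr_ge0.
move=> j; apply: gevreyM => //; first by apply: G; rewrite ger0_norm.
rewrite (_ : (fun x => _) = (fun x : 'rV[R]_n => (step (2 + - sg * (x 0 j - y 0 j)) / step 1)%:C)).
  by apply: G; rewrite normrN ger0_norm.
by apply/funext => x; rewrite mulNr.
Qed.

Lemma plateau1 (sg : R) y x : (forall j, `|sg * (x 0 j - y 0 j)| <= 1) -> plateau sg y x = 1.
Proof.
move=> h; rewrite /plateau big1 // => j _.
have I0 : step (1 : R) != 0 by rewrite gt_eqF // step1_gt0.
have := h j; rewrite ler_norml => /andP[h1 h2].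
rewrite !step_ge1 ?divff ?mulr1 //; first by rewrite lerBrDl; lra.
by lra.
Qed.

Lemma plateau0 (sg : R) y x j : 2 <= `|sg * (x 0 j - y 0 j)| -> plateau sg y x = 0.
Proof.
move=> h; rewrite /plateau (bigD1 j) //=.
suff -> : (step (2 + sg * (x 0 j - y 0 j)) / step 1)%:C * (step (2 - sg * (x 0 j - y 0 j)) / step 1)%:C = 0 :> R[i].
  by rewrite mul0r.
move: h; set t := sg * _ => h.
have [t0|t0] := leP 0 t.
  rewrite (@step0 _ (2 - t)) ?mul0r ?mulr0 //; move: h; rewrite ger0_norm // => h; lra.
rewrite (@step0 _ (2 + t)) ?mul0r //; move: h; rewrite ltr0_norm // => h; lra.
Qed.

End Composition.

(** * Plane waves *)

Section Wave.
Context {R : realType} {n : nat}.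
Implicit Types (x y xi : 'rV[R]_n) (s : seq 'I_n).

Definition phase (lam : R) xi y x : R := \sum_(j < n) lam * xi 0 j * (x 0 j - y 0 j).

Definition wave (lam : R) xi y x : R[i] := cos (phase lam xi y x) +i* sin (phase lam xi y x).

Lemma phase_line lam xi y x (j : 'I_n) (h : R) :
  phase lam xi y (h *: basis_vec j + x) = lam * xi 0 j * h + phase lam xi y x.
Proof.
rewrite /phase (bigD1 j) //= [in RHS](bigD1 j) //= !mxE !eqxx /=.
rewrite (eq_bigr (fun i => lam * xi 0 i * (x 0 i - y 0 i))); last first.
  by move=> i ij; rewrite !mxE (negbTE ij) andbF mulr0 add0r.
by ring.
Qed.

Lemma continuous_phase lam xi y : continuous (phase lam xi y).
Proof.
rewrite /phase; elim: (index_enum _) => [|j r IH] x.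
  rewrite (_ : (fun _ => _) = fun _ => 0); first exact: cst_continuous.
  by apply/funext => z; rewrite big_nil.
rewrite (_ : (fun _ => _) = fun z : 'rV[R]_n => lam * xi 0 j * (z 0 j - y 0 j) +
   \sum_(i <- r) lam * xi 0 i * (z 0 i - y 0 i)).
  apply: (@continuousD _ _ _ (fun z : 'rV[R]_n => lam * xi 0 j * (z 0 j - y 0 j))); last exact: IH.
  apply: (@continuousM _ _ (fun _ => lam * xi 0 j) (fun z : 'rV[R]_n => z 0 j - y 0 j)).
    exact: cst_continuous.
  apply: (@continuousB _ _ _ (fun z : 'rV[R]_n => z 0 j) (fun _ => y 0 j)).
    exact: (@coord_continuous R 1 n 0 j).
  exact: cst_continuous.
by apply/funext => z; rewrite big_cons.
Qed.

Lemma normc_wave lam xi y x : normc (wave lam xi y x) = 1.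
Proof. by rewrite /= cos2Dsin2 sqrtr1. Qed.

Lemma wave_center lam xi y : wave lam xi y y = 1.
Proof.
rewrite /wave (_ : phase _ _ _ _ = 0) ?cos0 ?sin0 //.
by rewrite /phase big1 // => j _; rewrite subrr mulr0.
Qed.

Lemma is_derive_wave lam xi y x (j : 'I_n) :
  is_derive x (basis_vec j) (re_part (wave lam xi y)) (- sin (phase lam xi y x) * (lam * xi 0 j)) /\
  is_derive x (basis_vec j) (im_part (wave lam xi y)) (cos (phase lam xi y x) * (lam * xi 0 j)).
Proof.
split.
  apply: (@is_derive_affine _ _ _ cos) (is_derive_cos _) => h.
  by rewrite /re_part /= phase_line.
apply: (@is_derive_affine _ _ _ sin) (is_derive_sin _) => h.
by rewrite /im_part /= phase_line.
Qed.

Lemma tame_wave lam xi y x : tame (wave lam xi y) x.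
Proof.
split.
- apply: (@continuous_comp _ _ _ (phase lam xi y) cos); [exact: continuous_phase|exact: continuous_cos].
- apply: (@continuous_comp _ _ _ (phase lam xi y) sin); [exact: continuous_phase|exact: continuous_sin].
- by move=> j; have [[? _] [? _]] := is_derive_wave lam xi y x j.
Qed.

Lemma Dj_wave lam xi y x (j : 'I_n) :
  Dj j (wave lam xi y) x = (lam * xi 0 j)%:C * wave lam xi y x.
Proof.
have [[_ e1] [_ e2]] := is_derive_wave lam xi y x j; rewrite DjE e1 e2 /wave.
by apply/eqP; rewrite eq_complex /=; apply/andP; split; apply/eqP; ring.
Qed.

Lemma dseq_wave lam xi y s :
  dseq s (wave lam xi y) = fun x => (\prod_(j <- s) (lam * xi 0 j)%:C) * wave lam xi y x.
Proof.
elim: s => [|j s IH]; first by apply/funext => x; rewrite big_nil mul1r.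
apply/funext => x; rewrite -[LHS]/(Dj j (dseq s (wave lam xi y)) x) IH.
rewrite (DjM _ (tame_cst _ x) (tame_wave lam xi y x)) Dj_cst mul0r add0r Dj_wave big_cons.
by rewrite mulrA (mulrC (\prod_(_ <- _) _)).
Qed.

Lemma smooth_wave lam xi y U : smooth U (wave lam xi y).
Proof.
move=> s x _; have T : tame (dseq s (wave lam xi y)) x.
  by rewrite dseq_wave; exact: tameM (tame_cst _ _) (tame_wave _ _ _ _).
exact: T.
Qed.

End Wave.

(** * Integration by parts and the action on distributions *)

Section TupleMeasurability.
Context {R : realType}.
Local Notation tup n := (n.-tuple (measurableTypeR R)).

(** An open set is the union of the countably many cubes with rational centre and radius 1/(k+1)
    that it contains, and a cube is measurable coordinate by coordinate. *)
Lemma open_rV_measurable n (O : set 'rV[R]_n) : open O ->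
  measurable (rV_of_tuple @^-1` O : set (tup n)).
Proof.
move=> oO; pose cube (i : {ffun 'I_n -> rat} * nat) : set 'rV[R]_n :=
  [set x | forall j, `|x 0 j - ratr (i.1 j)| < i.2.+1%:R^-1].
pose D (i : {ffun 'I_n -> rat} * nat) : set (tup n) :=
  if `[< cube i `<=` O >] then rV_of_tuple @^-1` cube i else set0.
have mcube i : measurable (rV_of_tuple @^-1` cube i : set (tup n)).
  rewrite (_ : rV_of_tuple @^-1` cube i = \bigcap_(j in [set: 'I_n])
    ((fun t : tup n => tnth t j) @^-1` ball (ratr (i.1 j) : R) (i.2.+1%:R^-1))).
    apply: fin_bigcap_measurable; first exact: finite_finset.
    move=> j _; rewrite -[X in measurable X]setTI.
    apply: (@measurable_tnth _ _ n j measurableT).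
    exact: (open_measurable (@ball_open R R _ _)).
  apply/seteqP; split=> t /= ht j; last first.
    by have := ht j Logic.I; rewrite /= -ball_normE /= mxE distrC.
  by move=> _; have := ht j; rewrite /= -ball_normE /= mxE distrC.
suff -> : (rV_of_tuple @^-1` O : set (tup n)) = \bigcup_i D i.
  apply: countable_bigcupT_measurable; first exact: countableP.
  by move=> i; rewrite /D; case: ifP => _; [exact: mcube|exact: measurable0].
apply/seteqP; split=> [t Ot|t [i _]]; last first.
  by rewrite /D; case: asboolP => // iO /iO.
have /nbhs_ballP[e /= e0 eO] : nbhs (rV_of_tuple t) O by exact: open_nbhs_nbhs.
have [k hk] : exists k : nat, k.+1%:R^-1 < e / 2.
  have e2 : 0 < e / 2 by rewrite divr_gt0.
  exists (Num.truncn (e / 2)^-1).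
  by rewrite invf_plt ?posrE ?ltr0n // truncnS_gt.
have k0 : 0 < k.+1%:R^-1 :> R by rewrite invr_gt0.
have q j : {q : rat | `|rV_of_tuple t 0 j - ratr q| < k.+1%:R^-1}.
  apply: cid; have /rat_in_itvoo[q] : rV_of_tuple t 0 j - k.+1%:R^-1 < rV_of_tuple t 0 j + k.+1%:R^-1.
    by rewrite ltrBlDr -addrA ltrDl addr_gt0.
  by rewrite in_itv /= -ltr_distl distrC => hq; exists q.
exists ([ffun j => sval (q j)], k) => //; rewrite /D; case: asboolP.
  by move=> _ j /=; rewrite ffunE; exact: (svalP (q j)).
case=> y cy; apply: eO; split=> // i j; rewrite (ord1 i) -ball_normE /=.
have := cy j; rewrite /= ffunE => h1; have h2 := svalP (q j).
apply: le_lt_trans (ler_distD (ratr (sval (q j))) _ _) _.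
rewrite [X in _ < X]splitr; apply: ltrD; first exact: lt_trans h2 hk.
by rewrite distrC; exact: lt_trans h1 hk.
Qed.

Lemma closed_rV_measurable n (K : set 'rV[R]_n) : closed K ->
  measurable (rV_of_tuple @^-1` K : set (tup n)).
Proof.
move=> /closed_openC /open_rV_measurable /measurableC.
by rewrite -preimage_setC setCK.
Qed.

Lemma compact_rV_measurable n (K : set 'rV[R]_n) : compact K ->
  measurable (rV_of_tuple @^-1` K : set (tup n)).
Proof. move=> cK; apply: closed_rV_measurable; apply: compact_closed cK; exact: norm_hausdorff. Qed.

Lemma continuous_rV_measurable n (O : set 'rV[R]_n) (F : 'rV[R]_n -> R) :
  open O -> (forall x, O x -> {for x, continuous F}) ->
  measurable_fun (rV_of_tuple @^-1` O : set (tup n)) (F \o rV_of_tuple).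
Proof.
move=> oO cF; apply: (measurability _ (RGenOpens.measurableE R)).
move=> _ [_ [a [b ->] <-]].
apply: (@open_rV_measurable n (O `&` F @^-1` `]a, b[%classic)).
rewrite openE => x [Ox Fx].
rewrite /interior; apply: filterI; first exact: open_nbhs_nbhs.
by apply: cF => //; apply: open_nbhs_nbhs; split=> //; exact: interval_open.
Qed.

End TupleMeasurability.

(** * Integrals of continuous functions with compact support *)

Section CompactSupportIntegrals.
Context {R : realType}.
Local Notation tup n := (n.-tuple (measurableTypeR R)).

Definition cube n (r : R) : set 'rV[R]_n := [set x | forall j, `|x 0 j| <= r].

Lemma compact_sub_cube n (K : set 'rV[R]_n) : compact K -> exists r, K `<=` cube r.
Proof.
move=> /compact_bounded[M [_ hM]]; exists (M + 1) => x Kx j.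
have := hM (M + 1); rewrite ltrDl => /(_ ltr01 x Kx); apply: le_trans.
rewrite [leRHS]/Num.norm /= mx_normrE; apply/bigmax_geP; right => /=.
by exists (0, j).
Qed.

Lemma closed_cube n r : closed (@cube n r).
Proof.
rewrite (_ : cube r = \bigcap_(j in [set: 'I_n]) ((fun x : 'rV[R]_n => `|x 0 j|) @^-1` [set z | z <= r])).
  apply: closed_bigI => j _; apply: closed_comp; last exact: closed_le.
  by move=> x _; exact: (cvg_norm (@coord_continuous R 1 n 0 j x)).
by apply/seteqP; split=> x /= h; [move=> j _; exact: h|move=> j; exact: (h j)].
Qed.

Lemma compact_cube n r : compact (@cube n r).
Proof.
apply: bounded_closed_compact; last exact: closed_cube.
exists `|r|; split; first exact: num_real.
move=> M rM x hx /=; rewrite [leLHS]/Num.norm /= mx_normrE.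
apply/bigmax_leP; split; first by apply: le_trans (ltW rM).
move=> [i j] _ /=; rewrite (ord1 i); apply: le_trans (hx j) _.
by apply: le_trans (ltW rM); exact: ler_norm.
Qed.

Lemma tcons_cube n (r : R) :
  @tcons R n @^-1` (rV_of_tuple @^-1` @cube n.+1 r) =
  `[- r, r]%classic `*` (rV_of_tuple @^-1` @cube n r).
Proof.
apply/seteqP; split=> [[x t] /= h|[x t] /= [h1 h2] j].
  split; first by have := h ord0; rewrite mxE /tcons tnth0 in_itv /= ler_norml.
  by move=> j; have := h (lift ord0 j); rewrite !mxE /tcons tnthS.
rewrite !mxE /tcons; case: (unliftP ord0 j) => [k ->|->].
  by rewrite tnthS; have := h2 k; rewrite mxE.
by rewrite tnth0 ler_norml; move: h1; rewrite in_itv.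
Qed.

Lemma lebesgue_nd_cube n (r : R) :
  (lebesgue_nd n (rV_of_tuple @^-1` @cube n r) < +oo)%E.
Proof.
elim: n => [|n IH].
  rewrite /= /dirac indicE; exact: ltry.
rewrite -[ltLHS]/((@lebesgue_measure R \x lebesgue_nd n)%E (@tcons R n @^-1` (rV_of_tuple @^-1` @cube n.+1 r))).
rewrite tcons_cube product_measure1E; first last.
- apply: closed_rV_measurable; exact: closed_cube.
- exact: measurable_itv.
have fin : (@lebesgue_measure R `[(- r)%R, r]%classic < +oo)%E.
  by rewrite lebesgue_measure_itv /=; case: ifP => _; rewrite ?ltry // -EFinB ltry.
by apply: lte_mul_pinfty => //; rewrite ge0_fin_numE.
Qed.

Lemma lebesgue_nd_compact n (K : set 'rV[R]_n) : compact K ->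
  (lebesgue_nd n (rV_of_tuple @^-1` K) < +oo)%E.
Proof.
move=> cK; have [r Kr] := compact_sub_cube cK.
apply: le_lt_trans (lebesgue_nd_cube n r); apply: le_measure; rewrite ?inE.
- exact: compact_rV_measurable.
- apply: closed_rV_measurable; exact: closed_cube.
- by move=> t /Kr.
Qed.

Definition ccont n (F : 'rV[R]_n -> R) : Prop :=
  continuous F /\ exists r, forall x, ~ cube r x -> F x = 0.

Lemma measurable_rV n (F : 'rV[R]_n -> R) : continuous F ->
  measurable_fun [set: tup n] (F \o rV_of_tuple).
Proof.
move=> cF; rewrite -[X in measurable_fun X](preimage_setT (@rV_of_tuple R n)).
exact: (continuous_rV_measurable openT (fun x _ => cF x)).
Qed.

Lemma ccont_bounded n (F : 'rV[R]_n -> R) : ccont F -> exists2 B, 0 <= B & forall x, `|F x| <= B.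
Proof.
move=> [cF [r Fr]].
have : compact (F @` cube r).
  by apply: continuous_compact; [exact: continuous_subspaceT|exact: compact_cube].
move=> /compact_bounded[M [_ hM]]; exists (`|M| + 1); first by rewrite addr_ge0.
move=> x; have [xr|xr] := pselect (cube r x); last by rewrite Fr // normr0 addr_ge0.
have := hM (`|M| + 1); rewrite (le_lt_trans (ler_norm M)) ?ltrDl // => /(_ isT (F x)).
by apply; exists x.
Qed.

Lemma ccont_integrable n (F : 'rV[R]_n -> R) : ccont F ->
  (lebesgue_nd n).-integrable setT (EFin \o (F \o rV_of_tuple)).
Proof.
move=> cF; have [B _ FB] := ccont_bounded cF; have [cF1 [r Fr]] := cF.
have mC : measurable (rV_of_tuple @^-1` @cube n r : set (tup n)) by apply: closed_rV_measurable; exact: closed_cube.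
have : (lebesgue_nd n).-integrable (rV_of_tuple @^-1` cube r) (EFin \o (F \o rV_of_tuple)).
  apply: measurable_bounded_integrable => //; first exact: lebesgue_nd_cube.
    exact: measurable_funTS (measurable_rV cF1).
  exists B; split; first exact: num_real.
  by move=> M BM t _ /=; apply: le_trans (ltW BM).
rewrite integrable_mkcond // (_ : _ \_ _ = EFin \o (F \o rV_of_tuple)) //.
apply/funext => t; rewrite patchE; case: ifPn => // /negP tC.
rewrite /= Fr // => h; apply: tC; exact: mem_set.
Qed.

Lemma integral_derive_ccont (f g : R -> R) (r : R) :
  (forall x : R, is_derive x 1 f (g x)) -> continuous g ->
  (forall x, r < `|x| -> f x = 0) ->
  (\int[lebesgue_measure]_x (g x)%:E = 0)%E.
Proof.
(* Positive and larger than [r] whatever the sign of [r], so [f] vanishes at both ends of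
   [-b, b]. *)
move=> fg cg fr; pose b : R := `|r| + 1.
have b0 : 0 < b by rewrite ltr_wpDl.
have rb : r < b by rewrite (le_lt_trans (ler_norm r)) // ltrDl.
have g0 x : r < `|x| -> g x = 0.
  move=> rx; have [_ <-] := fg x.
  rewrite (@near_eq_derive _ _ _ f (fun _ => 0)) ?derive_cst //.
  near=> y; apply: fr; near: y.
  have : `|y| @[y --> x] --> `|x| by exact: norm_continuous.
  by move=> /cvgr_gt /(_ _ rx).
have cf : continuous f by move=> x; apply/differentiable_continuous/derivable1_diffP; have [] := fg x.
have Nb : - b < b by rewrite gtrN.
transitivity (\int[@lebesgue_measure R]_(x in `[(- b)%R, b]) (g x)%:E)%E.
  rewrite [RHS]integral_mkcond; apply: eq_integral => x _; rewrite patchE.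
  case: ifPn => // /negP xb; rewrite g0 //; rewrite ltNge; apply/negP => xr; apply: xb.
  by rewrite inE /= in_itv /= -ler_norml (le_trans xr) // ltW.
rewrite (continuous_FTC2 (F := f) Nb).
- by rewrite !fr ?normrN ?ger0_norm ?subee // ltW.
- exact: continuous_subspaceT.
- split; first by move=> x _; have [] := fg x.
    by apply: cvg_at_right_filter; exact: cf.
  by apply: cvg_at_left_filter; exact: cf.
- by move=> x _; rewrite derive1E; have [] := fg x.
Unshelve. all: by end_near. Qed.

End CompactSupportIntegrals.

Section Consr.
Context {R : realType}.

(** The counterpart of [tcons] on row vectors; it splits off the head coordinate for Fubini. *)
Definition consr n (x : R) (y : 'rV[R]_n) : 'rV[R]_n.+1 :=
  \row_i (if unlift ord0 i is Some k then y 0 k else x).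

Lemma rV_of_tuple_tcons n (z : R * n.-tuple (measurableTypeR R)) :
  rV_of_tuple (tcons z) = consr z.1 (rV_of_tuple z.2).
Proof.
apply/rowP => i; rewrite !mxE /tcons; case: unliftP => [k ->|->]; last by rewrite tnth0.
by rewrite tnthS mxE.
Qed.

Lemma consr_head n (x : R) (y : 'rV[R]_n) :
  consr x y = consr 0 y + x *: basis_vec ord0.
Proof.
apply/rowP => i; rewrite !mxE eqxx /=; case: unliftP => [k ->|->].
  by rewrite eq_sym (negbTE (neq_lift _ _)) mulr0 addr0.
by rewrite eqxx mulr1 add0r.
Qed.

Lemma consr_tail n (x h : R) (y : 'rV[R]_n) (k : 'I_n) :
  consr x (h *: basis_vec k + y) = h *: basis_vec (lift ord0 k) + consr x y.
Proof.
apply/rowP => i; rewrite !mxE eqxx /=; case: unliftP => [l ->|->].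
  by rewrite !mxE eqxx /= (inj_eq (@lift_inj _ ord0)).
by rewrite (negbTE (neq_lift _ _)) mulr0 add0r.
Qed.

Lemma continuous_consr n (x : R) : continuous (@consr n x).
Proof.
move=> y A /nbhs_ballP[e /= e0 eA].
apply/(nbhs_ballP y); exists e => //= z [_ yz]; apply: eA; split=> // i j.
rewrite (ord1 i) !mxE; case: unliftP => [k _|_]; last exact: ballxx.
exact: yz.
Qed.

Lemma cube_consr n r (x : R) (y : 'rV[R]_n) :
  cube r (consr x y) -> `|x| <= r /\ cube r y.
Proof.
move=> h; split; first by have := h ord0; rewrite mxE unlift_none.
by move=> k; have := h (lift ord0 k); rewrite mxE liftK.
Qed.

End Consr.

Section IntegrationByParts.
Context {R : realType}.

Lemma ccont_derive n (F : 'rV[R]_n -> R) v : ccont F -> continuous ('D_v F) -> ccont ('D_v F).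
Proof.
move=> [_ [r Fr]] cD; split=> //; exists r => x xr.
rewrite (@near_eq_derive _ _ _ F (fun _ => 0)) ?derive_cst //.
have oC : open (~` @cube R n r) by apply: closed_openC; exact: closed_cube.
by apply: (@filterS _ (nbhs x) _ _ _ _ (open_nbhs_nbhs (conj oC xr))) => y; exact: Fr.
Qed.

Lemma integrable_tcons n (f : (n.+1).-tuple (measurableTypeR R) -> \bar R) :
  (lebesgue_nd n.+1).-integrable setT f ->
  (lebesgue_measure \x lebesgue_nd n)%E.-integrable setT (f \o @tcons R n).
Proof.
move=> /integrableP[mf foo]; apply/integrableP; split.
  exact: measurableT_comp (@measurable_tcons R n).
have := @ge0_integral_pushforward _ _ _ _ R _ (@measurable_tcons R n)
  (lebesgue_measure \x lebesgue_nd n)%E setT (fun t => `|f t|%E).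
rewrite preimage_setT => <- //.
  exact: measurableT_comp.
Qed.

Lemma integral_tcons n (f : (n.+1).-tuple (measurableTypeR R) -> \bar R) :
  (lebesgue_nd n.+1).-integrable setT f ->
  (\int[lebesgue_nd n.+1]_t f t =
   \int[(lebesgue_measure \x lebesgue_nd n)]_z f (tcons z))%E.
Proof.
move=> intf; have mf := measurable_int _ intf.
rewrite -[LHS]/(\int[pushforward (lebesgue_measure \x lebesgue_nd n)%E (@tcons R n)]_t f t)%E.
rewrite (integral_pushforward (@measurable_tcons R n)) //.
by rewrite preimage_setT; exact: integrable_tcons.
Qed.

(** Induction on n by Fubini. If [j] is a tail direction, the tail is integrated first with the head
    frozen, by the induction hypothesis; if [j] is the head, the line is integrated first, by the
    one-dimensional case. *)
Lemma integral_derive_nd n (F : 'rV[R]_n -> R) (j : 'I_n) :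
  ccont F -> (forall x, derivable F x (basis_vec j)) ->
  continuous ('D_(basis_vec j) F) ->
  (\int[lebesgue_nd n]_t ('D_(basis_vec j) F (rV_of_tuple t))%:E = 0)%E.
Proof.
elim: n F j => [|n IH] F j; first by case: j.
move=> cF dF cD.
have cG := ccont_derive cF cD.
have [cF1 [r Fr]] := cF.
have iG := ccont_integrable cG.
rewrite (integral_tcons iG); have := integrable_tcons iG => {}iG.
case: (unliftP ord0 j) => [k jE|jE].
  rewrite -(integral12_prod_meas1 iG) -[RHS](integral0 lebesgue_measure setT).
  apply: eq_integral => x _; rewrite /fubini_F /=.
  pose Fx y := F (consr x y).
  have E y : (fun h : R => h^-1 *: (Fx (h *: basis_vec k + y) - Fx y)) =
      (fun h : R => h^-1 *: (F (h *: basis_vec j + consr x y) - F (consr x y))).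
    by apply/funext => h; rewrite /Fx consr_tail jE.
  have DE y : 'D_(basis_vec k) Fx y = 'D_(basis_vec j) F (consr x y).
    by rewrite /derive E.
  have dFx y : derivable Fx y (basis_vec k).
    by rewrite /derivable E; exact: dF.
  under eq_integral do rewrite rV_of_tuple_tcons /= -DE.
  apply: IH => //.
    split; first by move=> y; apply: continuous_comp; [exact: continuous_consr|exact: cF1].
    by exists r => y yr; apply: Fr => /cube_consr[].
  rewrite (_ : 'D_(basis_vec k) Fx = 'D_(basis_vec j) F \o consr x); last exact/funext.
  by move=> y; apply: continuous_comp; [exact: continuous_consr|exact: cD].
rewrite -(integral21_prod_meas1 iG) -[RHS](integral0 (lebesgue_nd n) setT).
apply: eq_integral => t _; rewrite /fubini_G /=.
under eq_integral do rewrite rV_of_tuple_tcons /= consr_head.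
set y := rV_of_tuple t.
apply: (@integral_derive_ccont _ (fun x => F (consr 0 y + x *: basis_vec ord0)) _ r).
- by move=> x; rewrite jE; apply: is_derive_line; rewrite -jE; exact: dF.
- have ca : continuous (fun x : R => consr 0 y + x *: basis_vec ord0).
    by move=> x; apply: cvgD; [exact: cvg_cst|exact: scalel_continuous].
  by move=> x; exact: continuous_comp (ca x) (cD _).
- move=> x rx; apply: Fr; rewrite -consr_head => /cube_consr[xr _].
  by move: rx; rewrite ltNge xr.
Qed.

End IntegrationByParts.

(** * Test functions *)

Section Testfunctions.
Context {R : realType} {n : nat}.
Implicit Types (f g phi psi : 'rV[R]_n -> R[i]) (Om K : set 'rV[R]_n).

Lemma closed_compact_rV K : compact K -> closed K.
Proof. by move=> cK; apply: compact_closed cK; exact: norm_hausdorff. Qed.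

Lemma supported_near K f x : closed K -> supported_in K f -> ~ K x ->
  \near x, f x = 0.
Proof.
move=> cK sK Kx; have oC := closed_openC cK.
by apply: (@filterS _ (nbhs x) _ _ _ _ (open_nbhs_nbhs (conj oC Kx))) => y; exact: sK.
Qed.

Lemma supported_Dj K f j : closed K -> supported_in K f -> supported_in K (Dj j f).
Proof.
move=> cK sK x Kx; rewrite (@Dj_near _ _ j f (fun _ => 0)) ?Dj_cst //.
exact: supported_near sK Kx.
Qed.

Lemma supported_dseq K f s : closed K -> supported_in K f -> supported_in K (dseq s f).
Proof. by move=> cK sK; elim: s => [//|j s IH]; exact: supported_Dj. Qed.

Lemma supportedM K f g : supported_in K g -> supported_in K (fun x => f x * g x).
Proof. by move=> sg x /sg ->; rewrite mulr0. Qed.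

(** Smoothness is local: near a point of [K] it holds by assumption, and off the closed set [K] the
    function is 0. *)
Lemma smooth_extend K Om f : closed K -> open Om -> K `<=` Om ->
  supported_in K f -> smooth Om f -> smooth setT f.
Proof.
move=> cK oO KO sK sf; apply: smooth_local => x _.
have [Kx|Kx] := pselect (K x); first by exists Om; split=> //; exact: KO.
exists (~` K); split=> //; first exact: closed_openC.
apply: (@smooth_eq _ _ _ (fun _ => 0)); first exact: closed_openC.
  by move=> y Ky; rewrite sK.
by apply: smooth_cst; exact: closed_openC.
Qed.

Lemma test_functionM Om f phi : open Om -> smooth Om f -> test_function Om phi ->
  test_function Om (fun x => f x * phi x).
Proof.
move=> oO sf [sphi [K [cK KO sK]]]; split; last first.
  by exists K; split=> //; exact: supportedM.
apply: (smooth_extend (closed_compact_rV cK) oO KO (supportedM f sK)).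
exact: smoothM oO sf (smooth_subset (@subsetT _ Om) sphi).
Qed.

Lemma test_function_dseq Om phi s : test_function Om phi -> test_function Om (dseq s phi).
Proof.
move=> [sphi [K [cK KO sK]]]; split; first exact: smooth_dseq.
by exists K; split=> //; exact: supported_dseq (closed_compact_rV cK) sK.
Qed.

Lemma test_function0 Om : test_function Om (fun _ : 'rV[R]_n => 0 : R[i]).
Proof.
split; first exact: (smooth_cst 0 openT).
by exists set0; split=> //; exact: compact0.
Qed.

Lemma test_functionD Om phi psi : test_function Om phi -> test_function Om psi ->
  test_function Om (fun x => phi x + psi x).
Proof.
move=> [s1 [K1 [c1 KO1 h1]]] [s2 [K2 [c2 KO2 h2]]]; split.
  exact: (smoothD openT s1 s2).
exists (K1 `|` K2); split; first exact: compactU.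
  by move=> x [/KO1|/KO2].
by move=> x hx; rewrite h1 ?h2 ?addr0 // => ?; apply: hx; [right|left].
Qed.

Lemma test_functionZ Om (c : R[i]) phi : test_function Om phi ->
  test_function Om (fun x => c * phi x).
Proof.
move=> [s1 [K1 [c1 KO1 h1]]]; split.
  exact: (smoothM openT (smooth_cst c openT) s1).
by exists K1; split=> //; exact: supportedM.
Qed.

Lemma test_function_sum Om I (r : seq I) (Q : pred I) (F : I -> 'rV[R]_n -> R[i]) :
  (forall i, Q i -> test_function Om (F i)) ->
  test_function Om (fun x => \sum_(i <- r | Q i) F i x).
Proof.
move=> tF; elim: r => [|i r IH].
  rewrite (_ : (fun _ => _) = (fun _ => 0)); first exact: test_function0.
  by apply/funext => x; rewrite big_nil.
have [Qi|Qi] := boolP (Q i).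
  rewrite (_ : (fun _ => _) = (fun x => F i x + \sum_(i <- r | Q i) F i x)).
    exact: test_functionD (tF _ Qi) IH.
  by apply/funext => x; rewrite big_cons Qi.
rewrite (_ : (fun _ => _) = (fun x => \sum_(i <- r | Q i) F i x)) //.
by apply/funext => x; rewrite big_cons (negbTE Qi).
Qed.

Lemma test_function_ccont Om phi : test_function Om phi ->
  ccont (re_part phi) /\ ccont (im_part phi).
Proof.
move=> [sphi [K [cK KO sK]]]; have [r Kr] := compact_sub_cube cK.
split; split.
- by move=> x; have [] := sphi [::] x Logic.I.
- by exists r => x xr; rewrite /re_part sK // => /Kr.
- by move=> x; have [] := sphi [::] x Logic.I.
- by exists r => x xr; rewrite /im_part sK // => /Kr.
Qed.

End Testfunctions.

(** * Integrals of complex test functions *)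

Section Integrals.
Context {R : realType} {n : nat}.
Implicit Types (f g phi psi : 'rV[R]_n -> R[i]) (Om K : set 'rV[R]_n).
Implicit Types F : 'rV[R]_n -> R.

Lemma Rintegral_support (A : set 'rV[R]_n) F : (forall x, ~ A x -> F x = 0) ->
  \int[lebesgue_nd n]_(t in rV_of_tuple @^-1` A) F (rV_of_tuple t) =
  \int[lebesgue_nd n]_t F (rV_of_tuple t).
Proof.
move=> F0; rewrite Rintegral_mkcond; congr (Rintegral _ _ _).
apply/funext => t; rewrite patchE; case: ifPn => // /negP h.
by rewrite F0 // => h'; apply: h; rewrite inE.
Qed.

(** Integrands supported inside the open set are integrated over the whole space, where integration
    by parts has no boundary term. *)
Definition cint f : R[i] := cintegral setT f.

Lemma cintE f : cint f =
  (\int[lebesgue_nd n]_t re_part f (rV_of_tuple t)) +i*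
  (\int[lebesgue_nd n]_t im_part f (rV_of_tuple t)).
Proof. by rewrite /cint /cintegral preimage_setT. Qed.

Lemma cintegral_test Om phi : test_function Om phi -> cintegral Om phi = cint phi.
Proof.
move=> [_ [K [_ KO sK]]]; rewrite cintE /cintegral; congr (_ +i* _).
  by apply: Rintegral_support => x Ox; rewrite /re_part sK // => /KO.
by apply: Rintegral_support => x Ox; rewrite /im_part sK // => /KO.
Qed.

Lemma RintegralD_ccont F G : ccont F -> ccont G ->
  \int[lebesgue_nd n]_t (F (rV_of_tuple t) + G (rV_of_tuple t)) =
  \int[lebesgue_nd n]_t F (rV_of_tuple t) + \int[lebesgue_nd n]_t G (rV_of_tuple t).
Proof.
by move=> cF cG; apply: RintegralD => //; exact: ccont_integrable.
Qed.

Lemma RintegralZ_ccont (c : R) F : ccont F ->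
  \int[lebesgue_nd n]_t (c * F (rV_of_tuple t)) = c * \int[lebesgue_nd n]_t F (rV_of_tuple t).
Proof.
by move=> cF; apply: RintegralZl => //; exact: ccont_integrable.
Qed.

Lemma ccontZ (c : R) F : ccont F -> ccont (fun x => c * F x).
Proof.
move=> [cF [r Fr]]; split; last by exists r => x /Fr ->; rewrite mulr0.
by move=> x; exact: (@continuousM _ _ (fun _ => c) F x (@cst_continuous _ _ c x) (cF x)).
Qed.

Lemma cintD Om phi psi : test_function Om phi -> test_function Om psi ->
  cint (fun x => phi x + psi x) = cint phi + cint psi.
Proof.
move=> /test_function_ccont[r1 i1] /test_function_ccont[r2 i2].
rewrite !cintE re_partD im_partD.
by apply/eqP; rewrite eq_complex /=; apply/andP; split; apply/eqP; exact: RintegralD_ccont.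
Qed.

Lemma cintZ Om (c : R[i]) phi : test_function Om phi -> cint (fun x => c * phi x) = c * cint phi.
Proof.
move=> /test_function_ccont[r1 i1]; case: c => a b; rewrite !cintE re_partM im_partM.
apply/eqP; rewrite eq_complex /=; apply/andP; split; apply/eqP.
  have := RintegralD_ccont (ccontZ a r1) (ccontZ (- b) i1).
  rewrite !RintegralZ_ccont // mulNr => <-.
  by congr (Rintegral _ _ _); apply/funext => t; rewrite mulNr.
have := RintegralD_ccont (ccontZ a i1) (ccontZ b r1).
by rewrite !RintegralZ_ccont.
Qed.

Lemma cint_sum Om I (r : seq I) (Q : pred I) (F : I -> 'rV[R]_n -> R[i]) :
  (forall i, Q i -> test_function Om (F i)) ->
  cint (fun x => \sum_(i <- r | Q i) F i x) = \sum_(i <- r | Q i) cint (F i).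
Proof.
move=> tF; elim: r => [|i r IH].
  rewrite big_nil (_ : (fun _ => _) = (fun _ => 0 * 0)).
    by rewrite (cintZ 0 (test_function0 Om)) mul0r.
  by apply/funext => x; rewrite big_nil mul0r.
rewrite big_cons; have [Qi|Qi] := boolP (Q i).
  rewrite -IH -(cintD (tF _ Qi) (test_function_sum r tF)).
  by congr cint; apply/funext => x; rewrite big_cons Qi.
by rewrite -IH; congr cint; apply/funext => x; rewrite big_cons (negbTE Qi).
Qed.

Lemma cint_Dj Om phi j : test_function Om phi -> cint (Dj j phi) = 0.
Proof.
move=> tphi; have [r1 i1] := test_function_ccont tphi; have [sphi _] := tphi.
rewrite cintE re_part_Dj im_part_Dj.
have [cr ci] : continuous (fun x => 'D_(basis_vec j) (im_part phi) x) /\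
     continuous (fun x => - 'D_(basis_vec j) (re_part phi) x).
  rewrite -re_part_Dj -im_part_Dj; split=> x.
    by have [] := sphi [:: j] x Logic.I.
  by have [] := sphi [:: j] x Logic.I.
have dI x : derivable (im_part phi) x (basis_vec j).
  by have [_ _ /(_ j)[_ d]] := sphi [::] x Logic.I; exact: d.
have dR x : derivable (re_part phi) x (basis_vec j).
  by have [_ _ /(_ j)[d _]] := sphi [::] x Logic.I; exact: d.
have cR : continuous ('D_(basis_vec j) (re_part phi)).
  rewrite (_ : 'D_(basis_vec j) (re_part phi) = fun x => - - 'D_(basis_vec j) (re_part phi) x).
    by move=> x; exact: (continuousN (ci x)).
  by apply/funext => y; rewrite opprK.
apply/eqP; rewrite eq_complex /=; apply/andP; split; apply/eqP.
  by rewrite /Rintegral (integral_derive_nd i1 dI cr).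
have := RintegralZ_ccont (-1) (ccont_derive r1 cR).
rewrite {2}/Rintegral (integral_derive_nd r1 dR cR) mulr0 => <-.
by congr (Rintegral _ _ _); apply/funext => t; rewrite mulN1r.
Qed.

Lemma cint_parts Om f phi j : open Om -> smooth Om f -> test_function Om phi ->
  cint (fun x => f x * Dj j phi x) = - cint (fun x => Dj j f x * phi x).
Proof.
move=> oO sf tphi; have tjphi := test_function_dseq [:: j] tphi.
have t1 := test_functionM oO sf tjphi; have t2 := test_functionM oO (smooth_Dj j sf) tphi.
apply/eqP; rewrite -addr_eq0 -(cintD t1 t2) -(cint_Dj j (test_functionM oO sf tphi)).
apply/eqP; congr cint; apply/funext => x.
have [sphi [K [cK KO sK]]] := tphi.
(* [f] is smooth only on [Om], so the product rule is available on the support [K]; off [K] all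
   three terms vanish. *)
have [Kx|Kx] := pselect (K x).
  by rewrite (DjM _ (sf [::] _ (KO _ Kx)) (sphi [::] _ Logic.I)) addrC.
have cK' := closed_compact_rV cK.
by rewrite (supported_Dj j cK' (supportedM f sK) Kx) /= (supported_Dj j cK' sK Kx) sK // !mulr0 addr0.
Qed.

(** Moving the derivatives over one at a time reverses the word; symmetry of mixed derivatives
    restores it. *)
Lemma cint_dseq Om f phi s : open Om -> smooth Om f -> test_function Om phi ->
  cint (fun x => f x * dseq s phi x) = (-1) ^+ size s * cint (fun x => dseq s f x * phi x).
Proof.
move=> oO sf tphi.
have H : cint (fun x => f x * dseq s phi x) = (-1) ^+ size s * cint (fun x => dseq (rev s) f x * phi x).
  elim: s f sf => [|j s IH] f sf; first by rewrite mul1r.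
  rewrite (cint_parts j oO sf (test_function_dseq s tphi)) (IH _ (smooth_Dj j sf)).
  by rewrite exprS mulN1r mulNr rev_cons dseq_rcons.
rewrite H; congr (_ * _); congr cint; apply/funext => x.
have [_ [K [_ KO sK]]] := tphi.
have [Kx|Kx] := pselect (K x); last by rewrite sK // !mulr0.
congr (_ * _); apply: dseq_perm oO sf _ (KO _ Kx).
by rewrite perm_rev.
Qed.

End Integrals.

(** * The operator on functions and on distributions *)

Section OperatorAction.
Context {R : realType} {n d : nat}.
Implicit Types (P : diffop R n d) (Om K : set 'rV[R]_n) (f phi : 'rV[R]_n -> R[i]).

(** P acting on functions, as opposed to [apply_op], which acts on functionals. *)
Definition papp P f : 'rV[R]_n -> R[i] := fun x =>
  \sum_(a : mindex n d | (mdeg (mi a) <= d)%N) P a x * dseq (mseq (mi a)) f x.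

Definition smooth_coefs Om P := forall a : mindex n d, (mdeg (mi a) <= d)%N -> smooth Om (P a).

Lemma smooth_papp Om P f : open Om -> smooth_coefs Om P -> smooth Om f -> smooth Om (papp P f).
Proof.
move=> oO sP sf; apply: (smooth_sum _ oO) => a ad.
exact: smoothM oO (sP a ad) (smooth_dseq _ sf).
Qed.

Lemma smooth_iter_papp Om P f k : open Om -> smooth_coefs Om P -> smooth Om f ->
  smooth Om (iter k (papp P) f).
Proof. by move=> oO sP sf; elim: k => [//|k IH]; exact: smooth_papp. Qed.

Lemma supported_papp K P f : closed K -> supported_in K f -> supported_in K (papp P f).
Proof.
by move=> cK sK x Kx; rewrite /papp big1 // => a _; rewrite (supported_dseq _ cK sK Kx) mulr0.
Qed.

Lemma supported_iter_papp K P f k : closed K -> supported_in K f ->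
  supported_in K (iter k (papp P) f).
Proof. by move=> cK sK; elim: k => [//|k IH]; exact: supported_papp. Qed.

Lemma transposeE P phi : transpose P phi = fun x =>
  \sum_(a : mindex n d | (mdeg (mi a) <= d)%N)
    (-1) ^+ mdeg (mi a) * dseq (mseq (mi a)) (fun y => P a y * phi y) x.
Proof.
by apply/funext => x; apply: eq_bigr => a _; rewrite Dmulti_mseq.
Qed.

Lemma test_function_transpose_term Om P phi a : open Om -> smooth_coefs Om P ->
  test_function Om phi -> (mdeg (mi a) <= d)%N ->
  test_function Om (fun x =>
    (-1) ^+ mdeg (mi a) * dseq (mseq (mi a)) (fun y => P a y * phi y) x).
Proof.
move=> oO sP tphi ad; apply: test_functionZ; apply: test_function_dseq.
exact: test_functionM oO (sP a ad) tphi.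
Qed.

Lemma test_function_transpose Om P phi : open Om -> smooth_coefs Om P ->
  test_function Om phi -> test_function Om (transpose P phi).
Proof.
move=> oO sP tphi; rewrite transposeE; apply: test_function_sum => a ad.
exact: test_function_transpose_term.
Qed.

Lemma regular_dist_cint Om f phi : open Om -> smooth Om f -> test_function Om phi ->
  regular_dist Om f phi = cint (fun x => f x * phi x).
Proof.
by move=> oO sf tphi; rewrite /regular_dist (cintegral_test (test_functionM oO sf tphi)).
Qed.

Lemma cint_transpose Om P f phi : open Om -> smooth_coefs Om P -> smooth Om f ->
  test_function Om phi ->
  cint (fun x => f x * transpose P phi x) = cint (fun x => papp P f x * phi x).
Proof.
move=> oO sP sf tphi.
pose F (a : mindex n d) x := f x * ((-1) ^+ mdeg (mi a) * dseq (mseq (mi a)) (fun y => P a y * phi y) x).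
pose G (a : mindex n d) x := dseq (mseq (mi a)) f x * (P a x * phi x).
have tPphi a : (mdeg (mi a) <= d)%N -> test_function Om (fun y => P a y * phi y).
  by move=> ad; exact: test_functionM oO (sP a ad) tphi.
have tF a : (mdeg (mi a) <= d)%N -> test_function Om (F a).
  move=> ad; apply: (test_functionM oO sf); exact: test_function_transpose_term.
have tG a : (mdeg (mi a) <= d)%N -> test_function Om (G a).
  by move=> ad; exact: test_functionM oO (smooth_dseq _ sf) (tPphi a ad).
transitivity (cint (fun x => \sum_(a : mindex n d | (mdeg (mi a) <= d)%N) F a x)).
  by congr cint; apply/funext => x; rewrite transposeE big_distrr.
transitivity (cint (fun x => \sum_(a : mindex n d | (mdeg (mi a) <= d)%N) G a x)); last first.
  congr cint; apply/funext => x; rewrite /papp mulr_suml; apply: eq_bigr => a _.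
  by rewrite /G mulrA (mulrC (P a x)).
rewrite (cint_sum _ tF) (cint_sum _ tG); apply: eq_bigr => a ad.
rewrite (_ : F a = fun x => (-1) ^+ mdeg (mi a) * (f x * dseq (mseq (mi a)) (fun y => P a y * phi y) x)).
  rewrite (cintZ _ (test_functionM oO sf (test_function_dseq _ (tPphi a ad)))).
  rewrite (cint_dseq _ oO sf (tPphi a ad)) size_mseq mulrA -exprD addnn.
  by rewrite -mul2n exprM sqrrN expr1n expr1n mul1r.
by apply/funext => x; rewrite /F mulrCA.
Qed.

(** Distributional and classical iterates agree. The outermost [apply_op] changes the test function
    to its image under the transpose, hence the induction for all [phi]. *)
Lemma iter_apply_op Om P f k phi : open Om -> smooth_coefs Om P -> smooth Om f ->
  test_function Om phi ->
  iter k (apply_op P) (regular_dist Om f) phi = regular_dist Om (iter k (papp P) f) phi.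
Proof.
move=> oO sP sf; elim: k phi => [//|k IH] phi tphi.
have sfk := smooth_iter_papp k oO sP sf.
rewrite -[LHS]/(iter k (apply_op P) (regular_dist Om f) (transpose P phi)) (IH _ (test_function_transpose oO sP tphi)).
rewrite (regular_dist_cint oO sfk (test_function_transpose oO sP tphi)).
rewrite (regular_dist_cint oO _ tphi); last exact: smooth_iter_papp.
by rewrite (cint_transpose oO sP sfk tphi).
Qed.

Lemma smooth_measurable_on Om f : open Om -> smooth Om f -> measurable_on Om f.
Proof.
move=> oO sf; split; apply: continuous_rV_measurable => // x Ox; by have [] := sf [::] x Ox.
Qed.

Lemma smooth_bounded_compact Om K f : smooth Om f -> compact K -> K `<=` Om ->
  exists2 B, 0 <= B & forall x, K x -> normc (f x) <= B.
Proof.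
move=> sf cK KO.
have bd (g : 'rV[R]_n -> R) : (forall x, Om x -> {for x, continuous g}) ->
    exists2 B, 0 <= B & forall x, K x -> `|g x| <= B.
  move=> cg; have cgK : {within K, continuous g}.
    by apply: continuous_in_subspaceT => x /set_mem /KO; exact: cg.
  have /compact_bounded[M [_ hM]] := continuous_compact cgK cK.
  exists (`|M| + 1); first by rewrite addr_ge0.
  move=> x Kx; have := hM (`|M| + 1); rewrite (le_lt_trans (ler_norm M)) ?ltrDl // => /(_ isT (g x)).
  by apply; exists x.
have [B1 B10 h1] := bd (re_part f) (fun x Ox => let: And3 c _ _ := sf [::] x Ox in c).
have [B2 B20 h2] := bd (im_part f) (fun x Ox => let: And3 _ c _ := sf [::] x Ox in c).
exists (B1 + B2); first exact: addr_ge0.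
by move=> x Kx; apply: le_trans (normc_le_ReIm _) _; apply: lerD; [exact: h1|exact: h2].
Qed.

Lemma L2norm_le K f B : compact K -> 0 <= B ->
  measurable_fun (rV_of_tuple @^-1` K) (re_part f \o rV_of_tuple) ->
  measurable_fun (rV_of_tuple @^-1` K) (im_part f \o rV_of_tuple) ->
  (forall x, K x -> normc (f x) <= B) ->
  (L2norm K f <= (B * Num.sqrt (fine (lebesgue_nd n (rV_of_tuple @^-1` K))))%:E)%E.
Proof.
move=> cK B0 mr mi fB.
have mK := compact_rV_measurable cK.
have fin : lebesgue_nd n (rV_of_tuple @^-1` K) \is a fin_num.
  by rewrite ge0_fin_numE // lebesgue_nd_compact.
have h : (\int[lebesgue_nd n]_(t in rV_of_tuple @^-1` K) (normc (f (rV_of_tuple t)) ^+ 2)%:E <=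
    (B ^+ 2)%:E * lebesgue_nd n (rV_of_tuple @^-1` K))%E.
  rewrite -(integral_cst (lebesgue_nd n) mK); apply: ge0_le_integral => //.
  - by move=> t _; rewrite lee_fin sqr_ge0.
  - apply/measurable_EFinP.
    rewrite (_ : (fun _ => _) = fun t => re_part f (rV_of_tuple t) ^+ 2 + im_part f (rV_of_tuple t) ^+ 2).
      by apply: measurable_funD; apply: measurable_funX.
    apply/funext => t; rewrite /re_part /im_part; case: (f _) => a b /=.
    by rewrite sqr_sqrtr // addr_ge0 // sqr_ge0.
  - move=> t Kt; rewrite lee_fin; apply: lerXn2r; rewrite ?nnegrE ?normc_ge0 //.
    exact: fB.
rewrite /L2norm; apply: (@le_trans _ _ (sqrte ((B ^+ 2)%:E * lebesgue_nd n (rV_of_tuple @^-1` K))%E)).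
  by rewrite lee_sqrt // mule_ge0 // lee_fin sqr_ge0.
rewrite -(fineK fin) -EFinM /= lee_fin sqrtrM ?sqr_ge0 //.
by rewrite sqrtr_sqr ger0_norm.
Qed.

Lemma Rintegral_le_support K F B : compact K -> ccont F -> (forall x, ~ K x -> F x = 0) ->
  (forall x, `|F x| <= B) ->
  `|\int[lebesgue_nd n]_t F (rV_of_tuple t)| <= B * fine (lebesgue_nd n (rV_of_tuple @^-1` K)).
Proof.
move=> cK cF F0 FB; rewrite -(Rintegral_support F0).
have mK := compact_rV_measurable cK.
have iF : (lebesgue_nd n).-integrable (rV_of_tuple @^-1` K) (EFin \o (F \o rV_of_tuple)).
  by apply: integrableS (ccont_integrable cF).
have iB : (lebesgue_nd n).-integrable (rV_of_tuple @^-1` K) (EFin \o (fun _ => B)).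
  apply: (measurable_bounded_integrable mK (lebesgue_nd_compact cK) (measurable_cst B)).
  by exists `|B|; split; [exact: num_real|move=> M BM t _ /=; exact: ltW].
apply: le_trans (le_normr_Rintegral mK iF) _.
rewrite -(Rintegral_cst _ mK); apply: le_Rintegral => //; first exact: integrable_norm.
by move=> t _; exact: FB.
Qed.

Lemma regular_dist_distribution Om f : open Om -> smooth Om f ->
  is_distribution Om (regular_dist Om f).
Proof.
move=> oO sf; split.
  move=> c phi psi tphi tpsi.
  have t1 := test_functionM oO sf tphi; have t2 := test_functionM oO sf tpsi.
  rewrite !(regular_dist_cint oO sf) //; last exact: test_functionD (test_functionZ c tphi) tpsi.
  rewrite -(cintZ c t1) -(cintD (test_functionZ c t1) t2); congr cint; apply/funext => x.
  by rewrite mulrDr mulrCA.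
move=> K cK KO; have [Bf Bf0 hBf] := smooth_bounded_compact sf cK KO.
set mu := fine (lebesgue_nd n (rV_of_tuple @^-1` K)).
have mu0 : 0 <= mu by rewrite fine_ge0.
(* A function has order 0 as a distribution; the 2 covers real and imaginary parts, the 1 ensures
   strict positivity. *)
exists (2 * (Bf * mu) + 1), 0%N; split.
  by rewrite ltr_wpDl // mulr_ge0 // mulr_ge0.
move=> phi sphi sK B hB.
have tphi : test_function Om phi by split=> //; exists K.
have hphi x : normc (phi x) <= B.
  have := hB (fun _ => 0%N) x; rewrite Dmulti_mseq.
  have -> : mdeg (fun _ : 'I_n => 0%N) = 0%N by rewrite /mdeg big1.
  have -> : mseq (fun _ : 'I_n => 0%N) = [::] by apply: size0nil; rewrite size_mseq /mdeg big1.
  by apply.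
have B0 : 0 <= B := le_trans (normc_ge0 _) (hphi 0).
have tp := test_functionM oO sf tphi.
have [cr ci] := test_function_ccont tp.
have bd x : normc (f x * phi x) <= Bf * B.
  rewrite normcM; have [Kx|Kx] := pselect (K x).
    by apply: ler_pM; rewrite ?normc_ge0 ?hphi ?hBf.
  by rewrite (sK x Kx) ComplexField.Normc.normc0 mulr0 mulr_ge0.
rewrite (regular_dist_cint oO sf tphi) cintE.
apply: le_trans (normc_le_ReIm _) _ => /=.
apply: (@le_trans _ _ (Bf * B * mu + Bf * B * mu)).
  apply: lerD; apply: Rintegral_le_support => //.
  - by move=> x Kx; rewrite /re_part sK // mulr0.
  - by move=> x; apply: le_trans (Re_le_normc _) _; exact: bd.
  - by move=> x Kx; rewrite /im_part sK // mulr0.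
  - by move=> x; apply: le_trans (Im_le_normc _) _; exact: bd.
rewrite mulrDl mul1r (_ : _ + _ = 2 * (Bf * mu) * B); last by ring.
by rewrite lerDl.
Qed.

End OperatorAction.

(** * Normally convergent series *)

Section GeometricSums.
Context {R : realType}.
Implicit Types (a b : nat -> R) (C : R).

(** The factor 2^(-k) built into the amplitudes makes every series in play geometric, so a single
    constant encodes both convergence and size. *)
Definition geo C a : Prop := forall k, `|a k| <= C / 2 ^+ k.

Definition rsum a : R := limn (series a).

Lemma half_lt1 : `|2^-1 : R| < 1.
Proof. by rewrite ger0_norm ?invr_ge0 // invf_lt1 // ltr1n. Qed.

Lemma geo_ge0 C a : geo C a -> 0 <= C.
Proof. by move=> /(_ 0%N); rewrite expr0 divr1; exact: le_trans. Qed.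

Lemma geo_ncvg C a : geo C a -> cvgn [normed series a].
Proof.
move=> ga; have C0 := geo_ge0 ga.
apply: (@series_le_cvg _ _ (geometric C 2^-1)).
- by move=> k; exact: normr_ge0.
- by move=> k; rewrite /geometric /= mulr_ge0 // exprn_ge0 // invr_ge0.
- by move=> k; rewrite /geometric /= exprVn; exact: ga.
- by apply: is_cvg_geometric_series; exact: half_lt1.
Qed.

Lemma geo_cvg C a : geo C a -> cvgn (series a).
Proof. by move=> /geo_ncvg /normed_cvg. Qed.

Lemma rsum_le C a : geo C a -> `|rsum a| <= 2 * C.
Proof.
move=> ga; have C0 := geo_ge0 ga.
apply: le_trans (lim_series_norm (geo_ncvg ga)) _.
have cg : cvgn (series (geometric C (2^-1 : R))) by apply: is_cvg_geometric_series; exact: half_lt1.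
apply: le_trans (lim_series_le (geo_ncvg ga) cg _) _.
  by move=> k; rewrite /geometric /= exprVn; exact: ga.
rewrite (cvg_lim _ (cvg_geometric_series half_lt1)) //.
rewrite (_ : 1 - 2^-1 = 2^-1 :> R); last by field.
by rewrite invrK mulrC.
Qed.

Lemma rsumD C C' a b : geo C a -> geo C' b -> rsum (fun k => a k + b k) = rsum a + rsum b.
Proof. by move=> /geo_cvg ca /geo_cvg cb; exact: lim_seriesD. Qed.

Lemma rsumZ C (z : R) a : geo C a -> rsum (fun k => z * a k) = z * rsum a.
Proof. by move=> /geo_cvg ca; exact: lim_seriesZ. Qed.

Lemma geoD C C' a b : geo C a -> geo C' b -> geo (C + C') (fun k => a k + b k).
Proof. by move=> ga gb k; apply: le_trans (ler_normD _ _) _; rewrite mulrDl lerD. Qed.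

Lemma geoZ C (z : R) a : geo C a -> geo (`|z| * C) (fun k => z * a k).
Proof. by move=> ga k; rewrite normrM -mulrA ler_wpM2l. Qed.

Lemma rsum_ge_term C a m : geo C a -> (forall k, 0 <= a k) -> a m <= rsum a.
Proof.
move=> ga a0; have ca := geo_cvg ga.
apply: (@le_trans _ _ (series a m.+1)).
  by rewrite /series /= big_nat_recr //= lerDr sumr_ge0.
by apply: nondecreasing_cvgn_le => // ; apply: nondecreasing_series => k _ _; exact: a0.
Qed.

Definition cgeo C (z : nat -> R[i]) : Prop := forall k, normc (z k) <= C / 2 ^+ k.

Definition zsum (z : nat -> R[i]) : R[i] :=
  rsum (fun k => complex.Re (z k)) +i* rsum (fun k => complex.Im (z k)).

Lemma cgeo_Re C z : cgeo C z -> geo C (fun k => complex.Re (z k)).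
Proof. by move=> gz k; apply: le_trans (Re_le_normc _) _. Qed.

Lemma cgeo_Im C z : cgeo C z -> geo C (fun k => complex.Im (z k)).
Proof. by move=> gz k; apply: le_trans (Im_le_normc _) _. Qed.

Lemma zsum_le C z : cgeo C z -> normc (zsum z) <= 4 * C.
Proof.
move=> gz; apply: le_trans (normc_le_ReIm _) _ => /=.
have := lerD (rsum_le (cgeo_Re gz)) (rsum_le (cgeo_Im gz)).
by rewrite -mulrDl -natrD.
Qed.

Lemma cgeoD C C' z w : cgeo C z -> cgeo C' w -> cgeo (C + C') (fun k => z k + w k).
Proof. by move=> gz gw k; apply: le_trans (normcD _ _) _; rewrite mulrDl lerD. Qed.

Lemma cgeoZ C (p : R[i]) z : cgeo C z -> cgeo (normc p * C) (fun k => p * z k).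
Proof. by move=> gz k; rewrite normcM -mulrA ler_wpM2l // normc_ge0. Qed.

Lemma zsumD C C' z w : cgeo C z -> cgeo C' w -> zsum (fun k => z k + w k) = zsum z + zsum w.
Proof.
move=> gz gw; rewrite /zsum; apply/eqP; rewrite eq_complex /=; apply/andP; split; apply/eqP.
  rewrite -(rsumD (cgeo_Re gz) (cgeo_Re gw)); congr rsum; apply/funext => k.
  by case: (z k) (w k) => ? ? [].
rewrite -(rsumD (cgeo_Im gz) (cgeo_Im gw)); congr rsum; apply/funext => k.
by case: (z k) (w k) => ? ? [].
Qed.

Lemma zsumZ C (p : R[i]) z : cgeo C z -> zsum (fun k => p * z k) = p * zsum z.
Proof.
move=> gz; rewrite /zsum; case: p => p q.
have gr := cgeo_Re gz; have gi := cgeo_Im gz.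
apply/eqP; rewrite eq_complex /=; apply/andP; split; apply/eqP.
  rewrite -mulNr -(rsumZ p gr) -(rsumZ (- q) gi) -(rsumD (geoZ p gr) (geoZ (- q) gi)).
  by congr rsum; apply/funext => k; case: (z k) => ? ? /=; rewrite mulNr.
rewrite -(rsumZ p gi) -(rsumZ q gr) -(rsumD (geoZ p gi) (geoZ q gr)).
by congr rsum; apply/funext => k; case: (z k) => ? ?.
Qed.

Lemma cgeo0 : cgeo 0 (fun _ => 0).
Proof. by move=> k; rewrite ComplexField.Normc.normc0 mul0r. Qed.

Lemma zsum_sum I (r : seq I) (Q : pred I) (C : I -> R) (z : I -> nat -> R[i]) :
  (forall i, Q i -> cgeo (C i) (z i)) ->
  cgeo (\sum_(i <- r | Q i) C i) (fun k => \sum_(i <- r | Q i) z i k) /\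
  zsum (fun k => \sum_(i <- r | Q i) z i k) = \sum_(i <- r | Q i) zsum (z i).
Proof.
move=> gz; elim: r => [|i r [g1 IH]].
  rewrite !big_nil (_ : (fun _ => _) = fun _ => 0); last by apply/funext => k; rewrite big_nil.
  split; first exact: cgeo0.
  by have := zsumZ 0 cgeo0; rewrite !mul0r.
rewrite !big_cons; have [Qi|Qi] := boolP (Q i).
  rewrite (_ : (fun _ => _) = fun k => z i k + \sum_(i <- r | Q i) z i k); last first.
    by apply/funext => k; rewrite big_cons Qi.
  split; first exact: cgeoD (gz i Qi) g1.
  by rewrite (zsumD (gz i Qi) g1) IH.
rewrite (_ : (fun _ => _) = fun k => \sum_(i <- r | Q i) z i k) //.
by apply/funext => k; rewrite big_cons (negbTE Qi).
Qed.

End GeometricSums.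

(** * Taylor and Lipschitz estimates from directional derivatives *)

Section Lipschitz.
Context {R : realType} {n : nat}.
Implicit Types (F : 'rV[R]_n -> R) (x y v : 'rV[R]_n).

Lemma mvt_signed F x v (h : R) :
  (forall t, `|t| <= `|h| -> derivable F (x + t *: v) v) ->
  exists2 t, `|t| <= `|h| & F (x + h *: v) - F x = h * 'D_v F (x + t *: v).
Proof.
move=> dF; have [h0|h0] := leP 0 h.
  have d1 t : 0 <= t <= h -> derivable F (x + t *: v) v.
    by move=> /andP[t0 th]; apply: dF; rewrite !ger0_norm.
  have [t /andP[t0 th] E] := mvt_line h0 d1.
  by exists t => //; rewrite !ger0_norm.
have h0' : 0 <= - h by rewrite oppr_ge0 ltW.
have d1 t : 0 <= t <= - h -> derivable F (x + h *: v + t *: v) v.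
  move=> /andP[t0 th]; rewrite -addrA -scalerDl; apply: dF.
  by rewrite (ltr0_norm h0) ler_norml; apply/andP; split; lra.
have [t /andP[t0 th]] := mvt_line h0' d1.
rewrite -!addrA -!scalerDl subrr scale0r addr0 => E; exists (h + t).
  by rewrite (ltr0_norm h0) ler_norml; apply/andP; split; lra.
by rewrite -[LHS]opprB E mulNr opprK.
Qed.

Lemma taylor2 F x v (b h : R) :
  (forall y, derivable F y v) -> (forall y, derivable ('D_v F) y v) ->
  (forall y, `|'D_v ('D_v F) y| <= b) ->
  `|F (h *: v + x) - F x - h * 'D_v F x| <= b * h ^+ 2.
Proof.
move=> d1 d2 b2; rewrite (addrC (h *: v)).
have [t th ->] := mvt_signed (F := F) (x := x) (h := h) (fun t _ => d1 _).
have [r _] := mvt_signed (F := 'D_v F) (x := x) (h := t) (fun t _ => d2 _).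
rewrite -mulrBr => ->; rewrite !normrM -(real_normK (num_real h)) expr2 mulrA mulrC.
by apply: ler_pM; rewrite ?mulr_ge0 // ler_pM.
Qed.

(** Only partial derivatives are at hand, so the path from [x] to [y] changes one coordinate at a
    time; it stays in the box of radius [rho] around [x]. *)
Lemma coordinate_lipschitz F x y (b rho : R) :
  (forall w : 'rV[R]_n, (forall j, `|w 0 j - x 0 j| <= rho) ->
    forall j, derivable F w (basis_vec j) /\ `|'D_(basis_vec j) F w| <= b) ->
  (forall j, `|y 0 j - x 0 j| <= rho) ->
  `|F y - F x| <= b * \sum_(j < n) `|y 0 j - x 0 j|.
Proof.
move=> dF yx.
(* The m-th corner of the path. *)
pose w (m : nat) : 'rV[R]_n := \row_j (if (j < m)%N then y 0 j else x 0 j).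
have H m : (m <= n)%N -> `|F (w m) - F x| <= b * \sum_(j < n | (j < m)%N) `|y 0 j - x 0 j|.
  elim: m => [|m IH] mn.
    rewrite big_pred0 // mulr0 (_ : w 0%N = x) ?subrr ?normr0 //.
    by apply/rowP => j; rewrite !mxE.
  pose jm := Ordinal mn.
  have wS : w m.+1 = w m + (y 0 jm - x 0 jm) *: basis_vec jm.
    apply/rowP => j; rewrite !mxE eqxx /= ltnS.
    have [->|jjm] := eqVneq j jm; first by rewrite /= leqnn ltnn mulr1 addrC subrK.
    rewrite mulr0 addr0 leq_eqVlt; case: eqP => // jm'; exfalso.
    by move/eqP: jjm; apply; apply: val_inj.
  have wt t j : `|t| <= `|y 0 jm - x 0 jm| -> `|(w m + t *: basis_vec jm) 0 j - x 0 j| <= rho.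
    move=> ht; rewrite !mxE eqxx /=; have [->|jjm] := eqVneq j jm.
      by rewrite /= ltnn mulr1 addrAC subrr add0r; apply: le_trans ht _.
    rewrite mulr0 addr0; case: ifP => // _; rewrite subrr normr0.
    exact: le_trans (yx j).
  have [t ht E] := @mvt_signed F (w m) (basis_vec jm) (y 0 jm - x 0 jm)
     (fun t ht => (dF _ (fun j => wt t j ht) jm).1).
  rewrite (bigD1 jm) //= mulrDr.
  rewrite (_ : F _ - F x = (F (w m.+1) - F (w m)) + (F (w m) - F x)); last by rewrite addrA subrK.
  apply: le_trans (ler_normD _ _) _; apply: lerD.
    rewrite wS E normrM mulrC ler_wpM2r //; exact: (dF _ (fun j => wt t j ht) jm).2.
  apply: le_trans (IH (ltnW mn)) _.
  rewrite le_eqVlt; apply/orP; left; apply/eqP; congr (_ * _); apply: eq_bigl => j.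
  rewrite ltnS (leq_eqVlt j); have [->|jjm] := eqVneq j jm; first by rewrite /= ltnn andbF.
  by rewrite andbT (_ : (nat_of_ord j == m) = false) //; apply/eqP => e; move/eqP: jjm; apply; exact: val_inj.
have wn : w n = y by apply/rowP => j; rewrite !mxE ltn_ord.
have := H n (leqnn n); rewrite wn; congr (_ <= b * _).
by apply: eq_bigl => j; rewrite ltn_ord.
Qed.

End Lipschitz.

(** * Termwise differentiation *)

Section FunctionSeries.
Context {R : realType} {n : nat}.
Implicit Types (f : nat -> 'rV[R]_n -> R[i]) (x y v : 'rV[R]_n) (F : nat -> 'rV[R]_n -> R).

(** Bounds on the second derivatives give each summand a quadratic Taylor error; the errors sum to a
    quadratic error, and [is_derive_quad] applies. *)
Lemma is_derive_rsum F x v (b0 b1 b2 : R) :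
  (forall y, geo b0 (fun k => F k y)) -> (forall y, geo b1 (fun k => 'D_v (F k) y)) ->
  (forall y, geo b2 (fun k => 'D_v ('D_v (F k)) y)) ->
  (forall k y, derivable (F k) y v) -> (forall k y, derivable ('D_v (F k)) y v) ->
  is_derive x v (fun y => rsum (fun k => F k y)) (rsum (fun k => 'D_v (F k) x)).
Proof.
move=> g0 g1 g2 d1 d2.
apply: (@is_derive_quad _ _ _ _ _ _ (2 * b2)).
  by rewrite mulr_ge0 // (geo_ge0 (g2 x)).
move=> h.
pose e k := F k (h *: v + x) - F k x - h * 'D_v (F k) x.
have ge : geo (b2 * h ^+ 2) e.
  move=> k; rewrite mulrAC; apply: taylor2 => // y; exact: g2.
have gN : geo (`|-1| * b0) (fun k => -1 * F k x) by exact: geoZ (g0 x).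
have gh : geo (`|- h| * b1) (fun k => - h * 'D_v (F k) x) by exact: geoZ (g1 x).
rewrite (_ : _ - _ - _ = rsum e); first by rewrite -mulrA; exact: rsum_le.
rewrite (_ : e = fun k => (F k (h *: v + x) + -1 * F k x) + - h * 'D_v (F k) x); last first.
  by apply/funext => k; rewrite /e mulN1r mulNr.
rewrite (rsumD (geoD (g0 (h *: v + x)) gN) gh) (rsumD (g0 (h *: v + x)) gN).
by rewrite (rsumZ _ (g0 x)) (rsumZ _ (g1 x)) mulN1r mulNr.
Qed.

Lemma continuous_rsum F x (b0 b1 : R) :
  (forall y, geo b0 (fun k => F k y)) ->
  (forall k y j, derivable (F k) y (basis_vec j) /\ `|'D_(basis_vec j) (F k) y| <= b1 / 2 ^+ k) ->
  {for x, continuous (fun y => rsum (fun k => F k y))}.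
Proof.
move=> g0 d1.
(* For n = 0 there is a single point; for n > 0 some direction exists, from which [0 <= b1] is read
   off. *)
have [n0|n0] := posnP n.
  subst n; have E : (fun y : 'rV[R]_0 => rsum (fun k => F k y)) = fun _ => rsum (fun k => F k x).
    by apply/funext => y; congr rsum; apply/funext => k; congr (F k _); apply/rowP => -[].
  by rewrite E; exact: cst_continuous.
have b10 : 0 <= b1.
  have := (d1 0%N x (Ordinal n0)).2; rewrite expr0 divr1; exact: le_trans.
have lip y : `|rsum (fun k => F k x) - rsum (fun k => F k y)| <= 2 * (b1 * (n%:R * `|x - y|)).
  have gd : geo (b1 * (n%:R * `|x - y|)) (fun k => F k x + -1 * F k y).
    move=> k; rewrite mulN1r mulrAC.
    apply: le_trans (coordinate_lipschitz (rho := `|x - y|) (b := b1 / 2 ^+ k) _ _) _.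
    - by move=> w _ j; exact: d1.
    - move=> j; rewrite [leRHS]/Num.norm /= mx_normrE; apply/bigmax_geP; right => /=.
      by exists (0, j) => //=; rewrite !mxE.
    rewrite ler_wpM2l ?divr_ge0 ?exprn_ge0 //.
    rewrite -[n in n%:R]card_ord mulr_natl -sumr_const; apply: ler_sum => j _.
    rewrite [leRHS]/Num.norm /= mx_normrE; apply/bigmax_geP; right => /=.
    by exists (0, j) => //=; rewrite !mxE.
  apply: le_trans (rsum_le gd); rewrite le_eqVlt; apply/orP; left; apply/eqP; congr `|_|.
  by rewrite (rsumD (g0 x) (geoZ (-1) (g0 y))) (rsumZ _ (g0 y)) mulN1r.
move=> A /nbhs_ballP[e /= e0 eA].
pose L := 2 * (b1 * n%:R) + 1.
have L0 : 0 < L by rewrite ltr_wpDl // mulr_ge0 // mulr_ge0.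
apply/(nbhs_ballP x); exists (e / L) => /=; first by rewrite divr_gt0.
move=> y; rewrite -ball_normE /= => xy; apply: eA; rewrite -ball_normE /=.
apply: le_lt_trans (lip y) _.
rewrite (_ : 2 * _ = 2 * (b1 * n%:R) * `|x - y|); last by ring.
apply: (@le_lt_trans _ _ (L * `|x - y|)); first by rewrite ler_wpM2r // lerDl.
by rewrite mulrC -ltr_pdivlMr.
Qed.

Definition csum f : 'rV[R]_n -> R[i] := fun x => zsum (fun k => f k x).

Definition normal f : Prop := exists c : nat -> R,
  forall k, smooth setT (f k) /\ bdd setT (fun m => c m / 2 ^+ k) (f k).

Lemma normal_Dj f j : normal f -> normal (fun k => Dj j (f k)).
Proof.
move=> [c hc]; exists (c \o S) => k; have [sf bf] := hc k.
by split; [exact: smooth_Dj|exact: (bdd_Dj j bf)].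
Qed.

Lemma Re_Dj (g : 'rV[R]_n -> R[i]) j x :
  complex.Re (Dj j g x) = 'D_(basis_vec j) (im_part g) x.
Proof. by rewrite DjE. Qed.

Lemma Im_Dj (g : 'rV[R]_n -> R[i]) j x :
  complex.Im (Dj j g x) = - 'D_(basis_vec j) (re_part g) x.
Proof. by rewrite DjE. Qed.

(** Continuity of the sum uses the first derivatives of the summands, differentiation the second
    ones. *)
Lemma normal_calculus f x : normal f ->
  tame (csum f) x /\ forall j, Dj j (csum f) x = csum (fun k => Dj j (f k)) x.
Proof.
move=> nf; have [c hc] := nf.
have cb s y : cgeo (c (size s)) (fun k => dseq s (f k) y).
  by move=> k; have [_ /(_ s y Logic.I)] := hc k.
have tm k s y : tame (dseq s (f k)) y by have [sf _] := hc k; exact: sf.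
pose Fr k := re_part (f k); pose Fi k := im_part (f k).
have br0 y : geo (c 0%N) (fun k => Fr k y) := cgeo_Re (cb [::] y).
have bi0 y : geo (c 0%N) (fun k => Fi k y) := cgeo_Im (cb [::] y).
have bi1 j y : geo (c 1%N) (fun k => 'D_(basis_vec j) (Fi k) y).
  by move=> k; rewrite -Re_Dj; exact: cgeo_Re (cb [:: j] y) k.
have br1 j y : geo (c 1%N) (fun k => 'D_(basis_vec j) (Fr k) y).
  by move=> k; rewrite -normrN -Im_Dj; exact: cgeo_Im (cb [:: j] y) k.
have dr k y j : derivable (Fr k) y (basis_vec j).
  by have [_ _ /(_ j)[h _]] := tm k [::] y; exact: h.
have di k y j : derivable (Fi k) y (basis_vec j).
  by have [_ _ /(_ j)[_ h]] := tm k [::] y; exact: h.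
have EN k j : 'D_(basis_vec j) (Fr k) = - (im_part (Dj j (f k))).
  by rewrite im_part_Dj; apply/funext => y; rewrite -[RHS]/(- - _) opprK.
have EI k j : 'D_(basis_vec j) (Fi k) = re_part (Dj j (f k)) by rewrite re_part_Dj.
have dr2 k y j : derivable ('D_(basis_vec j) (Fr k)) y (basis_vec j).
  by rewrite EN; apply: derivableN; have [_ _ /(_ j)[_ h]] := tm k [:: j] y; exact: h.
have di2 k y j : derivable ('D_(basis_vec j) (Fi k)) y (basis_vec j).
  by rewrite EI; have [_ _ /(_ j)[h _]] := tm k [:: j] y; exact: h.
have br2 j y : geo (c 2%N) (fun k => 'D_(basis_vec j) ('D_(basis_vec j) (Fr k)) y).
  move=> k; have [_ _ /(_ j)[_ d]] := tm k [:: j] y.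
  by rewrite EN (deriveN d) normrN -Re_Dj; exact: cgeo_Re (cb [:: j; j] y) k.
have bi2 j y : geo (c 2%N) (fun k => 'D_(basis_vec j) ('D_(basis_vec j) (Fi k)) y).
  by move=> k; rewrite EI -normrN -Im_Dj; exact: cgeo_Im (cb [:: j; j] y) k.
have Dr j := is_derive_rsum x (br0) (br1 j) (br2 j) (fun k y => dr k y j) (fun k y => dr2 k y j).
have Di j := is_derive_rsum x (bi0) (bi1 j) (bi2 j) (fun k y => di k y j) (fun k y => di2 k y j).
have Er : re_part (csum f) = fun y => rsum (fun k => Fr k y) by [].
have Ei : im_part (csum f) = fun y => rsum (fun k => Fi k y) by [].
split.
  split.
  - rewrite Er; apply: (continuous_rsum br0) => k y j; split; [exact: dr|exact: br1].
  - rewrite Ei; apply: (continuous_rsum bi0) => k y j; split; [exact: di|exact: bi1].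
  - by move=> j; rewrite Er Ei; have [? _] := Dr j; have [? _] := Di j.
move=> j; rewrite DjE Er Ei; have [_ ->] := Dr j; have [_ ->] := Di j.
rewrite /csum /zsum; congr (_ +i* _).
  by congr rsum; apply/funext => k; rewrite Re_Dj.
rewrite -mulN1r -(rsumZ (-1) (br1 j x)); congr rsum; apply/funext => k.
by rewrite Im_Dj mulN1r.
Qed.

Lemma normal_dseq f s : normal f -> normal (fun k => dseq s (f k)).
Proof. by move=> nf; elim: s => [//|j s IH]; exact: normal_Dj. Qed.

Lemma dseq_csum f s : normal f -> dseq s (csum f) = csum (fun k => dseq s (f k)).
Proof.
move=> nf; elim: s => [//|j s IH]; rewrite -[LHS]/(Dj j (dseq s (csum f))) IH.
by apply/funext => x; have [_ ->] := normal_calculus x (normal_dseq s nf).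
Qed.

Lemma smooth_csum f : normal f -> smooth setT (csum f).
Proof.
move=> nf s x _; have T : tame (dseq s (csum f)) x.
  by rewrite (dseq_csum s nf); have [] := normal_calculus x (normal_dseq s nf).
exact: T.
Qed.

End FunctionSeries.

(** * The operator applied to series *)

Section OperatorSeries.
Context {R : realType} {n d : nat}.
Implicit Types (P : diffop R n d) (f : nat -> 'rV[R]_n -> R[i]) (U K : set 'rV[R]_n).

Lemma papp_csum P f : normal f -> papp P (csum f) = csum (fun k => papp P (f k)).
Proof.
move=> nf; have [c hc] := nf; apply/funext => x.
have cb s : cgeo (c (size s)) (fun k => dseq s (f k) x).
  by move=> k; have [_ /(_ s x Logic.I)] := hc k.
rewrite /papp /csum.
have [_ ->] := @zsum_sum R _ (index_enum (mindex n d)) (fun a => mdeg (mi a) <= d)%N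
   (fun a => normc (P a x) * c (size (mseq (mi a)))) (fun a k => P a x * dseq (mseq (mi a)) (f k) x)
   (fun a _ => cgeoZ (P a x) (cb _)).
by apply: eq_bigr => a _; rewrite (dseq_csum _ nf) /csum (zsumZ _ (cb _)).
Qed.

Lemma lconvZ (a b : nat -> R) (z : R) m :
  lconv m a (fun k => b k * z) = lconv m a b * z.
Proof.
elim: m a b => [|m IH] a b /=; first by rewrite mulrA.
by rewrite mulrDl -IH -(IH a (b \o S)).
Qed.

(** The coefficients are controlled only on [U], whereas [normal] speaks of the whole space; the
    common support [K] inside [U] bridges the gap. *)
Lemma normal_papp P f U K (c : mindex n d -> nat -> R) : open U -> closed K -> K `<=` U -> U !=set0 ->
  (forall a : mindex n d, (mdeg (mi a) <= d)%N -> smooth U (P a) /\ bdd U (c a) (P a)) ->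
  (forall k, supported_in K (f k)) -> normal f ->
  normal (fun k => papp P (f k)).
Proof.
move=> oU cK KU [x0 Ux0] hP sK [b hb].
pose c' m := \sum_(a : mindex n d | (mdeg (mi a) <= d)%N) lconv m (c a) (fun i => b (i + size (mseq (mi a)))%N).
have sU k : smooth U (papp P (f k)).
  apply: (smooth_papp oU); first by move=> a ad; have [h _] := hP a ad; exact: h.
  by have [sf _] := hb k; exact: smooth_subset sf.
have bU k : bdd U (fun m => c' m / 2 ^+ k) (papp P (f k)).
  have [sf bf] := hb k.
  have sfU := smooth_subset (@subsetT _ U) sf; have bfU := bdd_subset (@subsetT _ U) bf.
  have sT a : (mdeg (mi a) <= d)%N -> smooth U (fun y => P a y * dseq (mseq (mi a)) (f k) y).
    by move=> ad; have [sP _] := hP a ad; exact: smoothM oU sP (smooth_dseq _ sfU).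
  have bT a : (mdeg (mi a) <= d)%N ->
      bdd U (fun m => lconv m (c a) (fun i => b (i + size (mseq (mi a)))%N / 2 ^+ k))
        (fun y => P a y * dseq (mseq (mi a)) (f k) y).
    move=> ad; have [sP bP] := hP a ad.
    apply: (bddM oU sP (smooth_dseq _ sfU) bP).
    by move=> s x Ux; rewrite -dseq_cat -size_cat; exact: bfU.
  apply: bdd_le (bdd_sum (index_enum _) oU sT bT).
  by move=> m; rewrite /c' mulr_suml; apply: ler_sum => a _; rewrite lconvZ.
exists c' => k; have sk := supported_papp P cK (sK k).
split; first exact: (smooth_extend cK oU KU sk (sU k)).
move=> s x _; have [Kx|Kx] := pselect (K x); first exact: (bU k s x (KU _ Kx)).
rewrite (supported_dseq s cK sk Kx) ComplexField.Normc.normc0.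
(* The point [x0] serves to see that the majorant is nonnegative. *)
exact: le_trans (normc_ge0 _) (bU k s x0 Ux0).
Qed.

Lemma iter_papp_csum P f U K (c : mindex n d -> nat -> R) m : open U -> closed K -> K `<=` U -> U !=set0 ->
  (forall a : mindex n d, (mdeg (mi a) <= d)%N -> smooth U (P a) /\ bdd U (c a) (P a)) ->
  (forall k, supported_in K (f k)) -> normal f ->
  normal (fun k => iter m (papp P) (f k)) /\
  iter m (papp P) (csum f) = csum (fun k => iter m (papp P) (f k)).
Proof.
move=> oU cK KU U0 hP sK nf; elim: m => [//|m [IH1 IH2]].
have sm k : supported_in K (iter m (papp P) (f k)) by exact: supported_iter_papp.
split; first exact: (normal_papp oU cK KU U0 hP sm IH1).
by rewrite iterS IH2 papp_csum.
Qed.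

End OperatorSeries.

(** * Conjugation by a plane wave *)

Section Conjugation.
Context {R : realType} {n d : nat}.
Variables (U : set 'rV[R]_n) (lam : R) (xi y : 'rV[R]_n).
Hypothesis oU : open U.
Implicit Types (v : 'rV[R]_n -> R[i]) (s : seq 'I_n) (P : diffop R n d).
Local Notation e := (wave lam xi y).

(* e^-1 D_j e and e^-1 P e, e being the plane wave. *)
Definition conjD (j : 'I_n) v : 'rV[R]_n -> R[i] := fun x => Dj j v x + (lam * xi 0 j)%:C * v x.

Definition lseq s v := foldr conjD v s.

Definition plam P v : 'rV[R]_n -> R[i] := fun x =>
  \sum_(a : mindex n d | (mdeg (mi a) <= d)%N) P a x * lseq (mseq (mi a)) v x.

Lemma smooth_Lj j v : smooth U v -> smooth U (conjD j v).
Proof.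
by move=> sv; exact: (smoothD oU (smooth_Dj j sv) (smoothM oU (smooth_cst _ oU) sv)).
Qed.

Lemma smooth_lseq s v : smooth U v -> smooth U (lseq s v).
Proof. by move=> sv; elim: s => [//|j s IH]; exact: smooth_Lj. Qed.

Lemma dseq_waveM s v x : smooth U v -> U x ->
  dseq s (fun z => e z * v z) x = e x * lseq s v x.
Proof.
move=> sv; elim: s x => [//|j s IH] x Ux.
rewrite -[LHS]/(dseq [:: j] (dseq s (fun z => e z * v z)) x).
rewrite (@dseq_eq _ _ U _ (fun z => e z * lseq s v z) [:: j] x oU IH Ux) /=.
rewrite (DjM _ (tame_wave lam xi y x) (smooth_tame (smooth_lseq s sv) Ux)) Dj_wave.
by rewrite /conjD mulrDr addrC -!mulrA; congr (_ + _); rewrite mulrCA.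
Qed.

Lemma smooth_plam P v : smooth_coefs U P -> smooth U v -> smooth U (plam P v).
Proof.
move=> sP sv; apply: (smooth_sum _ oU) => a ad.
exact: smoothM oU (sP a ad) (smooth_lseq _ sv).
Qed.

Lemma papp_waveM P v x : smooth U v -> U x ->
  papp P (fun z => e z * v z) x = e x * plam P v x.
Proof.
move=> sv Ux; rewrite /papp /plam big_distrr; apply: eq_bigr => a _ /=.
by rewrite (dseq_waveM _ sv Ux) mulrCA.
Qed.

Lemma papp_eq P f g x : (forall z, U z -> f z = g z) -> U x -> papp P f x = papp P g x.
Proof. by move=> fg Ux; apply: eq_bigr => a _; rewrite (dseq_eq _ oU fg Ux). Qed.

Lemma iter_papp_waveM P v m x : smooth_coefs U P -> smooth U v -> U x ->
  iter m (papp P) (fun z => e z * v z) x = e x * iter m (plam P) v x.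
Proof.
move=> sP sv; elim: m x => [//|m IH] x Ux; rewrite !iterS.
rewrite (papp_eq P IH Ux) (papp_waveM P _ Ux) //.
by elim: m {IH} => [//|m IH]; exact: smooth_plam.
Qed.

End Conjugation.

(** * One application of the conjugated operator *)

Section ConjugatedBounds.
Context {R : realType} {n d : nat}.
Variables (U : set 'rV[R]_n) (kap : R) (xi : 'rV[R]_n).
Hypothesis oU : open U.
Hypothesis kap1 : 1 <= kap.
Implicit Types (v : 'rV[R]_n -> R[i]) (s : seq 'I_n) (P : diffop R n d) (c T : nat -> R).
Local Notation lam := (kap ^+ 2).
Local Notation Lj := (conjD lam xi).
Local Notation lseq := (lseq lam xi).
Local Notation plam := (plam lam xi).

Definition mono c := forall i j : nat, (i <= j)%N -> c i <= c j.

(** Size [A], rate [Y] and weight [c] are kept apart because the iteration changes each in its own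
    way: the size is multiplied, the rate grows additively, the weight is shifted. *)
Definition bnd (A Y : R) c v := smooth U v /\ bdd U (fun k => A * Y ^+ k * c k) v.

Let kap0 : 0 < kap. Proof. exact: lt_le_trans kap1. Qed.
Let kapl : kap <= lam. Proof. by rewrite expr2 ler_peMl // ltW. Qed.
Let lam0 : 0 < lam. Proof. by rewrite exprn_gt0. Qed.

Lemma bnd_le A A' Y c c' v : 0 <= Y -> (forall k, A * c k <= A' * c' k) ->
  bnd A Y c v -> bnd A' Y c' v.
Proof.
move=> Y0 h [sv bv]; split=> //; apply: bdd_le bv => k.
by rewrite mulrAC [leRHS]mulrAC ler_wpM2r // exprn_ge0.
Qed.

Lemma bndD A B Y c v w : bnd A Y c v -> bnd B Y c w -> bnd (A + B) Y c (fun x => v x + w x).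
Proof.
move=> [sv bv] [sw bw]; split; first exact: smoothD.
by apply: bdd_le (bddD oU sv sw bv bw) => k; rewrite !mulrDl.
Qed.

Lemma bndZ A Y c v (z : R[i]) : bnd A Y c v -> bnd (normc z * A) Y c (fun x => z * v x).
Proof.
move=> [sv bv]; split; first exact: (smoothM oU (smooth_cst z oU) sv).
by apply: bdd_le (bddZ z oU sv bv) => k; rewrite !mulrA.
Qed.

Lemma bnd_Dj A Y c v j : bnd A Y c v -> bnd (A * Y) Y (c \o S) (Dj j v).
Proof.
move=> [sv bv]; split; first exact: smooth_Dj.
by apply: bdd_le (bdd_Dj j bv) => k /=; rewrite exprS !mulrA.
Qed.

(** The weight of the first factor disappears into [c]; only the rates add up. *)
Lemma bndM C A Z Y T c v w : 0 <= C -> 0 <= A -> 0 <= Z -> 0 <= Y ->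
  (forall i j, T i * c j <= c (i + j)%N) ->
  bnd C Z T v -> bnd A Y c w -> bnd (C * A) (Z + Y) c (fun x => v x * w x).
Proof.
move=> C0 A0 Z0 Y0 Tc [sv bv] [sw bw]; split; first exact: smoothM.
apply: bdd_le (bddM oU sv sw bv bw) => k; apply: lconv_le => i j.
rewrite [leLHS](_ : _ = C * A * Z ^+ i * Y ^+ j * (T i * c j)); last by ring.
by rewrite ler_wpM2l // !mulr_ge0 // exprn_ge0.
Qed.

Lemma bnd_sum I (r : seq I) (Q : pred I) (F : I -> 'rV[R]_n -> R[i]) (A : R) Y c :
  0 <= A -> 0 <= Y -> (forall k, 0 <= c k) ->
  (forall i, Q i -> bnd A Y c (F i)) ->
  bnd (A *+ size r) Y c (fun x => \sum_(i <- r | Q i) F i x).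
Proof.
move=> A0 Y0 c0 hF; split; first by apply: (smooth_sum _ oU) => i Qi; have [] := hF i Qi.
have h := bdd_sum r oU (fun i Qi => (hF i Qi).1) (fun i Qi => (hF i Qi).2).
apply: bdd_le h => k; rewrite !mulrnAl.
have X0 : 0 <= A * Y ^+ k * c k by rewrite !mulr_ge0 // exprn_ge0.
elim: r => [|i r IH]; first by rewrite big_nil.
by rewrite big_cons mulrS; case: ifP => _; [rewrite lerD2l|rewrite (le_trans IH) // lerDr].
Qed.

Variable H : R.
Hypothesis H1 : 1 <= H.
Hypothesis Hxi : forall j, `|xi 0 j| <= H.
Let H0 : 0 < H. Proof. exact: lt_le_trans H1. Qed.
Let Y0 : 0 <= kap * H. Proof. by rewrite mulr_ge0 // ltW. Qed.
Let LH0 : 0 < lam * H. Proof. exact: mulr_gt0. Qed.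

(** The derivative costs kap H and the multiplication lam H; as kap <= lam, both are counted as lam
    H. *)
Lemma bnd_Lj A c v j : 0 <= A -> (forall k, 0 <= c k) -> mono c ->
  bnd A (kap * H) c v -> bnd (A * (2 * lam * H)) (kap * H) (c \o S) (Lj j v).
Proof.
move=> A0 c0 mc bv.
have h1 : bnd (A * (lam * H)) (kap * H) (c \o S) (Dj j v).
  apply: bnd_le (bnd_Dj j bv) => // k /=; rewrite ler_wpM2r //= ler_wpM2l // ler_wpM2r // ltW //.
have h2 : bnd (A * (lam * H)) (kap * H) (c \o S) (fun x => (lam * xi 0 j)%:C * v x).
  apply: bnd_le (bndZ (lam * xi 0 j)%:C bv) => // k.
  rewrite normc_real normrM (ger0_norm (ltW lam0)) (mulrC _ A).
  apply: ler_pM; [by rewrite !mulr_ge0 // ltW|exact: c0| |by apply: mc].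
  by rewrite ler_wpM2l // ler_pM2l.
apply: bnd_le (bndD h1 h2) => // k.
by rewrite (_ : A * (lam * H) + _ = A * (2 * lam * H)) //; ring.
Qed.

Lemma bnd_lseq A c v s : 0 <= A -> (forall k, 0 <= c k) -> mono c ->
  bnd A (kap * H) c v ->
  bnd (A * (2 * lam * H) ^+ size s) (kap * H) (fun k => c (k + size s)%N) (lseq s v).
Proof.
move=> A0 c0 mc bv; elim: s => [|j s IH].
  by apply: bnd_le bv => // k; rewrite /= expr0 mulr1 addn0.
have A0' : 0 <= A * (2 * lam * H) ^+ size s.
  by rewrite mulr_ge0 // exprn_ge0 // -mulrA mulr_ge0 // ltW.
have mc' : mono (fun k => c (k + size s)%N) by move=> a b ab; apply: mc; rewrite leq_add2r.
apply: bnd_le (bnd_Lj j A0' (fun k => c0 _) mc' IH) => // k.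
by rewrite /= (exprSr (2 * lam * H)) addSnnS !mulrA.
Qed.

Lemma prod_mseq (a : 'I_n -> nat) (F : 'I_n -> R[i]) :
  \prod_(j <- mseq a) F j = \prod_(j < n) F j ^+ a j.
Proof.
rewrite /mseq -[RHS]big_enum /=; elim: (enum 'I_n) => [|j r IH]; first by rewrite !big_nil.
rewrite /= big_cat big_cons IH; congr (_ * _).
by elim: (a j) => [|m IHm]; rewrite /= ?big_nil // big_cons IHm exprS.
Qed.

Definition prodxi s : R[i] := \prod_(j <- s) (lam * xi 0 j)%:C.

Lemma normc_prodxi s : normc (prodxi s) <= (lam * H) ^+ size s.
Proof.
rewrite /prodxi; elim: s => [|j s IH]; first by rewrite big_nil ComplexField.Normc.normc1.
rewrite big_cons normcM -[size (j :: s)]/(size s).+1 (exprS (lam * H)); apply: ler_pM; rewrite ?normc_ge0 //.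
by rewrite normc_real normrM (ger0_norm (ltW lam0)) ler_pM2l.
Qed.

(** Apart from the leading product, each term of the conjugated word contains a genuine derivative
    of [v], which costs kap H = lam H / kap and so gains 1/kap. Prepending [j] applies [conjD] to
    the old remainder and adds the single new term [prodxi s * Dj j v]. *)
Lemma bnd_remainder A c v s : 0 <= A -> (forall k, 0 <= c k) -> mono c ->
  bnd A (kap * H) c v ->
  bnd ((A * (2 * lam * H) ^+ size s / kap) *+ size s) (kap * H) (fun k => c (k + size s)%N)
    (fun x => lseq s v x - prodxi s * v x).
Proof.
move=> A0 c0 mc bv; have [sv _] := bv.
have L0 : 0 <= 2 * lam * H by rewrite -mulrA mulr_ge0 // ltW.
elim: s => [|j s IH].
  split.
    apply: (smooth_eq oU (f := fun _ => 0)); last exact: smooth_cst.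
    by move=> x _; rewrite /prodxi big_nil mul1r subrr.
  move=> s x Ux; rewrite (dseq_eq (g := fun _ => 0) s oU _ Ux).
    rewrite dseq_cst (_ : (if s is [::] then 0 else 0) = 0); last by case: s.
    by rewrite ComplexField.Normc.normc0 mulr0n !mul0r.
  by move=> z _; rewrite /prodxi big_nil mul1r subrr.
set A' := A * (2 * lam * H) ^+ size s / kap.
have A'0 : 0 <= A' by rewrite divr_ge0 ?mulr_ge0 ?exprn_ge0 // ltW.
have h1 : bnd (A' * (2 * lam * H) *+ size s) (kap * H) (fun k => c (k + (size s).+1)%N)
    (Lj j (fun x => lseq s v x - prodxi s * v x)).
  have mc' : mono (fun k => c (k + size s)%N) by move=> a b ab; apply: mc; rewrite leq_add2r.
  apply: bnd_le (bnd_Lj j (mulrn_wge0 (size s) A'0) (fun k => c0 _) mc' IH) => // k /=.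
  by rewrite !mulrnAl addSnnS.
have h2 := bndZ (prodxi s) (bnd_Dj j bv).
have h3 : bnd (A' * (2 * lam * H)) (kap * H) (fun k => c (k + (size s).+1)%N) (fun x => prodxi s * Dj j v x).
  apply: bnd_le h2 => // k /=.
  apply: ler_pM; [|exact: c0| |by apply: mc; rewrite addnS ltnS leq_addr].
    by rewrite mulr_ge0 ?normc_ge0 // mulr_ge0.
  rewrite /A' [leRHS](_ : _ = (2 * lam * H) ^+ size s * (A * ((2 * lam * H) / kap))); last by ring.
  apply: ler_pM; [exact: normc_ge0|by rewrite mulr_ge0| |].
    apply: le_trans (normc_prodxi s) _; apply: lerXn2r; rewrite ?nnegrE ?(ltW LH0) //.
    by rewrite -mulrA ler_peMl ?(ltW LH0) // ler1n.
  rewrite ler_wpM2l // ler_pdivlMr // (_ : kap * H * kap = lam * H); last by ring.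
  by rewrite -mulrA ler_peMl ?(ltW LH0) // ler1n.
have [sh bh] := bndD h1 h3.
have E z : U z -> Lj j (fun x => lseq s v x - prodxi s * v x) z + prodxi s * Dj j v z =
    lseq (j :: s) v z - prodxi (j :: s) * v z.
  move=> Uz; have sl := smooth_lseq lam xi oU s sv.
  have sm := smoothM oU (smooth_cst (- prodxi s) oU) sv.
  have Ef : (fun x => lseq s v x - prodxi s * v x) = (fun x => lseq s v x + - prodxi s * v x).
    by apply/funext => x; rewrite mulNr.
  rewrite Ef /conjD.
  rewrite (DjD _ (smooth_tame sl Uz) (smooth_tame sm Uz)).
  rewrite (DjM _ (tame_cst _ _) (smooth_tame sv Uz)) Dj_cst mul0r add0r.
  rewrite /prodxi big_cons -/(prodxi s) -[lseq (j :: s) v z]/(Dj j (lseq s v) z + (lam * xi 0 j)%:C * lseq s v z).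
  by ring.
have sz : size (j :: s) = (size s).+1 by [].
have En : A * (2 * lam * H) ^+ size (j :: s) / kap *+ size (j :: s) =
   A' * (2 * lam * H) *+ size s + A' * (2 * lam * H).
  by rewrite sz mulrSr /A' (exprSr (2 * lam * H)); congr (_ *+ _ + _); ring.
rewrite En; split; first exact: smooth_eq E sh.
exact: bdd_eq E bh.
Qed.

Variables (C h : R) (T : nat -> R).
Hypothesis C0 : 0 <= C.
Hypothesis h0 : 0 <= h.

(* One step of the iteration: the principal symbol is of size 1/kap on U, so
   the conjugated operator gains a factor 1/kap over the trivial lam^d. *)
Lemma bnd_plam P A c v : 0 <= A -> (forall k, 0 <= c k) -> mono c ->
  (forall i j, T i * c j <= c (i + j)%N) ->
  (forall a : mindex n d, (mdeg (mi a) <= d)%N -> bnd C (kap * h) T (P a)) ->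
  bnd (C / kap) (kap * h) T (fun x => principal_symbol P x xi) ->
  bnd A (kap * H) c v ->
  bnd (A * (C * (1 + d.+1%:R *+ size (index_enum (mindex n d)))) * (2 * lam * H) ^+ d / kap)
    (kap * (h + H)) (fun k => c (k + d)%N) (plam P v).
Proof.
move=> A0 c0 mc Tc bP bq bv.
have L0 : 0 <= 2 * lam * H by rewrite -mulrA mulr_ge0 // ltW.
have H2 : 1 <= 2 * H by have := H1; lra.
have kL : kap <= 2 * lam * H.
  by apply: le_trans kapl _; rewrite mulrAC ler_peMl ?(ltW lam0).
have L1 : 1 <= 2 * lam * H := le_trans kap1 kL.
have hk0 : 0 <= kap * h by rewrite mulr_ge0 // ltW.
have YE : kap * (h + H) = kap * h + kap * H by rewrite mulrDr.
have Y'0 : 0 <= kap * (h + H) by rewrite YE addr_ge0.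
pose cd k := c (k + d)%N.
have cd0 k : 0 <= cd k := c0 _.
have Tm m i j : T i * c (j + m)%N <= c (i + j + m)%N by rewrite -addnA.
pose D := A * C * (2 * lam * H) ^+ d / kap.
have D0 : 0 <= D by rewrite divr_ge0 ?mulr_ge0 ?exprn_ge0 // ltW.
(* The leading product is removed only in top order, where these products add up to the principal
   symbol. *)
pose rem (a : mindex n d) x := lseq (mseq (mi a)) v x - (if mdeg (mi a) == d then prodxi (mseq (mi a)) * v x else 0).
have brem (a : mindex n d) : (mdeg (mi a) <= d)%N ->
   bnd (D * d.+1%:R) (kap * (h + H)) cd (fun x => P a x * rem a x).
  move=> ad; rewrite YE.
  have brem0 : bnd (A * (2 * lam * H) ^+ d / kap * d.+1%:R) (kap * H) cd (rem a).
    rewrite /rem; case: eqP => [ea|/eqP ea].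
      have := bnd_remainder (mseq (mi a)) A0 c0 mc bv; rewrite size_mseq ea.
      apply: bnd_le => // k; rewrite ler_wpM2r // -mulr_natr ler_wpM2l ?ler_nat //.
      by rewrite divr_ge0 ?mulr_ge0 ?exprn_ge0 // ltW.
    have {ea}ad' : (mdeg (mi a) < d)%N by rewrite ltn_neqAle ea.
    have [sl bl] := bnd_lseq (mseq (mi a)) A0 c0 mc bv; rewrite size_mseq in bl.
    have bl' : bnd (A * (2 * lam * H) ^+ mdeg (mi a)) (kap * H) (fun k => c (k + mdeg (mi a))%N)
       (fun x => lseq (mseq (mi a)) v x - 0).
      split; [apply: smooth_eq sl => // z _|apply: bdd_eq bl => // z _]; by rewrite subr0.
    apply: bnd_le bl' => // k.
    apply: ler_pM; [by rewrite mulr_ge0 // exprn_ge0|exact: c0| |by apply: mc; rewrite leq_add2l].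
    (* Below top order one power of [2 * lam * H] is to spare, and it is at least [kap]. *)
    move: L0 kL L1; move: (2 * lam * H) => L L0 kL L1.
    have Ld : 0 <= L ^+ d / kap by rewrite divr_ge0 ?exprn_ge0 // ltW.
    rewrite -(mulrA A) -(mulrA A) ler_wpM2l //.
    apply: (@le_trans _ _ (L ^+ d / kap)); last by rewrite ler_peMr // ler1n.
    rewrite ler_pdivlMr //; apply: (@le_trans _ _ (L ^+ (mdeg (mi a)).+1)).
      by rewrite exprSr ler_wpM2l ?exprn_ge0.
    by rewrite ler_weXn2l.
  have := bndM C0 _ hk0 Y0 (Tm d) (bP a ad) brem0.
  rewrite (_ : C * _ = D * d.+1%:R); last by rewrite /D; ring.
  by apply; rewrite mulr_ge0 // divr_ge0 ?mulr_ge0 ?exprn_ge0 // ltW.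
have bsum := bnd_sum (index_enum (mindex n d)) (mulr_ge0 D0 (ler0n _ _)) Y'0 cd0 brem.
(* Here the factor 1/kap comes from the smallness of the symbol. *)
have bmain : bnd D (kap * (h + H)) cd (fun x => lam%:C ^+ d * (principal_symbol P x xi * v x)).
  rewrite YE.
  have bqv := bndM (divr_ge0 C0 (ltW kap0)) A0 hk0 Y0 Tc bq bv.
  apply: bnd_le (bndZ (lam%:C ^+ d) bqv) => // [|k]; first by rewrite addr_ge0.
  apply: ler_pM; [|exact: c0| |by apply: mc; rewrite leq_addr].
    by rewrite mulr_ge0 ?normc_ge0 // mulr_ge0 // divr_ge0 // ltW.
  rewrite normcX normc_real (ger0_norm (ltW lam0)) /D.
  rewrite [leLHS](_ : _ = (A * C / kap) * lam ^+ d); last by ring.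
  rewrite [leRHS](_ : _ = (A * C / kap) * (2 * lam * H) ^+ d); last by ring.
  rewrite ler_wpM2l ?divr_ge0 ?mulr_ge0 ?(ltW kap0) //; apply: lerXn2r; rewrite ?nnegrE ?(ltW lam0) //.
  by rewrite mulrAC ler_peMl ?(ltW lam0).
have [sh bh] := bndD bmain bsum.
have E z : U z -> lam%:C ^+ d * (principal_symbol P z xi * v z) +
    \sum_(a : mindex n d | (mdeg (mi a) <= d)%N) P a z * rem a z = plam P v z.
  move=> Uz; rewrite /principal_symbol mulr_suml mulr_sumr.
  rewrite [X in _ + X = _](bigID (fun a : mindex n d => mdeg (mi a) == d)) /= [RHS](bigID (fun a : mindex n d => mdeg (mi a) == d)) /= addrA.
  have cond (a : mindex n d) : (mdeg (mi a) <= d)%N && (mdeg (mi a) == d) = (mdeg (mi a) == d).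
    by case: eqP => [->|]; rewrite ?leqnn ?andbF.
  congr (_ + _); last first.
    by apply: eq_bigr => a /andP[_ /negbTE ea]; rewrite /rem ea subr0.
  rewrite [X in _ + X = _](eq_bigl _ _ cond) [RHS](eq_bigl _ _ cond) -big_split /=.
  apply: eq_bigr => a /eqP ea; rewrite /rem ea eqxx mulrBr.
  rewrite (_ : prodxi (mseq (mi a)) = lam%:C ^+ d * \prod_(j < n) (xi 0 j)%:C ^+ a j); first by ring.
  have -> : lam%:C ^+ d = \prod_(j < n) lam%:C ^+ mi a j.
    by rewrite prodrXr -[RHS]/(lam%:C ^+ mdeg (mi a)) ea.
  rewrite /prodxi prod_mseq -big_split /=.
  by apply: eq_bigr => j _; rewrite rmorphM exprMn.
split; first exact: smooth_eq E sh.
apply: bdd_eq E _ => //; apply: bdd_le bh => k.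
rewrite (_ : D + _ = A * (C * (1 + d.+1%:R *+ size (index_enum (mindex n d)))) * (2 * lam * H) ^+ d / kap) //.
rewrite -mulrnAr /D; move: (d.+1%:R *+ _) ((2 * lam * H) ^+ d) => p q; ring.
Qed.

End ConjugatedBounds.

(** * Iterating the conjugated operator *)

Section IteratedBounds.
Context {R : realType} {n d : nat}.
Variables (U : set 'rV[R]_n) (kap : R) (xi : 'rV[R]_n) (H C h : R) (T W : nat -> R).
Variable P : diffop R n d.
Hypotheses (oU : open U) (kap1 : 1 <= kap) (H1 : 1 <= H) (Hxi : forall j, `|xi 0 j| <= H).
Hypotheses (C0 : 0 <= C) (h0 : 0 <= h).
Hypotheses (W0 : forall k, 0 <= W k) (mW : mono W) (TW : forall i j, T i * W j <= W (i + j)%N).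
Hypothesis bP : forall a : mindex n d, (mdeg (mi a) <= d)%N -> bnd U C (kap * h) T (P a).
Hypothesis bq : bnd U (C / kap) (kap * h) T (fun x => principal_symbol P x xi).

(** The part of the one-step constant that stays fixed; the factor H^d is left out because H grows
    from step to step. *)
Definition step_const : R := C * (1 + d.+1%:R *+ size (index_enum (mindex n d))) * 2 ^+ d.

(** Each step raises the rate from kap H to kap (H + h), so step m is the one-step estimate with H +
    m h in place of H. *)
Lemma bnd_iter_plam A v m : 0 <= A -> bnd U A (kap * H) W v ->
  bnd U (A * step_const ^+ m * (H + m%:R * h) ^+ (d * m) * (kap ^+ 2 ^+ d / kap) ^+ m)
    (kap * (H + m%:R * h)) (fun k => W (k + d * m)%N) (iter m (plam (kap ^+ 2) xi P) v).
Proof.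
move=> A0 bv; have kap0 : 0 < kap by exact: lt_le_trans kap1.
have S0 : 0 <= step_const.
  by rewrite /step_const !mulr_ge0 ?exprn_ge0 // addr_ge0 // mulrn_wge0.
have Hm m' : H <= H + m'%:R * h by rewrite lerDl mulr_ge0.
have Hm0 m' : 0 <= H + m'%:R * h by apply: le_trans (Hm m'); apply: le_trans H1.
have q0 : 0 <= kap ^+ 2 ^+ d / kap by rewrite divr_ge0 ?exprn_ge0 // ltW.
elim: m => [|m IH].
  have -> : (fun k => W (k + d * 0)%N) = W by apply/funext => k; rewrite muln0 addn0.
  by rewrite mulr0n mul0r addr0 muln0 !expr0 !mulr1.
set A' := A * _ * _ * _ in IH.
have A'0 : 0 <= A' by rewrite /A' !mulr_ge0 ?exprn_ge0.
have mW' : mono (fun k => W (k + d * m)%N) by move=> i j ij; apply: mW; rewrite leq_add2r.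
have TW' i j : T i * W (j + d * m)%N <= W (i + j + d * m)%N by rewrite -addnA.
have Hxi' j : `|xi 0 j| <= H + m%:R * h := le_trans (Hxi j) (Hm m).
have := bnd_plam oU kap1 (le_trans H1 (Hm m)) Hxi' C0 h0 A'0 (fun k => W0 _) mW' TW' bP bq IH.
have -> : kap * (h + (H + m%:R * h)) = kap * (H + m.+1%:R * h).
  by rewrite -natr1; ring.
rewrite iterS; apply: bnd_le => [|k]; first by rewrite mulr_ge0 // ltW.
have -> : (k + d + d * m = k + d * m.+1)%N by rewrite mulnS addnA.
rewrite ler_wpM2r //.
have hH : (H + m%:R * h) ^+ (d * m.+1) <= (H + m.+1%:R * h) ^+ (d * m.+1).
  by apply: lerXn2r; rewrite ?nnegrE // lerD2l ler_wpM2r // ler_nat.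
apply: (@le_trans _ _ (A * step_const ^+ m.+1 * (H + m%:R * h) ^+ (d * m.+1) * (kap ^+ 2 ^+ d / kap) ^+ m.+1)).
  rewrite /A' le_eqVlt; apply/orP; left; apply/eqP.
  have e1 : (2 * kap ^+ 2 * (H + m%:R * h)) ^+ d = 2 ^+ d * kap ^+ 2 ^+ d * (H + m%:R * h) ^+ d.
    by rewrite exprMn exprMn.
  have e2 : step_const ^+ m.+1 = C * (1 + d.+1%:R *+ size (index_enum (mindex n d))) * 2 ^+ d * step_const ^+ m.
    by rewrite exprS.
  have e3 : (kap ^+ 2 ^+ d / kap) ^+ m.+1 = (kap ^+ 2 ^+ d / kap) * (kap ^+ 2 ^+ d / kap) ^+ m.
    by rewrite exprS.
  rewrite e1 e2 e3 mulnS exprD.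
  move: (step_const ^+ m) ((H + m%:R * h) ^+ d) ((H + m%:R * h) ^+ (d * m)) ((kap ^+ 2 ^+ d / kap) ^+ m).
  move: (kap ^+ 2 ^+ d) (2 ^+ d) (d.+1%:R *+ _) (kap^-1) => a1 a2 a3 a4 a5 a6 a7 a8.
  by ring.
rewrite ler_wpM2r ?exprn_ge0 // ler_wpM2l // mulr_ge0 // exprn_ge0 //.
Qed.

End IteratedBounds.

(** * The optimal function *)

Section Boxes.
Context {R : realType} {n : nat}.
Implicit Types (x y : 'rV[R]_n) (r : R).

Definition obox y r : set 'rV[R]_n := [set x | forall j, `|x 0 j - y 0 j| < r].
Definition cbox y r : set 'rV[R]_n := [set x | forall j, `|x 0 j - y 0 j| <= r].

Lemma open_obox y r : 0 < r -> open (obox y r).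
Proof.
move=> r0; rewrite (_ : obox y r = ball y r); first exact: ball_open.
apply/seteqP; split=> x /=.
  by move=> h; split=> // i j; rewrite (ord1 i) -ball_normE /= distrC.
by move=> [_ h] j; have := h 0 j; rewrite -ball_normE /= distrC.
Qed.

Lemma closed_cbox y r : closed (cbox y r).
Proof.
rewrite (_ : cbox y r = \bigcap_(j in [set: 'I_n]) ((fun x : 'rV[R]_n => `|x 0 j - y 0 j|) @^-1` [set z | z <= r])).
  apply: closed_bigI => j _; apply: closed_comp; last exact: closed_le.
  move=> x _; have c : (fun z : 'rV[R]_n => z 0 j - y 0 j) z @[z --> x] --> x 0 j - y 0 j.
    apply: (@continuousB _ _ _ (fun z : 'rV[R]_n => z 0 j) (fun _ => y 0 j)).
      exact: (@coord_continuous R 1 n 0 j).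
    exact: cst_continuous.
  exact: (cvg_norm c).
by apply/seteqP; split=> x /= h; [move=> j _; exact: h|move=> j; exact: (h j)].
Qed.

Lemma compact_cbox y r : compact (cbox y r).
Proof.
apply: (subclosed_compact (closed_cbox (y := y) (r := r)) (compact_cube (n := n) (r := r + `|y|))).
move=> x h j; rewrite -(subrK (y 0 j) (x 0 j)); apply: le_trans (ler_normD _ _) _.
apply: lerD; first exact: h.
rewrite [leRHS]/Num.norm /= mx_normrE; apply/bigmax_geP; right => /=.
by exists (0, j).
Qed.

Lemma cbox_sub_obox y r r' : r < r' -> cbox y r `<=` obox y r'.
Proof. by move=> rr x h j; exact: le_lt_trans (h j) rr. Qed.

Lemma obox_sub y r r' : r <= r' -> obox y r `<=` obox y r'.
Proof. by move=> rr x h j; exact: lt_le_trans (h j) rr. Qed.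

Lemma cbox_sub y r r' : r <= r' -> cbox y r `<=` cbox y r'.
Proof. by move=> rr x h j; exact: le_trans (h j) rr. Qed.

Lemma obox_sub_cbox y r : obox y r `<=` cbox y r.
Proof. by move=> x h j; exact: ltW. Qed.

Lemma obox_center y r : 0 < r -> obox y r y.
Proof. by move=> r0 j; rewrite subrr normr0. Qed.

Lemma open_cbox (Om : set 'rV[R]_n) y : open Om -> Om y -> exists2 r, 0 < r & cbox y r `<=` Om.
Proof.
move=> oO Oy; have /nbhs_ballP[e /= e0 eO] : nbhs y Om by exact: open_nbhs_nbhs.
exists (e / 2); first by rewrite divr_gt0.
move=> x h; apply: eO; split=> // i j; rewrite (ord1 i) -ball_normE /= distrC.
apply: le_lt_trans (h j) _; by rewrite ltr_pdivrMr // ltr_pMr // ltr1n.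
Qed.

End Boxes.

(** * Coefficients and principal symbol near a point *)

Section CoefficientBounds.
Context {R : realType} {n d : nat}.
Implicit Types (P : diffop R n d) (Om U : set 'rV[R]_n) (T : nat -> R).

Lemma coefs_bdd Om T P y r : open Om -> 0 < r -> cbox y r `<=` Om -> coefs_in Om T P ->
  weight_sequence T ->
  exists C h : R, [/\ 0 < C, 0 < h &
    forall a : mindex n d, (mdeg (mi a) <= d)%N -> bnd (obox y r) C h T (P a)].
Proof.
move=> oO r0 rO cP hT.
have ex (a : mindex n d) : exists p : R * R, [/\ 0 < p.1, 0 < p.2 &
    (mdeg (mi a) <= d)%N -> bnd (obox y r) p.1 p.2 T (P a)].
  have [ad|ad] := boolP (mdeg (mi a) <= d)%N; last by exists (1, 1).
  have [sP /(_ _ (@compact_cbox _ _ y r) rO)[C [h [C0 h0 hP]]]] := cP a ad.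
  exists (C, h); split=> // _; split.
    by apply: smooth_subset sP => x /obox_sub_cbox /rO.
  move=> s x Ux; have Ox : Om x by apply: rO; exact: obox_sub_cbox.
  rewrite (dseq_Dmulti s oO sP Ox) -(mdeg_count s); apply: hP; exact: obox_sub_cbox.
have [p hp] := choice ex.
exists (1 + \sum_a (p a).1), (1 + \sum_a (p a).2).
have g1 a : 0 <= (p a).1 by have [h _ _] := hp a; exact: ltW.
have g2 a : 0 <= (p a).2 by have [_ h _] := hp a; exact: ltW.
split; try by rewrite ltr_pwDl // sumr_ge0.
move=> a ad; have [_ _ /(_ ad)[sP bP]] := hp a; split=> //; apply: bdd_le bP => k.
have T0 := ltW (weight_gt0 hT k).
rewrite ler_wpM2r //; apply: ler_pM; rewrite ?exprn_ge0 //.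
  by rewrite (bigD1 a) //= addrCA lerDl addr_ge0 // sumr_ge0.
apply: lerXn2r; rewrite ?nnegrE ?addr_ge0 ?sumr_ge0 //.
by rewrite (bigD1 a) //= addrCA lerDl addr_ge0 // sumr_ge0.
Qed.

Lemma symbol_bnd U C h T P xi : open U -> 0 <= C -> 0 <= h -> (forall k, 0 <= T k) ->
  (forall a : mindex n d, (mdeg (mi a) <= d)%N -> bnd U C h T (P a)) ->
  exists2 C', 0 <= C' & bnd U C' h T (fun x => principal_symbol P x xi).
Proof.
move=> oU C0 h0 T0 bP.
pose z (a : mindex n d) : R[i] := \prod_(j < n) (xi 0 j)%:C ^+ a j.
pose B := C * (1 + \sum_a normc (z a)).
have B0 : 0 <= B by rewrite mulr_ge0 // addr_ge0 // sumr_ge0 // => a _; exact: normc_ge0.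
exists (B *+ size (index_enum (mindex n d))); first exact: mulrn_wge0.
apply: bnd_sum => // a /eqP ad.
have [sP bPa] : bnd U (normc (z a) * C) h T (fun x => z a * P a x).
  by apply: bndZ => //; apply: bP; rewrite ad.
have E x : z a * P a x = P a x * z a by rewrite mulrC.
have : bnd U (normc (z a) * C) h T (fun x => P a x * z a).
  split; first exact: (smooth_eq oU (fun x _ => E x) sP).
  exact: (bdd_eq oU (fun x _ => E x) bPa).
apply: bnd_le => // k; rewrite ler_wpM2r // mulrC ler_wpM2l //.
rewrite (bigD1 a) //= addrCA lerDl addr_ge0 // sumr_ge0 // => b _; exact: normc_ge0.
Qed.

Lemma vanishing_bound (q : 'rV[R]_n -> R[i]) y r (B t : R) : 0 <= B -> 0 < r ->
  smooth (obox y r) q -> q y = 0 ->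
  (forall j x, obox y r x -> normc (Dj j q x) <= B) ->
  t < r -> forall x, cbox y t x -> normc (q x) <= 2 * (B * (n%:R * t)).
Proof.
move=> B0 r0 sq qy Bq tr x xt.
have hs : \sum_(j < n) `|x 0 j - y 0 j| <= n%:R * t.
  by rewrite -[n in n%:R]card_ord mulr_natl -sumr_const; apply: ler_sum => j _.
have bound (F : 'rV[R]_n -> R) : F y = 0 ->
    (forall w, obox y r w -> forall j, derivable F w (basis_vec j) /\ `|'D_(basis_vec j) F w| <= B) ->
    `|F x| <= B * (n%:R * t).
  move=> Fy dF; rewrite -[F x]subr0 -Fy.
  apply: le_trans (coordinate_lipschitz (b := B) (rho := t) _ xt) _.
    by move=> w wt; apply: dF; exact: cbox_sub_obox wt.
  by rewrite ler_wpM2l.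
apply: le_trans (normc_le_ReIm _) _; rewrite mulr_natl mulr2n; apply: lerD.
  apply: (bound (re_part q)); first by rewrite /re_part qy.
  move=> w Uw j; have [_ _ /(_ j)[d1 _]] := sq [::] w Uw; split=> //.
  by rewrite -normrN -Im_Dj; apply: le_trans (Im_le_normc _) _; exact: Bq.
apply: (bound (im_part q)); first by rewrite /im_part qy.
move=> w Uw j; have [_ _ /(_ j)[_ d1]] := sq [::] w Uw; split=> //.
by rewrite -Re_Dj; apply: le_trans (Re_le_normc _) _; exact: Bq.
Qed.

End CoefficientBounds.

(** * The summands, their sum and its optimality *)

Section Construction.
Context {R : realType} {n : nat}.
Variables (M : nat -> R) (nu rho Hb : R) (x0 xi : 'rV[R]_n).
Hypotheses (hM : weight_sequence M) (hgamma : gamma_index M = +oo%E).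
Hypotheses (nu0 : 0 < nu) (rho0 : 0 < rho).
Hypotheses (Hb1 : 1 <= Hb) (Hbxi : forall j, `|xi 0 j| <= Hb) (Hbrho : (256 / rho) *+ n <= Hb).
Local Notation N := (wpow M nu).
Local Notation kap := (rfrq M nu).
Local Notation lam := (frq M nu).
Local Notation amp := (amp M nu).

(** Equal to 1 up to radius rho/(8 kap) and supported in radius rho/(4 kap), strictly inside the
    open box of radius rho/(2 kap) on which the symbol is controlled. *)
Definition plate k : 'rV[R]_n -> R[i] := plateau (8 * kap k / rho) x0.

Definition term k : 'rV[R]_n -> R[i] := fun x =>
  wave (lam k) xi x0 x * ((amp k)%:C * plate k x).

Definition plate_const : R := ((step 1)^-1 * (step 1)^-1) ^+ n.

Lemma plate_const_ge0 : 0 <= plate_const.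
Proof. by rewrite exprn_ge0 // mulr_ge0 // invr_ge0 ltW // step1_gt0. Qed.

Let k0 k : 0 < kap k. Proof. exact: rfrq_gt0. Qed.
Let l0 k : 0 < lam k. Proof. exact: frq_gt0. Qed.
Let a0 k : 0 < amp k. Proof. exact: amp_gt0. Qed.
Let Hb0 : 0 < Hb. Proof. exact: lt_le_trans Hb1. Qed.
Let p2 k : 0 < 2 ^+ k :> R. Proof. by rewrite exprn_gt0. Qed.

Let g0 m : 0 <= gev m ^+ 2 :> R. Proof. exact: sqr_ge0. Qed.

Lemma plate_gevrey k : gevrey plate_const (kap k * Hb) (plate k).
Proof.
have s0 : 0 <= 8 * kap k / rho by rewrite divr_ge0 ?mulr_ge0 // ltW.
have [sp bp] := plateau_gevrey x0 s0; split=> //; apply: bdd_le bp => m.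
rewrite ler_wpM2r // ler_wpM2l ?plate_const_ge0 //; apply: lerXn2r; rewrite ?nnegrE.
- by rewrite mulrn_wge0 // addr_ge0 // mulr_ge0.
- by rewrite mulr_ge0 // ltW.
(* 256 = (16 + 16) * 8: two steps of rate 16 per coordinate, scaled by 8 kap / rho. *)
rewrite (_ : _ *+ n = kap k * ((256 / rho) *+ n)); first by rewrite ler_pM2l.
rewrite mulrnAr; set a := (X in X *+ n = _); rewrite (_ : a = kap k * (256 / rho)) //.
by rewrite /a; field; rewrite gt_eqF.
Qed.

Lemma plate_supported k : supported_in (cbox x0 (rho / (4 * kap k))) (plate k).
Proof.
move=> x /existsNP[j /negP]; rewrite -ltNge => h; apply: (@plateau0 _ _ _ _ _ j).
rewrite normrM (ger0_norm (_ : 0 <= 8 * kap k / rho)); last by rewrite divr_ge0 ?mulr_ge0 // ltW.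
rewrite mulrC -ler_pdivrMr ?divr_gt0 ?mulr_gt0 //; apply: le_trans (ltW h).
rewrite le_eqVlt; apply/orP; left; apply/eqP; field.
by rewrite !gt_eqF.
Qed.

Lemma plate1 k x : cbox x0 (rho / (8 * kap k)) x -> plate k x = 1.
Proof.
move=> h; apply: plateau1 => j; rewrite normrM (ger0_norm (_ : 0 <= 8 * kap k / rho)); last first.
  by rewrite divr_ge0 ?mulr_ge0 // ltW.
rewrite mulrC -ler_pdivlMr ?divr_gt0 ?mulr_gt0 //; apply: le_trans (h j) _.
by rewrite mul1r invf_div.
Qed.

Lemma smooth_scaled_plate k : smooth setT (fun x => (amp k)%:C * plate k x).
Proof. by have [sp _] := plate_gevrey k; exact: (smoothM openT (smooth_cst _ openT) sp). Qed.

Lemma smooth_term k : smooth setT (term k).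
Proof. exact: (smoothM openT (@smooth_wave _ _ (lam k) xi x0 setT) (smooth_scaled_plate k)). Qed.

Lemma term_supported k : supported_in (cbox x0 (rho / (4 * kap k))) (term k).
Proof. by move=> x hx; rewrite /term plate_supported // mulr0 mulr0. Qed.

Lemma term_bdd : exists C L : R, [/\ 0 < C, 0 < L &
  forall k, bdd setT (fun m => C * L ^+ m * N m / 2 ^+ k) (term k)].
Proof.
have nu2 : 0 < nu / 2 by rewrite divr_gt0.
(* The Gevrey constants of the cutoff must fit below M^(nu/2), the room that [amp_gevrey] leaves. *)
have [C [h [C0 h0 hC]]] := wle_gev hM hgamma 2 nu2.
exists ((plate_const + 1) * C), (Hb + Hb * h); split.
- by rewrite mulr_gt0 // ltr_wpDl ?plate_const_ge0.
- by rewrite addr_gt0 // mulr_gt0.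
move=> k; have [sp bp] := plate_gevrey k.
have bw : bdd setT (fun m => (lam k * Hb) ^+ m) (wave (lam k) xi x0).
  move=> s x _; rewrite dseq_wave normcM normc_wave mulr1.
  elim: s => [|j s IH]; first by rewrite big_nil ComplexField.Normc.normc1.
  rewrite big_cons normcM -[size (j :: s)]/(size s).+1 exprS; apply: ler_pM; rewrite ?normc_ge0 //.
  by rewrite normc_real normrM (ger0_norm (ltW (l0 k))) ler_pM2l.
have bs := bddZ (amp k)%:C openT sp bp.
apply: bdd_le (bddM openT (@smooth_wave _ _ (lam k) xi x0 setT) (smooth_scaled_plate k) bw bs) => m.
rewrite (_ : (plate_const + 1) * C * (Hb + Hb * h) ^+ m * N m / 2 ^+ k =
  ((plate_const + 1) * C / 2 ^+ k) * (Hb + Hb * h) ^+ m * N m); last by ring.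
apply: lconv_le => i j.
rewrite normc_real (ger0_norm (ltW (a0 k))) !exprMn.
have := @amp_gevrey _ M hM nu nu0 (fun m => gev m ^+ 2) C h k i j (ltW C0) (ltW h0) (g0 j) (hC j) => key.
rewrite [leLHS](_ : _ = plate_const * (Hb ^+ i * Hb ^+ j * (amp k * lam k ^+ i * kap k ^+ j * gev j ^+ 2))); last first.
  move: (lam k ^+ i) (Hb ^+ i) (Hb ^+ j) (kap k ^+ j) (gev j ^+ 2) => *; ring.
rewrite [leRHS](_ : _ = (plate_const + 1) * (Hb ^+ i * Hb ^+ j * (C * h ^+ j * N (i + j)%N / 2 ^+ k))); last first.
  move: (Hb ^+ i) (Hb ^+ j) (h ^+ j) => *; ring.
have HH : 0 <= Hb ^+ i * Hb ^+ j by rewrite mulr_ge0 // exprn_ge0 // ltW.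
apply: ler_pM; [exact: plate_const_ge0| |by rewrite lerDl|by rewrite ler_wpM2l].
have l1 := ltW (l0 k); have k1 := ltW (k0 k); have a1 := ltW (a0 k).
exact: (mulr_ge0 HH (mulr_ge0 (mulr_ge0 (mulr_ge0 a1 (exprn_ge0 i l1)) (exprn_ge0 j k1)) (g0 j))).
Qed.

Lemma normal_term : normal term.
Proof.
have [C [L [_ _ b]]] := term_bdd; exists (fun m => C * L ^+ m * N m) => k.
by split; [exact: smooth_term|exact: b].
Qed.

(** Near [x0] the cutoff is 1, so only the wave is differentiated. *)
Lemma term_center s k :
  dseq s (term k) x0 = (amp k)%:C * \prod_(j <- s) (lam k * xi 0 j)%:C.
Proof.
have r0 : 0 < rho / (8 * kap k) by rewrite divr_gt0 // mulr_gt0.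
have oB := @open_obox _ _ x0 _ r0.
rewrite (dseq_eq (g := fun x => (amp k)%:C * wave (lam k) xi x0 x) s oB _ (obox_center x0 r0)).
  rewrite (dseqZ _ s oB (@smooth_wave _ _ (lam k) xi x0 _) (obox_center x0 r0)) dseq_wave wave_center mulr1.
  by [].
by move=> x hx; rewrite /term plate1 ?mulr1; [rewrite mulrC|exact: obox_sub_cbox].
Qed.

Definition optfun : 'rV[R]_n -> R[i] := csum term.

Lemma smooth_optfun U : smooth U optfun.
Proof. exact: smooth_subset (smooth_csum normal_term). Qed.

Lemma roumieu_optfun Om : roumieu Om N optfun.
Proof.
split; first exact: smooth_optfun.
have [C [L [C0 L0 b]]] := term_bdd.
move=> K _ _; exists (4 * C), L; split; rewrite ?mulr_gt0 //.
move=> a x _; rewrite Dmulti_mseq -size_mseq (dseq_csum _ normal_term).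
rewrite -!mulrA (mulrA C); apply: zsum_le => k; exact: (b k (mseq a) x Logic.I).
Qed.

(** No cancellation at [x0]: all summands contribute xi_j^m times a positive number, so the sum
    dominates its term of index m, which is a_m lam_m^m = N_m / 2^m. *)
Lemma optfun_lower m j : `|xi 0 j| ^+ m * N m / 2 ^+ m <= normc (dseq (nseq m j) optfun x0).
Proof.
have ge : geo (N m) (fun k => amp k * lam k ^+ m).
  move=> k; rewrite ger0_norm; first exact: amp_frq.
  by rewrite mulr_ge0 ?exprn_ge0 // ltW.
have gc : cgeo (N m) (fun k => (amp k * lam k ^+ m)%:C) by move=> k; rewrite normc_real.
rewrite (dseq_csum _ normal_term) /csum.
have -> : (fun k => dseq (nseq m j) (term k) x0) = (fun k => (xi 0 j ^+ m)%:C * (amp k * lam k ^+ m)%:C).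
  apply/funext => k; rewrite term_center big_nseq -/(GRing.exp _ _).
  rewrite (_ : iter m _ 1 = (lam k * xi 0 j)%:C ^+ m); last first.
    by elim: m {ge gc} => [//|m IH]; rewrite iterS IH exprS.
  rewrite -rmorphXn -!rmorphM /=; congr (_%:C); rewrite exprMn.
  by move: (xi 0 j ^+ m) (lam k ^+ m) => *; ring.
rewrite (zsumZ _ gc) normcM normc_real normrX -mulrA ler_wpM2l ?exprn_ge0 //.
rewrite -(amp_frq_diag hM nu0).
apply: le_trans (Re_le_normc _) => /=.
apply: le_trans (ler_norm _).
apply: (rsum_ge_term m ge) => k; by rewrite mulr_ge0 ?exprn_ge0 // ltW.
Qed.

(** An estimate by [S] at the single point [x0], along the single direction [j], already forces N_m
    <= C (2h / |xi_j|)^m S_m. *)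
Lemma optimal_optfun Om j : Om x0 -> xi 0 j != 0 -> optimal Om N optfun.
Proof.
move=> Ox xj; split; first exact: roumieu_optfun.
move=> S hS [_ hn] [_ /(_ [set x0] (@compact_set1 _ _))].
have sub : [set x0] `<=` Om by move=> _ ->.
move=> /(_ sub)[C [h [C0 h0 hC]]]; apply: hn.
have xj0 : 0 < `|xi 0 j| by rewrite normr_gt0.
exists C, (2 * h / `|xi 0 j|); split=> //; first by rewrite divr_gt0 // mulr_gt0.
move=> m; have := hC (fun i => count_mem i (nseq m j)) x0 erefl.
rewrite -(dseq_Dmulti _ openT (smooth_optfun (U := setT)) Logic.I) mdeg_count size_nseq => h2.
have := le_trans (optfun_lower m j) h2; rewrite ler_pdivrMr // mulrC -ler_pdivlMr ?exprn_gt0 //.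
move=> h3; apply: le_trans h3 _; rewrite le_eqVlt; apply/orP; left; apply/eqP.
rewrite expr_div_n exprMn; field; by rewrite gt_eqF // exprn_gt0.
Qed.

End Construction.

(** * Iterates of the operator on the optimal function *)

Section Iterates.
Context {R : realType} {n d : nat}.

(** In order 0 the gain 1/kap comes from the zero at the centre and the radius of the box; in order
    k >= 1 it is paid by the larger rate, since (kap h)^k / kap >= h^k. *)
Lemma vanishing_bnd (q : 'rV[R]_n -> R[i]) y (rho C h kap : R) (T : nat -> R) :
  0 < rho -> 1 <= kap -> 0 <= C -> 0 <= h -> weight_sequence T ->
  bnd (obox y rho) C h T q -> q y = 0 ->
  bnd (obox y (rho / (2 * kap))) ((C + n%:R * rho * C * h * T 1%N) / kap) (kap * h) T q.
Proof.
move=> rho0 kap1 C0 h0 hT [sq bq] qy; have kap0 : 0 < kap by exact: lt_le_trans kap1.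
have T0 k : 0 <= T k := ltW (weight_gt0 hT k).
have tr : rho / (2 * kap) < rho.
  by rewrite ltr_pdivrMr ?mulr_gt0 // ltr_pMr //; have := kap1; lra.
split; first exact: smooth_subset (obox_sub (ltW tr)) sq.
move=> s x Ux; have Ux' : obox y rho x by exact: obox_sub (ltW tr) _ Ux.
have E0 : 0 <= n%:R * rho * C * h * T 1%N by rewrite !mulr_ge0 // ltW.
case: s => [|j s].
  have B0 : 0 <= C * h * T 1%N by rewrite !mulr_ge0.
  have Bq j z : obox y rho z -> normc (Dj j q z) <= C * h * T 1%N by exact: (bq [:: j] z).
  apply: le_trans (vanishing_bound B0 rho0 sq qy Bq tr (obox_sub_cbox Ux)) _.
  rewrite expr0 mulr1 (weight0 hT) mulr1.
  rewrite [leLHS](_ : _ = n%:R * rho * C * h * T 1%N / kap); last by field; rewrite gt_eqF.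
  by rewrite ler_pM2r ?invr_gt0 // lerDr.
apply: le_trans (bq (j :: s) x Ux') _.
have k1 : 1 <= kap ^+ size s by rewrite exprn_ege1.
have e : (kap * h) ^+ size (j :: s) = kap * (kap ^+ size s * h ^+ size (j :: s)).
  by rewrite (exprMn _ kap h) (exprS kap) mulrA.
rewrite e ler_wpM2r // [leRHS](_ : _ = (C + n%:R * rho * C * h * T 1%N) * kap ^+ size s * h ^+ size (j :: s)).
  rewrite ler_wpM2r ?exprn_ge0 // -[leLHS]mulr1; apply: ler_pM; [exact: C0|exact: ler01| |exact: k1].
  by rewrite lerDl.
by move: (kap ^+ _) (h ^+ _) => p q'; field; rewrite gt_eqF.
Qed.

Variables (M T : nat -> R) (nu rho Hb C h : R) (x0 xi : 'rV[R]_n) (P : diffop R n d).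
Hypotheses (hM : weight_sequence M) (hgamma : gamma_index M = +oo%E) (hT : weight_sequence T).
Hypotheses (nu0 : 0 < nu) (rho0 : 0 < rho) (C0 : 0 < C) (h0 : 0 < h) (d0 : (0 < d)%N).
Hypotheses (Hb1 : 1 <= Hb) (Hbxi : forall j, `|xi 0 j| <= Hb) (Hbrho : (256 / rho) *+ n <= Hb).
Hypothesis bP : forall a : mindex n d, (mdeg (mi a) <= d)%N -> bnd (obox x0 rho) C h T (P a).
Hypothesis bq : forall kap, 1 <= kap ->
  bnd (obox x0 (rho / (2 * kap))) (C / kap) (kap * h) T (fun x => principal_symbol P x xi).
Local Notation sc := (@step_const R n d C).
Local Notation theta := (1 - (2 * d%:R)^-1).

(** One weight for cutoff and coefficients together, stable under multiplication by the latter. *)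
Let W k := T k * gev k ^+ 2.

Let T0 k : 0 < T k. Proof. exact: weight_gt0. Qed.
Let T1 k : 1 <= T k. Proof. exact: weight_ge1. Qed.
Let g1 k : 1 <= gev k :> R. Proof. exact: gev_ge1. Qed.
Let g0 k : 0 <= gev k :> R. Proof. exact: le_trans (gev_ge1 k). Qed.
Let W0 k : 0 <= W k. Proof. by rewrite mulr_ge0 ?sqr_ge0 // ltW. Qed.
Let Hb0 : 0 < Hb. Proof. exact: lt_le_trans Hb1. Qed.

Let mW : mono W.
Proof.
move=> i j ij; apply: ler_pM; rewrite ?sqr_ge0 ?(ltW (T0 i)) //; first exact: weight_homo.
by apply: lerXn2r; rewrite ?nnegrE // gev_homo.
Qed.

Let TW i j : T i * W j <= W (i + j)%N.
Proof.
rewrite /W mulrA; apply: ler_pM; [by rewrite mulr_ge0 // ltW|exact: sqr_ge0|exact: weight_supermul|].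
by apply: lerXn2r; rewrite ?nnegrE // gev_homo // leq_addl.
Qed.

Lemma step_const_ge0 : 0 <= sc.
Proof. by rewrite /step_const !mulr_ge0 ?exprn_ge0 ?addr_ge0 ?mulrn_wge0 // ltW. Qed.

(** Of the three factors [gev], two come from the cutoff and one from the growth of the rate during
    the m steps. *)
Definition iter_const m : R :=
  @plate_const R n * (sc * (Hb + h) ^+ d) ^+ m * (T (d * m)%N * gev (d * m) ^+ 3) *
  wpow M (nu * theta) (d * m).

Lemma iter_const_ge0 m : 0 <= iter_const m.
Proof.
have pc0 := @plate_const_ge0 R n; have s0 := step_const_ge0; have t0 := ltW (T0 (d * m)%N).
have H0 : 0 <= Hb + h by rewrite addr_ge0 // ltW.
rewrite /iter_const mulr_ge0 //; last exact: ltW (wpow_gt0 hM _ _).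
by rewrite mulr_ge0 // mulr_ge0 // exprn_ge0 // mulr_ge0 // exprn_ge0.
Qed.

Lemma term_iterate k m x :
  normc (iter m (papp P) (term M nu rho x0 xi k) x) <= iter_const m / 2 ^+ k.
Proof.
have kap1 := rfrq_ge1 hM nu0 k; have kap0 := rfrq_gt0 hM nu0 k.
have a0 := amp_gt0 hM nu0 k; have pc0 := @plate_const_ge0 R n; have s0 := step_const_ge0.
have wp0 r i : 0 <= wpow M r i by exact: ltW (wpow_gt0 hM r i).
have p20 : 0 < 2 ^+ k :> R by rewrite exprn_gt0.
(* The symbol is small only close to [x0]; off the support of the summand its iterates vanish. *)
have [Kx|Kx] := pselect (cbox x0 (rho / (4 * rfrq M nu k)) x); last first.
  rewrite (supported_iter_papp P m (@closed_cbox _ _ _ _) (term_supported xi hM nu0 rho0 (k := k)) Kx).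
  by rewrite ComplexField.Normc.normc0 divr_ge0 ?(ltW p20) // iter_const_ge0.
set kap := rfrq M nu k in kap1 kap0 Kx *; pose U := obox x0 (rho / (2 * kap)).
have t0 : 0 < rho / (2 * kap) by rewrite divr_gt0 ?mulr_gt0.
have oU : open U by exact: open_obox.
have Ux : U x.
  apply: cbox_sub_obox Kx; rewrite ltr_pM2l // ltf_pV2 ?posrE ?mulr_gt0 //.
  by rewrite ltr_pM2r // ltr_nat.
have tr : rho / (2 * kap) <= rho.
  by rewrite ler_pdivrMr ?mulr_gt0 // ler_peMr ?(ltW rho0) //; have := kap1; lra.
have bPU (a : mindex n d) : (mdeg (mi a) <= d)%N -> bnd U C (kap * h) T (P a).
  move=> ad; have [sa ba] := bP ad; split; first exact: smooth_subset (obox_sub tr) sa.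
  apply: bdd_le (bdd_subset (obox_sub tr) ba) => i; rewrite ler_wpM2r ?(ltW (T0 i)) //.
  rewrite ler_wpM2l ?(ltW C0) //; apply: lerXn2r; rewrite ?nnegrE ?mulr_ge0 ?(ltW h0) ?(ltW kap0) //.
  by rewrite ler_peMl // ltW.
pose v x := (amp M nu k)%:C * plate M nu rho x0 k x.
have sv : smooth U v := smooth_subset (@subsetT _ U) (smooth_scaled_plate x0 hM nu0 rho0 Hb1 Hbrho k).
have [sp bp] := plate_gevrey x0 hM nu0 rho0 Hb1 Hbrho k.
have bv : bnd U (amp M nu k * @plate_const R n) (kap * Hb) W v.
  split=> //; apply: bdd_subset (@subsetT _ U) _; apply: bdd_le (bddZ (amp M nu k)%:C openT sp bp) => i.
  rewrite normc_real (ger0_norm (ltW a0)) [leLHS](_ : _ = amp M nu k * @plate_const R n * (kap * Hb) ^+ i * gev i ^+ 2).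
    have Y0 : 0 <= (kap * Hb) ^+ i by rewrite exprn_ge0 // mulr_ge0 // ltW.
    have A0 : 0 <= amp M nu k * @plate_const R n by rewrite mulr_ge0 // ltW.
    apply: ler_wpM2l; first exact: mulr_ge0.
    by rewrite /W ler_peMl ?sqr_ge0.
  by rewrite !mulrA.
have sP : smooth_coefs U P by move=> a ad; have [] := bPU a ad.
rewrite (@iter_papp_waveM _ _ _ U (frq M nu k) xi x0 oU P v m x sP sv Ux) normcM normc_wave mul1r.
have [_ /(_ [::] x Ux)] := bnd_iter_plam oU kap1 Hb1 Hbxi (ltW C0) (ltW h0) W0 mW TW bPU
  (bq kap1) m (mulr_ge0 (ltW a0) pc0) bv.
rewrite /= add0n expr0 mulr1 (rfrq_sqr hM) => key; apply: le_trans key _.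
have key2 := amp_iter hM nu0 k m d0.
(* From Hb + m h <= (Hb + h)(dm + 1), raised to the power dm. *)
have Hg : (Hb + m%:R * h) ^+ (d * m) <= (Hb + h) ^+ (d * m) * gev (d * m).
  rewrite /gev -exprMn; apply: lerXn2r; rewrite ?nnegrE ?mulr_ge0 ?addr_ge0 ?mulr_ge0 ?(ltW Hb0) ?(ltW h0) //.
  rewrite mulrDl; apply: lerD; first by rewrite ler_peMr ?(ltW Hb0) // ler1n.
  by rewrite mulrC ler_wpM2l ?(ltW h0) // ler_nat ltnW // ltnS leq_pmull.
rewrite -/kap in key2 *.
have e1 : (frq M nu k ^+ d / kap) ^+ m = frq M nu k ^+ (d * m) / kap ^+ m.
  by rewrite expr_div_n exprM.
have e2 : (sc * (Hb + h) ^+ d) ^+ m = sc ^+ m * (Hb + h) ^+ (d * m).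
  by rewrite (exprMn _ sc) exprM.
rewrite e1 /iter_const e2 /W.
have a1 : 0 <= amp M nu k * frq M nu k ^+ (d * m) / kap ^+ m.
  have f0 := ltW (frq_gt0 hM nu0 k); have k0 := ltW kap0.
  by rewrite divr_ge0 ?exprn_ge0 // mulr_ge0 ?exprn_ge0 // ltW.
have b1 : 0 <= (Hb + m%:R * h) ^+ (d * m).
  by rewrite exprn_ge0 // addr_ge0 ?mulr_ge0 // ltW.
have c1 : 0 <= @plate_const R n * sc ^+ m * T (d * m)%N * gev (d * m) ^+ 2.
  exact: (mulr_ge0 (mulr_ge0 (mulr_ge0 pc0 (exprn_ge0 m s0)) (ltW (T0 _))) (sqr_ge0 _)).
have := ler_wpM2l c1 (ler_pM b1 a1 Hg key2).
rewrite (_ : gev (d * m) ^+ 3 = gev (d * m) * gev (d * m) ^+ 2); last by rewrite exprS.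
move: (wpow M _ _) (gev (d * m)) (gev (d * m) ^+ 2) (frq M nu k ^+ _) (kap ^+ m) (2 ^+ k)
  (sc ^+ m) ((Hb + m%:R * h) ^+ (d * m)) ((Hb + h) ^+ (d * m)) (T (d * m)%N) => z1 z3 z2 z4 z5 z6 z7 z8 z9 z10.
move=> key3; apply: le_trans (_ : _ <= @plate_const R n * z7 * z10 * z2 * (z8 * (amp M nu k * z4 / z5))) _.
  by rewrite le_eqVlt; apply/orP; left; apply/eqP; ring.
apply: le_trans key3 _.
by rewrite le_eqVlt; apply/orP; left; apply/eqP; ring.
Qed.

Lemma iter_papp_optfun m x :
  normc (iter m (papp P) (optfun M nu rho x0 xi) x) <= 4 * iter_const m.
Proof.
have nf := normal_term x0 hM hgamma nu0 rho0 Hb1 Hbxi Hbrho.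
have r4 : rho / 4 < rho by rewrite ltr_pdivrMr // ltr_pMr // ltr1n.
have sK k : supported_in (cbox x0 (rho / 4)) (term M nu rho x0 xi k).
  move=> z hz; apply: (term_supported xi hM nu0 rho0 (k := k)) => hz'; apply: hz.
  apply: cbox_sub hz'; rewrite ler_pM2l // lef_pV2 ?posrE ?mulr_gt0 ?rfrq_gt0 //.
  by rewrite ler_peMr // rfrq_ge1.
have [_ ->] := iter_papp_csum m (open_obox (y := x0) rho0) (@closed_cbox _ _ _ _)
  (@cbox_sub_obox _ _ x0 _ _ r4) (ex_intro _ x0 (obox_center x0 rho0)) bP sK nf.
by apply: zsum_le => k; exact: term_iterate.
Qed.

Lemma iter_const_absorb : (forall r, 0 < r -> wle T (wpow M r)) -> nu * theta < 1 ->
  forall h', 0 < h' -> exists2 A, 0 < A & forall m, 4 * iter_const m <= A * h' ^+ m * M (d * m)%N.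
Proof.
move=> hTM s1 h' h'0; have pc0 := @plate_const_ge0 R n; have s0 := step_const_ge0.
have B0 : 0 <= sc * (Hb + h) ^+ d by rewrite mulr_ge0 // exprn_ge0 // addr_ge0 // ltW.
have G0 k : 0 <= gev k ^+ 3 :> R by rewrite exprn_ge0.
have V0 k : 0 <= T k * gev k ^+ 3 by rewrite mulr_ge0 // ltW.
have hV r : 0 < r -> wle (fun k => T k * gev k ^+ 3) (wpow M r).
  move=> r0; have r2 : 0 < r / 2 by rewrite divr_gt0.
  rewrite (splitr r); apply: (wleM hM (fun k => ltW (T0 k)) G0); first exact: hTM.
  exact: wle_gev.
(* The constants are only known to be nonnegative; adding 1 makes them positive. *)
have [A A0 hA] := @wle_absorb _ M hM hgamma (nu * theta) (@plate_const R n + 1) (sc * (Hb + h) ^+ d + 1) h' _ d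
  d0 V0 hV s1 (ltr_wpDl pc0 ltr01) (ltr_wpDl B0 ltr01) h'0.
exists (4 * A); first by rewrite mulr_gt0.
move=> m; rewrite -!mulrA ler_pM2l // mulrA; apply: le_trans (hA m).
rewrite /iter_const ler_wpM2r ?(ltW (wpow_gt0 hM _ _)) // ler_wpM2r //.
apply: ler_pM; [exact: pc0|exact: exprn_ge0|by rewrite lerDl|].
by apply: lerXn2r; rewrite ?nnegrE ?lerDl // addr_ge0.
Qed.

End Iterates.

Theorem corollary5p5 (R : realType) (n d : nat) (M T : nat -> R)
    (Om : set 'rV[R]_n) (P : diffop R n d)
    (hM : weight_sequence M)
    (hgamma : gamma_index M = +oo%E)
    (hsup : (ereal_sup [set (wquot M k `^ (k%:R^-1))%:E
                         | k in [set k : nat | (1 <= k)%N]] < +oo)%E)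
    (hT : weight_sequence T)
    (hTM : forall rho : R, 0 < rho -> wle T (wpow M rho))
    (hOm : open Om)
    (hd : (1 <= d)%N)
    (hP : has_order Om P)
    (hcoef : coefs_in Om T P)
    (hnell : ~ elliptic Om P) :
  exists (u : 'rV[R]_n -> R[i]) (nu : R),
    [/\ smooth Om u,
        1 < nu,
        beurling_iterates Om P M (regular_dist Om u),
        ~ roumieu Om M u &
        optimal Om (wpow M nu) u].
Proof.
have [x0 [xi [Ox0 xi0 sym0]]] : exists x xi : 'rV[R]_n,
    [/\ Om x, xi != 0 & principal_symbol P x xi = 0].
  apply: contrapT => h; apply: hnell => x xi Ox xi0; apply/eqP => e.
  by apply: h; exists x, xi.
have [j xij] : exists j, xi 0 j != 0.
  apply: contrapT => h; move/eqP: xi0; apply; apply/rowP => j; rewrite mxE.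
  by apply/eqP/negPn/negP => e; apply: h; exists j.
have [rho rho0 rO] := open_cbox hOm Ox0.
have oU := open_obox (y := x0) rho0.
have [C1 [h [C10 h0 bP1]]] := coefs_bdd hOm rho0 rO hcoef hT.
have T0 k : 0 <= T k := ltW (weight_gt0 hT k).
have [C2 C20 bq1] := symbol_bnd xi oU (ltW C10) (ltW h0) T0 bP1.
(* One constant for the coefficients and for the symbol on the shrinking boxes. *)
pose C := C1 + (C2 + n%:R * rho * C2 * h * T 1%N).
have E0 : 0 <= n%:R * rho * C2 * h * T 1%N.
  exact: (mulr_ge0 (mulr_ge0 (mulr_ge0 (mulr_ge0 (ler0n _ _) (ltW rho0)) C20) (ltW h0)) (T0 _)).
have C0 : 0 < C by rewrite ltr_pwDl // addr_ge0.
have bP (a : mindex n d) : (mdeg (mi a) <= d)%N -> bnd (obox x0 rho) C h T (P a).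
  move=> ad; apply: bnd_le (bP1 a ad) => [|k]; first exact: ltW.
  by rewrite ler_wpM2r // lerDl addr_ge0.
have bq kap : 1 <= kap ->
    bnd (obox x0 (rho / (2 * kap))) (C / kap) (kap * h) T (fun x => principal_symbol P x xi).
  move=> kap1; have kap0 : 0 < kap by exact: lt_le_trans kap1.
  apply: bnd_le (vanishing_bnd rho0 kap1 C20 (ltW h0) hT bq1 sym0) => [|k].
    by rewrite mulr_ge0 // ltW.
  by rewrite ler_wpM2r // ler_pM2r ?invr_gt0 // lerDr ltW.
(* Dominates 1, the rate of the cutoffs and the coordinates of [xi]. *)
pose Hb := 1 + (256 / rho) *+ n + \sum_j `|xi 0 j|.
have S0 : 0 <= \sum_j `|xi 0 j| by rewrite sumr_ge0.
have Q0 : 0 <= (256 / rho) *+ n by exact: mulrn_wge0 (divr_ge0 (ler0n _ _) (ltW rho0)).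
have Hb1 : 1 <= Hb by rewrite /Hb -addrA lerDl addr_ge0.
have Hbrho : (256 / rho) *+ n <= Hb by rewrite /Hb addrAC lerDr addr_ge0.
have Hbxi i : `|xi 0 i| <= Hb.
  rewrite /Hb (bigD1 i) //= addrCA lerDl !addr_ge0 // sumr_ge0 //.
pose nu : R := 1 + (4 * d%:R)^-1.
have d0 : 0 < d%:R :> R by rewrite ltr0n.
have nu1 : 1 < nu by rewrite ltrDl invr_gt0 mulr_gt0.
have nu0 : 0 < nu by exact: lt_trans nu1.
have nuth : nu * (1 - (2 * d%:R)^-1) < 1.
  (* With e = 1/d the product is (1 + e/4)(1 - e/2) = 1 - e/4 - e^2/8. *)
  rewrite /nu; have : 0 < (d%:R)^-1 :> R by rewrite invr_gt0.
  rewrite !invfM; move: (d%:R^-1) => e e0.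
  have : 0 < e * e by rewrite mulr_gt0.
  by lra.
have opt := optimal_optfun hM hgamma nu0 rho0 Hb1 Hbxi Hbrho Ox0 xij.
set u := optfun M nu rho x0 xi in opt.
have su : smooth Om u := smooth_optfun x0 hM hgamma nu0 rho0 Hb1 Hbxi Hbrho (U := Om).
have sP : smooth_coefs Om P by move=> a ad; have [] := hcoef a ad.
exists u, nu; split=> //; last first.
  (* Optimality is tested on M itself, which lies strictly below M^nu. *)
  by have [_ /(_ M hM (wlt_wpow hM hgamma nu1))] := opt.
split; first exact: regular_dist_distribution.
have sg k : smooth Om (iter k (papp P) u) by exact: smooth_iter_papp.
have meas K k : compact K -> K `<=` Om ->
    measurable_fun (rV_of_tuple @^-1` K) (re_part (iter k (papp P) u) \o rV_of_tuple) /\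
    measurable_fun (rV_of_tuple @^-1` K) (im_part (iter k (papp P) u) \o rV_of_tuple).
  move=> cK KO; have [mr mi'] := smooth_measurable_on hOm (sg k).
  by split; [apply: measurable_funS mr|apply: measurable_funS mi'] => //;
    [exact: open_rV_measurable|move=> t /KO|exact: open_rV_measurable|move=> t /KO].
exists (fun k => iter k (papp P) u); split=> [k|K cK KO h' h'0].
  split; last by move=> phi tphi; exact: iter_apply_op.
  split; first exact: smooth_measurable_on hOm (sg k).
  move=> K cK KO; have [B B0 hB] := smooth_bounded_compact (sg k) cK KO.
  have [mr mi'] := meas K k cK KO.
  by apply: le_lt_trans (L2norm_le cK B0 mr mi' hB) _; rewrite ltry.
have [A A0 hA] := iter_const_absorb (n := n) hM hgamma hT C0 h0 hd Hb1 hTM nuth h'0.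
set mK := Num.sqrt (fine (lebesgue_nd n (rV_of_tuple @^-1` K))).
have mK0 : 0 <= mK := sqrtr_ge0 _.
exists (A * (mK + 1)); first by rewrite mulr_gt0 // ltr_wpDl.
move=> k; have [mr mi'] := meas K k cK KO.
have M0 := weight_gt0 hM (d * k).
have B0 : 0 <= A * h' ^+ k * M (d * k)%N by rewrite !mulr_ge0 ?exprn_ge0 // ltW.
have hB x : K x -> normc (iter k (papp P) u x) <= A * h' ^+ k * M (d * k)%N.
  move=> _; apply: le_trans (hA k).
  exact: (iter_papp_optfun hM hgamma hT nu0 rho0 C0 h0 hd Hb1 Hbxi Hbrho bP bq).
have := L2norm_le cK B0 mr mi' hB; move=> key; apply: (le_trans key); rewrite lee_fin -/mK.
rewrite [leRHS](_ : _ = A * h' ^+ k * M (d * k)%N * (mK + 1)); last by ring.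
by rewrite ler_wpM2l // lerDl.
Qed.
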